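(* Fix $0<p<1$. Let $\mu$ be an even finite Borel measure on $\mathbb{R}^n$ such that (1) $\int|x|\,\mathrm{d}\mu(x)<\infty$, and (2) $\mu$ is not supported on any hyperplane. Then there exist $c>0$ and an even function $f\in\mathrm{LC}_n$ with $h_f\ge0$ such that $S_{f,p}=c\cdot\mu$.
   Context: A measure $\mu$ on $\mathbb{R}^n$ is even if $\mu(-A)=\mu(A)$ for all Borel $A$; a function $f$ is even if $f(-x)=f(x)$. $\mathrm{LC}_n$ is the class of all upper semi-continuous log-concave functions $f:\mathbb{R}^n\to[0,\infty)$; every such $f$ is $f=e^{-\phi}$ with $\phi:\mathbb{R}^n\to(-\infty,\infty]$ convex and lower semi-continuous. The support function of $f=e^{-\phi}$ is the Legendre transform $h_f(y)=\phi^{\ast}(y)=\sup_{x\in\mathbb{R}^n}(\langle x,y\rangle-\phi(x))$. Surface area measure: for $f=e^{-\phi}\in\mathrm{LC}_n$, $S_f$ is the push-forward of $f\,\mathrm{d}x$ under $\nabla\phi$ (which exists $f\,\mathrm{d}x$-a.e.), i.e. $S_f(A)=\int_{\{x:\nabla\phi(x)\in A\}}f\,\mathrm{d}x$ for Borel $A$. $L^p$-surface area measure: for $0<p<1$ and $f\in\mathrm{LC}_n$ with $0<\int f<\infty$ (and $h_f\ge0$), $S_{f,p}$ is the measure with density $h_f^{1-p}$ with respect to $S_f$, i.e. $\mathrm{d}S_{f,p}=h_f^{1-p}\,\mathrm{d}S_f$ (here $h_f<\infty$ holds $S_f$-almost everywhere). Since $S_{f,p}$ is only defined when $0<\int f<\infty$,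 the existence of $f$ includes this property. *)

(* Defs.v *)
From HB Require Import structures.
From mathcomp Require Import all_boot all_order all_algebra.
From mathcomp Require Import all_classical all_reals all_analysis.

Set Implicit Arguments.
Unset Strict Implicit.
Unset Printing Implicit Defensive.

Import Order.TTheory GRing.Theory Num.Theory.
Import numFieldNormedType.Exports.

Local Open Scope classical_set_scope.
Local Open Scope ring_scope.

(* Points of R^n are row vectors; the sigma-algebra on 'rV[R]_n is the Borel
   one, generated by the open sets. *)
HB.instance Definition _ (R : realType) (n : nat) :=
  @isMeasurable.Build (sigma_display (@open 'rV[R]_n)) 'rV[R]_n
    <<s @open 'rV[R]_n >> (@sigma_algebra0 _ setT _) (@sigma_algebraC _ _)
    (@sigma_algebra_bigcup _ setT _).

Lemma countable_bigcup_measurable d (T : sigmaRingType d) (I : countType)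
    (P : set I) (F : I -> set T) :
  (forall i, measurable (F i)) -> measurable (\bigcup_(i in P) F i).
Proof.
move=> mF.
have -> : \bigcup_(i in P) F i = \bigcup_k
    (if unpickle k is Some i then if i \in P then F i else set0 else set0).
  apply/seteqP; split => [z [i Pi Fz]|z [k _]].
    by exists (pickle i) => //; rewrite pickleK mem_set.
  by case: unpickle => // i; case: ifPn => // /set_mem Pi Fz; exists i.
apply: bigcupT_measurable => k.
by case: unpickle => // i; case: ifP.
Qed.

Section boxes.
Context {R : realType}.

Definition open_box n (a b : 'I_n -> R) : set 'rV[R]_n :=
  [set x | forall i, a i < x ord0 i < b i].

Lemma open_rV_measurable n (U : set 'rV[R]_n) : open U -> measurable U.
Proof. exact: sub_sigma_algebra. Qed.

Lemma open_box_open n (a b : 'I_n -> R) : open (open_box a b).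
Proof.
rewrite openE => x bx; exists (fun _ j => `]a j, b j[%classic : set R).
  move=> i j; rewrite (ord1 i); apply: open_nbhs_nbhs; split.
    exact: interval_open.
  by rewrite /= in_itv /=; exact: bx.
by move=> y /= yab i; have := yab ord0 i; rewrite /= in_itv.
Qed.

Lemma open_box_rat n (U : set 'rV[R]_n) : open U ->
  U = \bigcup_(ab in [set ab : {ffun 'I_n -> rat * rat} |
         open_box (fun i => ratr (ab i).1) (fun i => ratr (ab i).2) `<=` U])
      open_box (fun i => ratr (ab i).1) (fun i => ratr (ab i).2).
Proof.
move=> oU; apply/seteqP; split => [x Ux|x [ab /= abU abx]]; last exact: abU.
have : nbhs x U by apply: open_nbhs_nbhs.
move=> [P Px PU].
have H (i : 'I_n) : exists ab : rat * rat,
    ratr ab.1 < x ord0 i < ratr ab.2 /\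
    (forall t : R, ratr ab.1 < t < ratr ab.2 -> P ord0 i t).
  have /nbhs_ballP[e /= e0 eP] := Px ord0 i.
  have /rat_in_itvoo[q1] : x ord0 i - e < x ord0 i by rewrite ltrBlDr ltrDl.
  rewrite in_itv /= => /andP[q1a q1b].
  have /rat_in_itvoo[q2] : x ord0 i < x ord0 i + e by rewrite ltrDl.
  rewrite in_itv /= => /andP[q2a q2b].
  exists (q1, q2); split => /=; first by rewrite q1b q2a.
  move=> t /andP[t1 t2]; apply: eP; rewrite /ball /= ltr_distlC.
  by rewrite (lt_trans q1a t1) (lt_trans t2 q2b).
have [g gP] := choice H.
exists [ffun i => g i] => /=; last by move=> i; rewrite /= ffunE; case: (gP i).
move=> y yg; apply: PU => i j; rewrite (ord1 i).
by apply: (gP j).2; have := yg j; rewrite ffunE.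
Qed.

End boxes.

Section lebesgue_measure_rV.
Context {R : realType}.
Local Open Scope ereal_scope.

Definition cons_rV n (z : measurableTypeR R * 'rV[R]_n) : 'rV[R]_n.+1 :=
  \row_i oapp (z.2 ord0) z.1 (unlift ord0 i).

(* n-dimensional Lebesgue measure on the Borel sets of R^n, as the n-fold
   product of lebesgue_measure; R^0 carries the Dirac mass. *)
Fixpoint lebesgue_rV n : set 'rV[R]_n -> \bar R :=
  match n with
  | 0%N => \d_(0%R : 'rV[R]_0)
  | m.+1 => pushforward (@lebesgue_measure R \x lebesgue_rV (n:=m)) (@cons_rV m)
  end.

Lemma cons_rV_box n (a b : 'I_n.+1 -> R) :
  @cons_rV n @^-1` open_box a b =
  `]a ord0, b ord0[%classic `*`
    @open_box R n (fun i => a (lift ord0 i)) (fun i => b (lift ord0 i)).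
Proof.
apply/seteqP; split => -[t x].
  move=> abx; split => [|i] /=.
    by have := abx ord0; rewrite mxE unlift_none in_itv.
  by have := abx (lift ord0 i); rewrite mxE liftK.
move=> [/= tab xab] i; rewrite in_itv /= in tab; rewrite mxE.
by case: unliftP => [j|] ->; first exact: xab.
Qed.

Lemma measurable_cons_rV n : measurable_fun [set: _] (@cons_rV n).
Proof.
apply: (@measurability _ _ _ _ _ _ (@open 'rV[R]_n.+1)) => //.
move=> _ [U oU <-]; rewrite setTI (open_box_rat oU) preimage_bigcup.
apply: countable_bigcup_measurable => ab.
rewrite cons_rV_box; apply: measurableX => //.
by apply: open_rV_measurable; exact: open_box_open.
Qed.

Lemma lebesgue_rV_spec n :
  (exists m : {sigma_finite_measure set 'rV[R]_n -> \bar R},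
     @lebesgue_rV n = m :> (set _ -> \bar R)) /\
  (forall a b : 'I_n -> R, (forall i, a i <= b i)%R ->
     lebesgue_rV (open_box a b) = (\prod_i (b i - a i))%:E).
Proof.
elim: n => [|n [[m mE] mbox]].
  split; first by exists \d_(0%R : 'rV[R]_0).
  by move=> a b _; rewrite big_ord0 /= diracE mem_set// => -[].
have box a b : (forall i, a i <= b i)%R ->
    @lebesgue_rV n.+1 (open_box a b) = (\prod_i (b i - a i))%:E.
  move=> ab; rewrite /= /pushforward cons_rV_box mE.
  set B := open_box _ _; have mB : measurable B.
    by apply: open_rV_measurable; exact: open_box_open.
  rewrite product_measure1E// -mE mbox//.
  rewrite [X in X * _](_ : _ = (b ord0 - a ord0)%:E); last first.
    rewrite [LHS]lebesgue_measure_itv /= lte_fin.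
    by case: ltgtP (ab ord0) => // ->; rewrite subrr.
  by rewrite big_ord_recl EFinM.
split=> //.
pose mu : {measure set 'rV[R]_n.+1 -> \bar R} :=
  measure_function_pushforward__canonical__measure_function_Measure
    (@lebesgue_measure R \x m) (@measurable_cons_rV n).
have muE : @lebesgue_rV n.+1 = mu :> (set _ -> \bar R) by rewrite /= mE.
have sf : sigma_finite setT mu.
  exists (fun k => open_box (fun=> (- k%:R)%R) (fun=> k%:R%R)).
    apply/esym; rewrite -subTset => x _.
    exists (Num.truncn (\sum_j `|x ord0 j|)%R).+1 => // i; rewrite -ltr_norml.
    apply: le_lt_trans (truncnS_gt _).
    by rewrite (bigD1 i) //= lerDl sumr_ge0.
  move=> k; split; first by apply: open_rV_measurable; exact: open_box_open.
  by rewrite -muE box ?ltry// => i; rewrite ge0_cp.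
pose nu : {sigma_finite_measure set 'rV[R]_n.+1 -> \bar R} :=
  HB.pack (Measure.sort mu) (Measure_isSigmaFinite.Build _ _ _ mu sf).
by exists nu.
Qed.

Lemma lebesgue_rV_box n (a b : 'I_n -> R) : (forall i, a i <= b i)%R ->
  lebesgue_rV (open_box a b) = (\prod_i (b i - a i))%:E.
Proof. exact: (lebesgue_rV_spec n).2. Qed.

Let lebesgue_rV0 n : @lebesgue_rV n set0 = 0.
Proof. by have [[m ->] _] := lebesgue_rV_spec n; exact: measure0. Qed.

Let lebesgue_rV_ge0 n A : 0 <= @lebesgue_rV n A.
Proof. by have [[m ->] _] := lebesgue_rV_spec n; exact: measure_ge0. Qed.

Let lebesgue_rV_sigma_additive n : semi_sigma_additive (@lebesgue_rV n).
Proof.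
by have [[m ->] _] := lebesgue_rV_spec n; exact: measure_semi_sigma_additive.
Qed.

HB.instance Definition _ n := isMeasure.Build _ _ _ (@lebesgue_rV n)
  (@lebesgue_rV0 n) (@lebesgue_rV_ge0 n) (@lebesgue_rV_sigma_additive n).

Let lebesgue_rV_sigma_finite n : sigma_finite setT (@lebesgue_rV n).
Proof. by have [[m ->] _] := lebesgue_rV_spec n; exact: sigma_finiteT. Qed.

HB.instance Definition _ n := Measure_isSigmaFinite.Build _ _ _
  (@lebesgue_rV n) (@lebesgue_rV_sigma_finite n).

End lebesgue_measure_rV.

Section euclidean.
Context {R : realType} {n : nat}.
Implicit Types x y u : 'rV[R]_n.

Definition dot x y : R := \sum_i x ord0 i * y ord0 i.

(* The library norm on row vectors is the sup norm. *)
Definition enorm x : R := Num.sqrt (dot x x).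

Definition hyperplane (H : set 'rV[R]_n) : Prop :=
  exists u a, u != 0 /\ H = [set x | dot x u = a].

Definition supported_on (mu : set 'rV[R]_n -> \bar R) (A : set 'rV[R]_n) :=
  mu (~` A) = 0%E.

Definition even_measure (mu : set 'rV[R]_n -> \bar R) : Prop :=
  forall A : set 'rV[R]_n, measurable A -> mu (-%R @` A) = mu A.

Definition even_fun (f : 'rV[R]_n -> R) : Prop := forall x, f (- x) = f x.

End euclidean.

Section log_concave_functions.
Context {R : realType} {n : nat}.
Implicit Types (f : 'rV[R]_n -> R) (x y : 'rV[R]_n) (A : set 'rV[R]_n).

Definition upper_semicontinuous f : Prop :=
  lower_semicontinuous (fun x => (- f x)%:E).

Definition log_concave f : Prop :=
  forall x y (t : R), 0 < t < 1 ->
    f x `^ (1 - t) * f y `^ t <= f ((1 - t) *: x + t *: y).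

Definition LC f : Prop :=
  [/\ forall x, 0 <= f x, upper_semicontinuous f & log_concave f].

Local Open Scope ereal_scope.

(* The convex function phi with f = exp (- phi); +oo where f vanishes. *)
Definition potential f x : \bar R := - lne (f x)%:E.

Definition support_fun f y : \bar R :=
  ereal_sup (range (fun x => (dot x y)%:E - potential f x)).

Definition is_gradient (phi : 'rV[R]_n -> \bar R) x y : Prop :=
  [/\ \forall z \near x, phi z \is a fin_num,
      differentiable (fine \o phi) x
    & forall v, 'd (fine \o phi) x v = dot v y].

(* Pushforward of f dx by the gradient of the potential: points where the
   potential is not differentiable are left out of the preimage. *)
Definition surface_area_measure f A : \bar R :=
  \int[@lebesgue_rV R n]_(x in [set x | exists2 y, A y &
    is_gradient (potential f) x y]) (f x)%:E.

Definition Lp_surface_area_measure (p : R) f A : \bar R :=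
  \int[surface_area_measure f]_(y in A) support_fun f y `^ (1 - p).

End log_concave_functions.

(* Main.v *)
From HB Require Import structures.
Require Import Defs.
From mathcomp Require Import all_boot all_order all_algebra.
From mathcomp Require Import all_classical all_reals all_analysis.
From mathcomp Require Import measurable_realfun ring lra.

(* Write f = exp(- phi) with phi = h^*, so that h_f = h when h is convex and
   lower semi-continuous. Among the even h : R^n -> [0, +oo] with
   \int h^p dmu <= C, maximize the mass \int exp(- h^* ) dx. The first moment and
   the hyperplane condition force h^*(x) >= r |x| - M for a suitable C, so the
   mass is bounded, and biconjugates of a maximizing sequence have a subsequence
   whose limit is a maximizer h = h^**.

   Put dW = h^(p-1) dmu. For A open and symmetric and kappa = W(A) / W(R^n), the
   competitor h + t (1_A - kappa) is admissible by concavity of s |-> s^p. It need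
   not be convex, but its conjugate is at most h^* + t kappa everywhere, and at
   most h^* + t kappa - t for small t > 0 where grad h^* lies in A. Comparing
   masses and letting t tend to 0 gives S_f(A) <= kappa \int f. As functions of A
   both sides are even measures of the same finite total mass, so passing to
   complements gives equality: S_f = lambda h^(p-1) mu, that is
   h^(1-p) S_f = lambda mu. *)

Set Implicit Arguments.
Unset Strict Implicit.

Import Order.TTheory GRing.Theory Num.Theory.
Import numFieldNormedType.Exports.

Local Open Scope classical_set_scope.
Local Open Scope ring_scope.

(** * Lebesgue measure on R^n *)

(** Two obstacles shape the argument. First, [p - 1] is negative, so the weight [h^(p-1)] is under
    control only if [h] stays away from 0. An even convex [h] is smallest at 0, and [C] is chosen so
    that a maximizer has [h 0 > 0]: the competitor [a + norm1 y] has mass at least [exp a] at a cost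
    of order [a^p], whereas [h 0 = 0] forces a nonnegative conjugate and thereby a mass below
    [exp a]. The bound [h >= h 0 > 0] also leaves room for subtracting [t kappa]. Second, the mass
    is not visibly continuous along a maximizing sequence. All conjugates in play are bounded by a
    common [K] on a common ball around 0, and convexity towards that ball compares the density at
    [x] with the density near a slightly shrunk point, up to a factor close to 1. This is uniform
    along the sequence, so convergence on a countable dense set suffices, and a change of variables
    removes the shrinking from the integrals. The same shrinking makes the boundary of the domain of
    a conjugate negligible; inside the domain, non-differentiability is reduced to sets that
    axis-parallel lines meet at most once. *)

Section rV_measurability.
Context {R : realType} {n : nat}.
Implicit Types (x y u : 'rV[R]_n).

Lemma coord_rV_continuous i : continuous (fun x => x ord0 i).
Proof. by move=> x; exact: coord_continuous. Qed.

Lemma continuous_rV_measurable (f : 'rV[R]_n -> R) :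
  continuous f -> measurable_fun setT f.
Proof.
move=> /continuousP cf.
apply: (measurability _ (RGenOpens.measurableE R)).
move=> _ [_ [a [b ->] <-]]; rewrite setTI; apply: open_rV_measurable.
exact/cf/interval_open.
Qed.

Lemma measurable_coord i : measurable_fun setT (fun x => x ord0 i).
Proof. exact: (continuous_rV_measurable (@coord_rV_continuous i)). Qed.

Lemma dot_continuous y : continuous (fun x => dot x y).
Proof.
move=> x; rewrite /dot.
apply: (@cvg_big R^o _ +%R 0 _ add_continuous _ (nbhs x)) => i _.
apply: cvgM; last exact: cvg_cst.
exact: coord_rV_continuous.
Qed.

Lemma measurable_dot y : measurable_fun setT (fun x => dot x y).
Proof. exact: (continuous_rV_measurable (@dot_continuous y)). Qed.

Lemma measurable_fun_rVP d (T : measurableType d) (D : set T)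
    (F : T -> 'rV[R]_n) :
  (forall a b, measurable (D `&` F @^-1` open_box a b)) -> measurable_fun D F.
Proof.
move=> mF; apply: (@measurability _ _ _ _ _ _ (@open 'rV[R]_n)) => //.
move=> _ [U oU <-]; rewrite (open_box_rat oU) preimage_bigcup setI_bigcupr.
by apply: countable_bigcup_measurable => ab; exact: mF.
Qed.

Lemma measurable_fun_rV d (T : measurableType d) (F : T -> 'rV[R]_n) :
  (forall i, measurable_fun setT (fun t => F t ord0 i)) ->
  measurable_fun setT F.
Proof.
move=> mF; apply: measurable_fun_rVP => a b; rewrite setTI.
have -> : F @^-1` open_box a b =
    \bigcap_(i in setT) ((fun t => F t ord0 i) @^-1` `]a i, b i[%classic).
  apply/seteqP; split => [t Ft i _|t Ft i].
    by rewrite /= in_itv; exact: Ft.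
  by have := Ft i I; rewrite /= in_itv.
apply: fin_bigcap_measurable => // i _.
by rewrite -[X in measurable X]setTI; exact: mF.
Qed.

End rV_measurability.

(** * Uniqueness, affine changes of variables and slicing along lines *)

Section lebesgue_rV_invariance.
Context {R : realType} {n : nat}.
Implicit Types (x y u : 'rV[R]_n) (E : set 'rV[R]_n).
Local Notation leb := (@lebesgue_rV R n).

Lemma open_boxI (a b c d : 'I_n -> R) : open_box a b `&` open_box c d =
  open_box (fun i => Num.max (a i) (c i)) (fun i => Num.min (b i) (d i)).
Proof.
apply/seteqP; split => [x [ab cd] i|x abcd].
  have /andP[? ?] := ab i; have /andP[? ?] := cd i.
  by rewrite gt_max lt_min; apply/andP; split; apply/andP.
by split => i; have := abcd i;
  rewrite gt_max lt_min => /andP[/andP[? ?] /andP[? ?]]; apply/andP.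
Qed.

Lemma measurable_open_box (a b : 'I_n -> R) : measurable (open_box a b).
Proof. by apply: open_rV_measurable; exact: open_box_open. Qed.

Lemma open_box_eq0 (a b : 'I_n -> R) i : b i <= a i -> open_box a b = set0.
Proof.
move=> ba; rewrite -subset0 => x /(_ i) /andP[ax xb].
by have := lt_trans ax xb; rewrite ltNge ba.
Qed.

Definition cube (r : R) : set 'rV[R]_n := open_box (fun=> - r) (fun=> r).

Lemma cubeE r : cube r = [set x | forall i, `|x ord0 i| < r].
Proof. by apply/seteqP; split => x /= H i; have := H i; rewrite ltr_norml. Qed.

Lemma measurable_cube r : measurable (cube r).
Proof. exact: measurable_open_box. Qed.

Lemma lebesgue_cube r : 0 <= r -> leb (cube r) = ((2 * r) ^+ n)%:E.
Proof.
move=> r0; rewrite lebesgue_rV_box; last first.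
  by move=> _; rewrite (le_trans _ r0)// oppr_le0.
by rewrite big_const_ord iter_mulr_1 opprK mulr2n mulrDl mul1r.
Qed.

Lemma bigcup_cube : \bigcup_k cube k%:R = setT.
Proof.
rewrite -subTset => x _.
exists (Num.truncn (\sum_j `|x ord0 j|)).+1 => // i; rewrite -ltr_norml.
apply: le_lt_trans (truncnS_gt _).
by rewrite (bigD1 i) //= lerDl sumr_ge0.
Qed.

(** Boxes are stable under intersection and generate the Borel sets, and cubes of finite measure
    exhaust the space. *)
Lemma lebesgue_rV_unique (m : {measure set 'rV[R]_n -> \bar R}) :
  (forall a b : 'I_n -> R, (forall i, a i <= b i) ->
     m (open_box a b) = (\prod_i (b i - a i))%:E) ->
  forall E, measurable E -> m E = leb E.
Proof.
move=> mbox E mE.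
pose G := [set A : set 'rV[R]_n | exists a b, A = open_box a b].
have lebG A : G A -> m A = leb A.
  move=> [a [b ->]].
  have [ab|] := pselect (forall i, a i <= b i).
    by rewrite mbox// lebesgue_rV_box.
  move=> /existsNP[i /negP]; rewrite -ltNge => /ltW ba.
  by rewrite (open_box_eq0 ba) !measure0.
apply: (@measure_unique _ _ _ G (fun k => cube k%:R)) => //.
- apply/seteqP; split => A.
    apply: smallest_sub; first exact: smallest_sigma_algebra.
    move=> U oU; rewrite (open_box_rat oU).
    apply: (@countable_bigcup_measurable _ (g_sigma_algebraType G)) => ab.
    by apply: sub_sigma_algebra; eexists; eexists.
  apply: smallest_sub; first exact: sigma_algebra_measurable.
  by move=> _ [a [b ->]]; exact: measurable_open_box.
- by move=> _ _ [a [b ->]] [c [d ->]]; rewrite open_boxI; eexists; eexists.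
- by move=> k; eexists; eexists.
- exact: bigcup_cube.
- by move=> k; rewrite lebG ?lebesgue_cube ?ltry//; eexists; eexists.
Qed.

Lemma measurable_affine_rV (s : R) u : measurable_fun setT (fun x => s *: x + u).
Proof.
apply: measurable_fun_rV => i; under eq_fun do rewrite !mxE.
by apply: measurable_funD => //; apply: measurable_funM => //;
  exact: measurable_coord.
Qed.

(** The pushforward multiplied by [|s|^n] gives every box its volume, so uniqueness applies. A
    negative [s] exchanges the end points of the sides; the case [s = -1] is the reflection that
    evenness relies on. *)
Lemma lebesgue_rV_affine (s : R) u E : s != 0 -> measurable E ->
  leb ((fun x => s *: x + u) @^-1` E) = ((`|s| ^- n)%:E * leb E)%E.
Proof.
move=> s0 mE; have s0' : 0 < `|s| by rewrite normr_gt0.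
pose m : {measure set 'rV[R]_n -> \bar R} :=
  mscale (NngNum (ltW (exprn_gt0 n s0')))
  (measure_function_pushforward__canonical__measure_function_Measure
    leb (measurable_affine_rV s u)).
have mm : forall a b : 'I_n -> R, (forall i, a i <= b i) ->
     m (open_box a b) = (\prod_i (b i - a i))%:E.
  move=> a b ab; rewrite /m /= /mscale /= /pushforward.
  have [sp|sn|sE] := ltgtP s 0; last by rewrite sE eqxx in s0.
  - have -> : (fun x => s *: x + u) @^-1` open_box a b =
      open_box (fun i => (b i - u ord0 i) / s) (fun i => (a i - u ord0 i) / s).
      apply/seteqP; split => x /= xab i; have := xab i; rewrite !mxE.
        move=> /andP[? ?].
        by rewrite ltr_ndivrMr// ltr_ndivlMr// [_ * s]mulrC; apply/andP; split; lra.
      rewrite ltr_ndivrMr// ltr_ndivlMr// [_ * s]mulrC => /andP[? ?].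
      by apply/andP; split; lra.
    rewrite lebesgue_rV_box; last first.
      by move=> i; rewrite ler_ndivrMr// divfK// lerB.
    rewrite -EFinM; congr EFin.
    have -> : `|s| ^+ n = \prod_(i < n) `|s| by rewrite prodr_const card_ord.
    rewrite -big_split/=.
    by apply: eq_bigr => i _; rewrite ltr0_norm//; field.
  - have -> : (fun x => s *: x + u) @^-1` open_box a b =
      open_box (fun i => (a i - u ord0 i) / s) (fun i => (b i - u ord0 i) / s).
      apply/seteqP; split => x /= xab i; have := xab i; rewrite !mxE.
        move=> /andP[? ?].
        by rewrite ltr_pdivrMr// ltr_pdivlMr// [_ * s]mulrC; apply/andP; split; lra.
      rewrite ltr_pdivrMr// ltr_pdivlMr// [_ * s]mulrC => /andP[? ?].
      by apply/andP; split; lra.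
    rewrite lebesgue_rV_box; last first.
      by move=> i; rewrite ler_pdivrMr// divfK// lerB.
    rewrite -EFinM; congr EFin.
    have -> : `|s| ^+ n = \prod_(i < n) `|s| by rewrite prodr_const card_ord.
    rewrite -big_split/=.
    by apply: eq_bigr => i _; rewrite gtr0_norm//; field.
rewrite -(lebesgue_rV_unique mm mE) /m /= /mscale /= /pushforward.
by rewrite muleA -EFinM mulVf ?mul1e// gt_eqF// exprn_gt0.
Qed.

Lemma ge0_integral_affine_rV (s : R) u (f : 'rV[R]_n -> \bar R) : s != 0 ->
  measurable_fun setT f -> (forall x, 0 <= f x)%E ->
  (\int[leb]_x f (s *: x + u)%R = (`|s| ^- n)%:E * \int[leb]_x f x)%E.
Proof.
move=> s0 mf f0; have s0' : 0 <= `|s| ^- n by rewrite invr_ge0 exprn_ge0.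
rewrite -[LHS](@ge0_integral_pushforward _ _ _ _ _ _
  (measurable_affine_rV s u) leb setT f)//.
rewrite -(@ge0_integral_mscale _ _ _ leb setT measurableT (NngNum s0') f)//.
apply: eq_measure_integral => [|? A mA _]; first exact: measurable_affine_rV.
exact: (lebesgue_rV_affine u s0 mA).
Qed.

(** A set of pairs [(t, x)] to be sliced in two ways: at fixed [t] in the unit interval the slice is
    a translate of [E], at fixed [x] it is the trace of [E] on a segment from [x] in direction
    [u]. *)
Let lines u E : set (measurableTypeR R * 'rV[R]_n) :=
  (`]0%R, 1%R[%classic `*` setT) `&` (fun z => z.2 + z.1 *: u) @^-1` E.

Let measurable_lines u E : measurable E -> measurable (lines u E).
Proof.
move=> mE; apply: measurableI; first exact: measurableX.
rewrite -[X in measurable X]setTI.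
suff mF : measurable_fun setT
    (fun z : measurableTypeR R * 'rV[R]_n => z.2 + z.1 *: u) by exact: mF.
apply: measurable_fun_rV => i; under eq_fun do rewrite !mxE.
apply: measurable_funD.
  exact: measurableT_comp (@measurable_coord R n i) measurable_snd.
by apply: measurable_funM => //; exact: measurable_fst.
Qed.

Let ysection_lines u E x : ysection (lines u E) x =
  `]0%R, 1%R[%classic `&` [set t : R | E (x + t *: u)].
Proof.
apply/seteqP; split => t; rewrite /ysection /lines /= in_setE /=.
  by move=> [[]].
by move=> [].
Qed.

Lemma measurable_line u E x : measurable E ->
  measurable (`]0%R, 1%R[%classic `&` [set t : R | E (x + t *: u)]).
Proof.
by move=> mE; rewrite -ysection_lines; apply: measurable_ysection;
  exact: measurable_lines.
Qed.

Lemma measurable_fun_line u E : measurable E -> measurable_fun setT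
  (fun x => lebesgue_measure (`]0%R, 1%R[%classic `&` [set t : R | E (x + t *: u)])).
Proof.
move=> mE; under eq_fun do rewrite -ysection_lines.
exact: (measurable_fun_ysection (@lebesgue_measure R) (measurable_lines u mE)).
Qed.

(** Slicing in an arbitrary direction without a change of basis: by translation invariance all
    [t]-slices of [lines u E] have measure [leb E], and [t] runs over an interval of length 1. *)
Lemma lebesgue_rV_tonelli u E : measurable E ->
  (leb E = \int[leb]_x lebesgue_measure
    (`]0%R, 1%R[%classic `&` [set t : R | E (x + t *: u)%R]))%E.
Proof.
move=> mE; have mA := measurable_lines u mE.
have := @indic_fubini_tonelli _ _ _ _ R (@lebesgue_measure R) leb _ mA.
rewrite indic_fubini_tonelli_FE// indic_fubini_tonelli_GE// => H.
transitivity (\int[lebesgue_measure]_x (leb \o xsection (lines u E)) x)%E.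
  transitivity (\int[@lebesgue_measure R]_(t in `]0%R, 1%R[%classic) (leb E))%E.
    by rewrite integral_cst//= lebesgue_measure_itv/= lte01 sube0 mule1.
  rewrite integral_mkcond; apply: eq_integral => t _ /=; rewrite patchE.
  case: ifPn => [t01|t01].
    have -> : xsection (lines u E) t = (fun x => 1 *: x + t *: u) @^-1` E.
      apply/seteqP; split => x; rewrite /xsection /lines /= in_setE /= scale1r.
        by move=> [].
      by move=> Ex; rewrite inE in t01; split.
    by rewrite lebesgue_rV_affine ?oner_eq0// normr1 expr1n invr1 mul1e.
  have -> : xsection (lines u E) t = set0; last by rewrite measure0.
  rewrite -subset0 => x; rewrite /xsection /lines /= in_setE /= => -[[tt _] _].
  by move/negP : t01; rewrite inE.
by rewrite H; apply: eq_integral => x _ /=; rewrite ysection_lines.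
Qed.

End lebesgue_rV_invariance.

(** * The scalar product, the sup norm and its dual norm *)

Section norm_dot.
Context {R : realType} {n : nat}.
Implicit Types (x y z u : 'rV[R]_n) (i : 'I_n).

Lemma coord_le_norm x i : `|x ord0 i| <= `|x|.
Proof.
rewrite [leRHS]/Num.norm /= mx_normrE.
by apply/bigmax_geP; right => /=; exists (ord0, i).
Qed.

Lemma normr_coord x : x != 0 -> exists i, `|x| = `|x ord0 i|.
Proof.
rewrite -normr_eq0 => /mx_norm_neq0[[j i] /= xE]; exists i.
by rewrite [LHS]xE (ord1 j).
Qed.

Lemma normr_le x (r : R) : 0 <= r -> (forall i, `|x ord0 i| <= r) -> `|x| <= r.
Proof.
move=> r0 xr; have [->|/normr_coord[i ->]] := eqVneq x 0; last exact: xr.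
by rewrite normr0.
Qed.

Lemma cube_norm (r : R) x : 0 < r -> cube r x <-> `|x| < r.
Proof.
move=> r0; rewrite cubeE; split => [/= xr|xr i].
  have [->|/normr_coord[i ->]] := eqVneq x 0; last exact: xr.
  by rewrite normr0.
exact: le_lt_trans (coord_le_norm x i) xr.
Qed.

Lemma dotC x y : dot x y = dot y x.
Proof. by apply: eq_bigr => i _; rewrite mulrC. Qed.

Lemma dotDl x y z : dot (x + y) z = dot x z + dot y z.
Proof. by rewrite /dot -big_split; apply: eq_bigr => i _; rewrite mxE mulrDl. Qed.

Lemma dotZl (s : R) x y : dot (s *: x) y = s * dot x y.
Proof. by rewrite /dot mulr_sumr; apply: eq_bigr => i _; rewrite mxE mulrA. Qed.

Lemma dotDr x y z : dot z (x + y) = dot z x + dot z y.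
Proof. by rewrite ![dot z _]dotC dotDl. Qed.

Lemma dotZr (s : R) x y : dot y (s *: x) = s * dot y x.
Proof. by rewrite ![dot y _]dotC dotZl. Qed.

Lemma dotNl x y : dot (- x) y = - dot x y.
Proof. by rewrite -scaleN1r dotZl mulN1r. Qed.

Lemma dotNr x y : dot y (- x) = - dot y x.
Proof. by rewrite dotC dotNl dotC. Qed.

Lemma dot0l x : dot 0 x = 0.
Proof. by rewrite -(scale0r 0) dotZl mul0r. Qed.

Lemma dot0r x : dot x 0 = 0.
Proof. by rewrite dotC dot0l. Qed.

Lemma dot_delta x i : dot x (delta_mx ord0 i) = x ord0 i.
Proof.
rewrite /dot (bigD1 i)//= big1 => [|j ji]; first by rewrite mxE !eqxx mulr1 addr0.
by rewrite mxE (negbTE ji) andbF mulr0.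
Qed.

Lemma norm_delta i : `|delta_mx ord0 i : 'rV[R]_n| = 1.
Proof.
apply/eqP; rewrite eq_le; apply/andP; split.
  by apply: normr_le => // j; rewrite mxE; case: andb; rewrite ?normr1 ?normr0.
by have := coord_le_norm (delta_mx ord0 i) i; rewrite mxE !eqxx normr1.
Qed.

(** The dual of the sup norm, which is the norm carried by row vectors; hence the pairing bound
    [dot_le_norm1]. *)
Definition norm1 x : R := \sum_i `|x ord0 i|.

Lemma norm1_ge0 x : 0 <= norm1 x.
Proof. by apply: sumr_ge0. Qed.

Lemma norm1N x : norm1 (- x) = norm1 x.
Proof. by apply: eq_bigr => i _; rewrite mxE normrN. Qed.

Lemma dot_le_norm1 x y : `|dot x y| <= `|x| * norm1 y.
Proof.
rewrite (le_trans (ler_norm_sum _ _ _))// mulr_sumr ler_sum// => i _.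
by rewrite normrM ler_wpM2r// coord_le_norm.
Qed.

Lemma measurable_norm1 : measurable_fun setT norm1.
Proof.
apply: measurable_sum => i; apply: measurableT_comp => //.
exact: measurable_coord.
Qed.

Lemma norm_rV_continuous : continuous (fun x => `|x|).
Proof. by move=> x; apply: norm_continuous. Qed.

Lemma measurable_normr : measurable_fun setT (fun x => `|x|).
Proof. exact: (continuous_rV_measurable norm_rV_continuous). Qed.

End norm_dot.

Lemma expR_ge_expr {R : realType} n (x : R) : 0 <= x -> x ^+ n <= n`!%:R * expR x.
Proof.
move=> x0; case: n => [|n]; first by rewrite fact0 mul1r expr0 -{1}expR0 ler_expR.
rewrite mulrC -ler_pdivrMr ?ltr0n ?fact_gt0//.
by rewrite (le_trans _ (expR_ge1Dxn n x0))// lerDr.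
Qed.

(** * Null sets, thin slabs and integrability of exponentials *)

Section lebesgue_rV_estimates.
Context {R : realType} {n : nat}.
Implicit Types (x y u : 'rV[R]_n) (E : set 'rV[R]_n).
Local Notation leb := (@lebesgue_rV R n).

Lemma lebesgue_rV_sections0 u E : measurable E ->
  (forall x (t1 t2 : R), E (x + t1 *: u) -> E (x + t2 *: u) -> t1 = t2) ->
  leb E = 0%E.
Proof.
move=> mE E1; rewrite (lebesgue_rV_tonelli u mE); apply: integral0_eq => x _.
set A := (X in lebesgue_measure X).
have [[t At]|A0] := pselect (A !=set0); last first.
  by rewrite (_ : A = set0) ?measure0//; apply/eqP/negPn/negP => /set0P.
rewrite (_ : A = [set t]) ?lebesgue_measure_set1//.
apply/seteqP; split => [s As|_ ->//].
exact: E1 As.2 At.2.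
Qed.

(** Slicing goes along a coordinate [i] with [|y_i| = |y|]: moving [x] by [t] in that direction
    changes [dot x y] by [t y_i], so the slab condition confines [t] to an interval of length [2 s].
    Since [t < 1], only base points in the cube of half-side [T + 1] contribute. *)
Lemma lebesgue_slab y (s T : R) : y != 0 -> 0 <= s -> 0 <= T ->
  (leb (cube T `&` [set x | (`|dot x y| < s * `|y|)%R]) <=
   (2 * s * (2 * (T + 1)) ^+ n)%:E)%E.
Proof.
move=> y0 s0 T0; have [i yi] := normr_coord y0.
have yi0 : 0 < `|y ord0 i| by rewrite -yi normr_gt0.
set E := _ `&` _.
have mE : measurable E.
  apply: measurableI; first exact: measurable_cube.
  rewrite -[X in measurable X]setTI; apply: measurable_fun_ltr => //.
  apply: measurableT_comp => //; exact: measurable_dot.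
have T1 : 0 <= T + 1 by rewrite addr_ge0.
rewrite (lebesgue_rV_tonelli (delta_mx ord0 i) mE).
apply: (@le_trans _ _ (\int[leb]_(x in cube (T + 1)) (2 * s)%:E)%E); last first.
  by rewrite integral_cst//= ?lebesgue_cube// -?EFinM//; exact: measurable_cube.
rewrite [leRHS]integral_mkcond; apply: ge0_le_integral => //.
- by apply: measurable_fun_line.
- by apply/(measurable_restrictT _ (@measurable_cube _ _ _)).
- move=> x _; rewrite patchE; set A := _ `&` _.
  have AE t : A t -> `|t - (- dot x y / y ord0 i)| < s.
    move=> [_ [_ /=]]; rewrite dotDl dotZl [dot (delta_mx _ _) _]dotC dot_delta.
    rewrite yi -ltr_pdivrMr// -normf_div; congr (_ < _); congr `|_|.
    by rewrite mulrDl mulfK -?normr_gt0//; ring.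
  case: ifPn => xT.
    apply: (@le_trans _ _ (lebesgue_measure (ball (- dot x y / y ord0 i) s))).
      apply: le_measure; rewrite ?inE//; first exact: measurable_line.
        exact: measurable_ball.
      by move=> t /AE; rewrite /ball/= distrC.
    by rewrite lebesgue_measure_ball// mulr2n mulrDl mul1r.
  rewrite (_ : A = set0) ?measure0// -subset0 => t [t01 [xtT _]].
  move/negP : xT; apply; rewrite inE cubeE => j /=.
  move: xtT; rewrite cubeE => /(_ j) /=; rewrite !mxE => xtj.
  move: t01; rewrite /= in_itv/= => /andP[t0 t1].
  move: xtj; rewrite eqxx /=; case: (j == i); rewrite ?mulr1 ?mulr0 !ltr_norml;
    by move=> /andP[? ?]; apply/andP; split; lra.
Qed.

Lemma expR_norm_integrable (c : R) : 0 < c ->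
  (\int[leb]_x (expR (- (c * `|x|)))%:E < +oo)%E.
Proof.
move=> c0.
have c2 : 0 < c / 2 by rewrite divr_gt0.
(* The term with [k] the integer part of [|x|] already dominates the integrand at [x]. *)
pose F (k : nat) x : \bar R :=
  ((expR (- (c * k%:R)))%:E * (\1_(cube k.+1%:R : set 'rV[R]_n) x)%:E)%E.
have F0 k x : (0 <= F k x)%E by rewrite mule_ge0// lee_fin// expR_ge0.
have mF k : measurable_fun setT (F k).
  apply: emeasurable_funM; first exact: measurable_cst.
  by apply/measurable_EFinP/measurable_indic; exact: measurable_cube.
apply: (@le_lt_trans _ _ (\int[leb]_x (\sum_(k <oo) F k x))%E).
  apply: ge0_le_integral => //.
  - apply/measurable_EFinP; apply: measurableT_comp => //.
    apply: measurable_funN; apply: measurable_funM => //.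
    exact: measurable_normr.
  - exact: ge0_emeasurable_sum.
  move=> x _; pose k := Num.truncn `|x|.
  apply: (@le_trans _ _ (F k x)).
    rewrite /F indicE mem_set; last first.
      by apply/cube_norm; rewrite ?ltr0n// truncnS_gt.
    rewrite mule1 lee_fin ler_expR lerN2 ler_pM2l//.
    by rewrite truncn_le.
  rewrite (@nneseriesD1 _ (F^~ x) k xpredT (fun j _ => F0 j x) isT).
  by rewrite leeDl// nneseries_ge0.
rewrite integral_nneseries//.
(* The bound [u ^ n <= n! exp u] at [u = (c / 2) (k + 1)] absorbs the volume [(2 (k + 1)) ^ n] at
   the price of half the decay; the other half leaves a geometric series of ratio
   [exp (- c / 2)]. *)
pose K : R := n`!%:R * (4 / c) ^+ n * expR (c / 2).
have K0 : 0 <= K by rewrite !mulr_ge0 ?expR_ge0// exprn_ge0// divr_ge0// ltW.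
pose z : R := expR (- (c / 2)).
have z0 : 0 < z by exact: expR_gt0.
have z1 : `|z| < 1 by rewrite gtr0_norm// expR_lt1 oppr_lt0.
have FK k : (\int[leb]_x F k x <= (geometric K z k)%:E)%E.
  rewrite ge0_integralZl//; last first.
    by apply/measurable_EFinP/measurable_indic; exact: measurable_cube.
  rewrite integral_indic//; last exact: measurable_cube.
  rewrite setIT [X in (_ * X <= _)%E](_ : _ = ((2 * k.+1%:R) ^+ n)%:E); last first.
    exact: lebesgue_cube.
  rewrite -EFinM lee_fin /geometric/=.
  have -> : 2 * k.+1%:R = (4 / c) * ((c / 2) * k.+1%:R) :> R.
    by field; rewrite gt_eqF.
  rewrite exprMn.
  have : ((c / 2) * k.+1%:R) ^+ n <= n`!%:R * expR ((c / 2) * k.+1%:R).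
    by apply: expR_ge_expr; rewrite mulr_ge0// ltW.
  have -> : expR (c / 2 * k.+1%:R) = expR (c * k%:R) * z ^+ k * expR (c / 2).
    rewrite /z -expRM_natr -!expRD; congr expR; rewrite -[k.+1]addn1 natrD; lra.
  move=> H.
  rewrite expRN ler_pdivrMl ?expR_gt0//.
  rewrite (le_trans (ler_wpM2l _ H)) ?exprn_ge0 ?divr_ge0// ?(ltW c0)//.
  by rewrite /K le_eqVlt; apply/orP; left; apply/eqP; ring.
rewrite (le_lt_trans (lee_nneseries _ (fun k _ => FK k)))//.
  by move=> k _ _; apply: integral_ge0 => x _; exact: F0.
apply: (@le_lt_trans _ _ (K * (1 - z)^-1)%:E); last exact: ltry.
apply: lime_le.
  apply: is_cvg_nneseries => k _ _.
  rewrite lee_fin; apply: geometric_ge0 => //; exact: ltW.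
apply: nearW => m; rewrite sumEFin lee_fin.
by have := geometric_le_lim m K0 z0 z1; rewrite seriesEnat/=.
Qed.

End lebesgue_rV_estimates.

(** * The Legendre transform *)

Section legendre.
Context {R : realType} {n : nat}.
Implicit Types (x y z u : 'rV[R]_n) (g : 'rV[R]_n -> \bar R) (c : R).
Local Open Scope ereal_scope.

Definition legendre g y : \bar R :=
  ereal_sup (range (fun x => (dot x y)%:E - g x)).

(** Trades a supremum of extended reals for affine minorants of [g]; nearly all later estimates of
    conjugates go through this form. *)
Lemma legendre_leP g y c :
  legendre g y <= c%:E <-> forall x, (dot x y - c)%:E <= g x.
Proof.
have H (a : R) (b : \bar R) : (a%:E - b <= c%:E) = ((a - c)%:E <= b).
  case: b => [b| |] /=; rewrite ?leNye ?leey ?leye_eq ?leeNy_eq//.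
  by rewrite -EFinB !lee_fin lerBlDr lerBlDl addrC.
split => [gc x|gc].
  by rewrite -H (le_trans _ gc)//; apply: ereal_sup_ubound; exists x.
by apply: ge_ereal_sup => _ [x _ <-]; rewrite H.
Qed.

Lemma legendre_gtP g y c :
  c%:E < legendre g y <-> exists x, g x < (dot x y - c)%:E.
Proof.
split => [|[x]]; last first.
  rewrite !ltNge => /negP xc; apply/negP => /legendre_leP/(_ x).
  by move: xc.
apply: contraPP => /forallNP cg; rewrite ltNge => /negP; apply.
by apply/legendre_leP => x; rewrite leNgt; apply/negP/cg.
Qed.

Lemma legendre_ge g x y : (dot x y)%:E - g x <= legendre g y.
Proof. by apply: ereal_sup_ubound; exists x. Qed.

Lemma fenchel_young g x y c : g x <= c%:E -> (dot x y - c)%:E <= legendre g y.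
Proof. by move=> gc; rewrite (le_trans _ (legendre_ge g x y))// EFinB leeB. Qed.

Lemma le_legendre g1 g2 y : (forall x, g1 x <= g2 x) ->
  legendre g2 y <= legendre g1 y.
Proof.
move=> g12; apply: ge_ereal_sup => _ [x _ <-].
by rewrite (le_trans _ (legendre_ge g1 x y))// leeB.
Qed.

Lemma biconj_le g x : legendre (legendre g) x <= g x.
Proof.
case gx : (g x) => [c| |]; last 2 first.
- exact: leey.
- apply: ge_ereal_sup => _ [y _ <-].
  have := legendre_ge g x y; rewrite gx /= leye_eq => /eqP ->.
  by rewrite addeNy.
- apply/legendre_leP => y; rewrite dotC; apply: fenchel_young.
  by rewrite gx.
Qed.

Lemma triconj g : legendre (legendre (legendre g)) = legendre g.
Proof.
apply/funext => y; apply/le_anti; rewrite biconj_le/=.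
by apply: le_legendre; exact: biconj_le.
Qed.

(** Quantifying over real upper bounds [c] and [d] avoids sums of opposite infinities; a point where
    [g] is [+oo] imposes no condition. *)
Definition convex_ereal g := forall x y c (d t : R), (0 <= t <= 1)%R ->
  g x <= c%:E -> g y <= d%:E ->
  g (t *: x + (1 - t) *: y)%R <= (t * c + (1 - t) * d)%:E.

Lemma legendre_convex g : convex_ereal (legendre g).
Proof.
move=> x y c d t /andP[t0 t1] /legendre_leP gx /legendre_leP gy.
apply/legendre_leP => z; move: (gx z) (gy z).
case: (g z) => [b| |]; [|by move=> *; exact: leey|by rewrite leeNy_eq => /eqP].
rewrite !lee_fin dotDr !dotZr => H1 H2.
have t10 : (0 <= 1 - t)%R by rewrite subr_ge0.
have := ler_wpM2l t0 H1; have := ler_wpM2l t10 H2.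
set A := dot _ _; set B := dot _ _; lra.
Qed.

Lemma legendre_even g : (forall x, g (- x)%R = g x) ->
  forall y, legendre g (- y)%R = legendre g y.
Proof.
move=> ge.
have H y : legendre g (- y)%R <= legendre g y.
  apply: ge_ereal_sup => _ [x _ <-].
  by rewrite dotNr -dotNl -ge; exact: legendre_ge.
by move=> y; apply/le_anti; rewrite H -[X in legendre g X <= _]opprK H.
Qed.

(** For each [x], one of [x] and [- x] has nonnegative product with [y], and [g] takes the same
    value at both. *)
Lemma legendre0_le g y : (forall x, g (- x)%R = g x) ->
  legendre g 0%R <= legendre g y.
Proof.
move=> ge; apply: ge_ereal_sup => _ [x _ <-]; rewrite dot0r.
have [xy|xy] := leP 0%R (dot x y).
  by rewrite (le_trans _ (legendre_ge g x y))// leeB.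
rewrite (le_trans _ (legendre_ge g (- x)%R y))// ge leeB//.
by rewrite lee_fin dotNl oppr_ge0 ltW.
Qed.

(** Lower semi-continuity of a conjugate: the set is a union of open half-spaces, one for each [x]
    with [g x < +oo], a value [-oo] contributing the whole space. *)
Lemma legendre_open g c : open [set y | c%:E < legendre g y].
Proof.
have -> : [set y | c%:E < legendre g y] = \bigcup_(x in [set x | g x < +oo])
    [set y | g x + c%:E < (dot x y)%:E].
  apply/seteqP; split => [y /legendre_gtP[x gx]|y [x _ gx]].
    exists x; first by rewrite /= (lt_le_trans gx)// leey.
    by rewrite /= -lteBrDr.
  by apply/legendre_gtP; exists x; rewrite EFinB lteBrDr.
apply: bigcup_open => x gx.
have [[r gr]|gr] : (exists r, g x + c%:E = r%:E) \/ g x = -oo.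
  move: gx => /=; by case: (g x) => [r| |]// _; [left; exists (r + c)%R|right].
- rewrite (_ : [set _ | _] = (fun y => dot y x) @^-1` [set t : R | (r < t)%R]).
    apply: open_comp; last exact: open_gt.
    by move=> y _; exact: dot_continuous.
  by apply/seteqP; split => y /=; rewrite dotC gr lte_fin.
- rewrite (_ : [set _ | _] = setT); first exact: openT.
  by rewrite -subTset => y _ /=; rewrite gr addNye ltNyr.
Qed.

Lemma measurable_legendre g : measurable_fun setT (legendre g).
Proof.
apply: (measurability _ (ErealGenOInfty.measurableE R)).
move=> /= _ [_ [a ->]] <-; rewrite setTI.
by rewrite preimage_itvoy; apply: open_rV_measurable; exact: legendre_open.
Qed.

End legendre.

(** * Gradients of convex functions *)

Section gradient_littleo.
Context {R : realType} {n : nat}.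
Implicit Types (x y z u v : 'rV[R]_n).

Definition dotr y v : R^o := dot v y.

Fact dotr_linear y : linear (dotr y).
Proof. by move=> a u v; rewrite /dotr dotDl dotZl. Qed.

HB.instance Definition _ y :=
  GRing.isLinear.Build R 'rV[R]_n R^o *:%R (dotr y) (dotr_linear y).

Lemma gradient_littleoP (f : 'rV[R]_n -> R) x y :
  (differentiable f x /\ forall v, 'd f x v = dot v y) <->
  (forall e, 0 < e -> \forall z \near (0 : 'rV[R]_n),
    `|f (z + x) - (f x + dot z y)| <= e * `|z|).
Proof.
have E : (f \o shift x = cst (f x) + dotr y +o_ (0 : 'rV[R]_n) id) <->
  (forall e, 0 < e -> \forall z \near (0 : 'rV[R]_n),
    `|f (z + x) - (f x + dot z y)| <= e * `|z|).
  exact: eqaddoP.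
split => [[/diff_locallyP[_ df] dfE]|/E H].
  apply/E; suff <- : ('d f x : _ -> _) = dotr y by [].
  exact/funext.
have dc : continuous (dotr y) by move=> z; exact: dot_continuous.
have dE := diff_unique dc H.
split; last by move=> v; rewrite dE.
by apply/diff_locallyP; rewrite dE.
Qed.

End gradient_littleo.

(** * One-sided directional slopes and differentiability of convex functions *)

Section convex_ereal.
Context {R : realType} {n : nat}.
Implicit Types (x y z u v : 'rV[R]_n) (b c d : R).
Variable phi : 'rV[R]_n -> \bar R.
Hypotheses (phi_cvx : convex_ereal phi) (phi_low : forall x, (-oo < phi x)%E).

Definition dom_phi : set 'rV[R]_n := [set x | (phi x < +oo)%E].
Local Notation U := (interior dom_phi).

Lemma dom_phi_fin x : dom_phi x -> phi x = (fine (phi x))%:E.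
Proof. by move=> xd; rewrite fineK// fin_real// phi_low. Qed.

Lemma interior_dom_fin x : U x -> \forall z \near x, phi z \is a fin_num.
Proof. by apply: filterS => z zd; rewrite fin_real// phi_low. Qed.

(* phi'(x; v) < b, for the one-sided directional derivative of phi *)
Definition slope_lt v b : set 'rV[R]_n :=
  [set x | exists m : nat,
    (phi (x + m.+1%:R^-1 *: v)%R < phi x + (m.+1%:R^-1 * b)%:E)%E].

Lemma slope_shrink x v b c t s : phi x = c%:E ->
  (phi (x + t *: v)%R < (c + t * b)%:E)%E -> 0 < s <= t ->
  (phi (x + s *: v)%R < (c + s * b)%:E)%E.
Proof.
move=> xc xt /andP[s0 st]; have t0 := lt_le_trans s0 st.
have fd : phi (x + t *: v) = (fine (phi (x + t *: v)))%:E.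
  by apply: dom_phi_fin; rewrite /dom_phi/= (lt_trans xt)// ltry.
set d := fine _ in fd.
have r01 : 0 <= s / t <= 1.
  by apply/andP; split; [rewrite divr_ge0// ltW|rewrite ler_pdivrMr// mul1r].
have := phi_cvx r01 (_ : phi (x + t *: v) <= d%:E)%E (_ : phi x <= c%:E)%E.
rewrite fd xc !lexx => /(_ isT isT).
have -> : (s / t) *: (x + t *: v) + (1 - s / t) *: x = x + s *: v.
  rewrite scalerDr scalerA mulfVK ?gt_eqF// addrAC -scalerDl.
  by rewrite [s / t + _]addrC subrK scale1r.
move=> /le_lt_trans; apply; move: xt; rewrite fd !lte_fin => dt.
have -> : c + s * b = s / t * (c + t * b) + (1 - s / t) * c.
  by field; rewrite gt_eqF.
by rewrite ltrD2r ltr_pM2l// divr_gt0.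
Qed.

(** By monotonicity of the quotients one good step yields all smaller ones. Sampling only the steps
    [1 / (m + 1)] thus loses nothing, and it keeps [slope_lt] a countable union. *)
Lemma slope_ltP x v b c : phi x = c%:E ->
  slope_lt v b x <->
  exists2 t, 0 < t & forall s, 0 < s <= t ->
    (phi (x + s *: v)%R < (c + s * b)%:E)%E.
Proof.
move=> xc; rewrite /slope_lt/= xc; split => [[m]|[t t0 H]].
  rewrite -EFinD => xm; exists m.+1%:R^-1; first by rewrite invr_gt0.
  by move=> s; exact: (slope_shrink xc xm).
exists (Num.truncn t^-1); rewrite -EFinD; apply: H.
rewrite invr_gt0 ltr0n/= invf_ple ?posrE//.
by rewrite ltW// truncnS_gt.
Qed.

Lemma convex_midpoint x v c d e : phi x = c%:E ->
  (phi (x + v)%R <= d%:E)%E -> (phi (x - v)%R <= e%:E)%E -> 2 * c <= d + e.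
Proof.
move=> xc xd xe; have h01 : 0 <= (2^-1 : R) <= 1 by lra.
have := phi_cvx h01 xd xe.
have -> : 2^-1 *: (x + v) + (1 - 2^-1) *: (x - v) = x.
  have -> : 1 - 2^-1 = 2^-1 :> R by field.
  rewrite -scalerDr addrACA subrr addr0 scalerDr -scalerDl.
  have -> : 2^-1 + 2^-1 = 1 :> R by field.
  by rewrite scale1r.
rewrite xc lee_fin => H; clear -H; lra.
Qed.

(** The one-sided derivatives along [v] and [- v] have nonnegative sum, because [x] is the midpoint
    of [x + s v] and [x - s v]; here [s] is a step that serves both directions. *)
Lemma slope_opp x v b b' c : phi x = c%:E ->
  slope_lt v b x -> slope_lt (- v) b' x -> 0 < b + b'.
Proof.
move=> xc /(slope_ltP _ _ xc)[t t0 Ht] /(slope_ltP _ _ xc)[t' t0' Ht'].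
pose s := Num.min t t'.
have s0 : 0 < s by rewrite lt_min t0.
have /Ht xs : 0 < s <= t by rewrite s0 ge_min lexx.
have /Ht' : 0 < s <= t' by rewrite s0 ge_min lexx orbT.
rewrite scalerN => xs'.
have fd : phi (x + s *: v) = (fine (phi (x + s *: v)))%:E.
  by apply: dom_phi_fin; rewrite /dom_phi/= (lt_trans xs)// ltry.
have fd' : phi (x - s *: v) = (fine (phi (x - s *: v)))%:E.
  by apply: dom_phi_fin; rewrite /dom_phi/= (lt_trans xs')// ltry.
have H : 2 * c <= fine (phi (x + s *: v)) + fine (phi (x - s *: v)).
  by apply: (convex_midpoint xc (v := s *: v)); rewrite -?fd -?fd'.
move: xs xs'; rewrite fd fd' !lte_fin => xs xs'.
have : 0 < s * (b + b') by clear -xs xs' H; lra.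
by rewrite pmulr_rgt0.
Qed.

Lemma gradient_slope_lt x y v e : is_gradient phi x y -> 0 < e ->
  slope_lt v (dot v y + e) x.
Proof.
move=> [xU df dfE] e0.
have /gradient_littleoP H : differentiable (fine \o phi) x /\
    forall v, 'd (fine \o phi) x v = dot v y by [].
have v1 : 0 < `|v| + 1 by rewrite ltr_wpDl.
have {}H := H (e / (`|v| + 1)) (divr_gt0 e0 v1).
have v0 : (fun m : nat => m.+1%:R^-1 *: v) @ \oo --> (0 : 'rV[R]_n).
  rewrite -(scale0r v); apply: cvgZr_tmp; exact: cvg_harmonic.
have xv : (fun m : nat => m.+1%:R^-1 *: v + x) @ \oo --> x.
  by rewrite -{2}(add0r x); apply: cvgD => //; exact: cvg_cst.
have : \forall m \near \oo, phi (m.+1%:R^-1 *: v + x) \is a fin_num.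
  exact: (xv _ xU).
have : \forall m \near \oo,
  `|(fine \o phi) (m.+1%:R^-1 *: v + x) -
    ((fine \o phi) x + dot (m.+1%:R^-1 *: v) y)| <=
    e / (`|v| + 1) * `|m.+1%:R^-1 *: v|.
  exact: (v0 _ H).
move=> H1 H2; near \oo => m.
have : phi (m.+1%:R^-1 *: v + x) \is a fin_num by near: m.
have : `|(fine \o phi) (m.+1%:R^-1 *: v + x) -
    ((fine \o phi) x + dot (m.+1%:R^-1 *: v) y)| <=
    e / (`|v| + 1) * `|m.+1%:R^-1 *: v| by near: m.
move=> H3 H4; exists m; rewrite [(x + _)%R]addrC.
rewrite -(fineK H4) -(fineK (nbhs_singleton xU)) -EFinD lte_fin.
move: H4 H3 => _; rewrite /= dotZl normrZ ger0_norm; last by rewrite invr_ge0.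
set a := fine _; set b := fine (phi x); set k := _^-1.
have k0 : 0 < k by rewrite invr_gt0.
rewrite ler_norml => /andP[_ H5].
have H6 : e / (`|v| + 1) * (k * `|v|) < k * e.
  have -> : e / (`|v| + 1) * (k * `|v|) = k * (e * (`|v| / (`|v| + 1))).
    by field; rewrite gt_eqF.
  by rewrite ltr_pM2l// gtr_pMr// ltr_pdivrMr// mul1r ltrDl.
clear -H5 H6; lra.
Unshelve. all: by end_near. Qed.

(** Induction on the number [k] of coordinates in which [z] may be nonzero. The bounds along the
    axes are glued one at a time by midpoint convexity. *)
Lemma slope_upper x y c : phi x = c%:E ->
  (forall i e, 0 < e -> slope_lt (delta_mx ord0 i) (y ord0 i + e) x /\
     slope_lt (- delta_mx ord0 i) (- y ord0 i + e) x) ->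
  forall e, 0 < e -> exists2 d, 0 < d & forall z, `|z| <= d ->
    (phi (x + z)%R <= (c + dot z y + e * norm1 z)%:E)%E.
Proof.
move=> xc sl e e0.
suff H (k : nat) : exists2 d, 0 < d &
    forall z, (forall i : 'I_n, (k <= i)%N -> z ord0 i = 0) -> `|z| <= d ->
    (phi (x + z)%R <= (c + dot z y + e * norm1 z)%:E)%E.
  have [d d0 {}H] := H n.
  by exists d => // z; apply: H => i; rewrite leqNgt ltn_ord.
elim: k => [|k [d d0 IH]].
  exists 1 => // z z0 _.
  have -> : z = 0 by apply/rowP => i; rewrite z0// mxE.
  rewrite addr0 xc dot0l addr0 /norm1 big1 ?mulr0 ?addr0//.
  by move=> i _; rewrite mxE normr0.
have [kn|kn] := ltnP k n; last first.
  by exists d => // z z0; apply: IH => i /(leq_trans kn); rewrite leqNgt ltn_ord.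
pose i := Ordinal kn.
have [/(slope_ltP _ _ xc)[t t0 Ht] /(slope_ltP _ _ xc)[t' t0' Ht']] := sl i e e0.
(* The radius is halved because [x + z] is the midpoint of [x + 2 w] and [x + 2 z_i e_i], where [w]
   is [z] without its [i]-th coordinate: both doubled displacements must remain within the known
   ranges. *)
exists (Num.min d (Num.min t t') / 2).
  by rewrite divr_gt0// !lt_min d0 t0 t0'.
move=> z z0; rewrite ler_pdivlMr// !le_min mulrC => /and3P[zd zt zt'].
pose w := z - z ord0 i *: delta_mx ord0 i.
have wi j : w ord0 j = if j == i then 0 else z ord0 j.
  rewrite !mxE eqxx /=; case: eqP => [->|_]; first by rewrite mulr1 subrr.
  by rewrite mulr0 subr0.
have zE : z = w + z ord0 i *: delta_mx ord0 i by rewrite subrK.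
have {}IH : (phi (x + 2 *: w)%R <= (c + dot (2 *: w) y + e * norm1 (2 *: w))%:E)%E.
  apply: IH => [j kj|].
    rewrite mxE wi; case: eqP => [_|/eqP ji]; first by rewrite mulr0.
    rewrite z0 ?mulr0// ltn_neqAle kj andbT; apply: contraNN ji => /eqP kj'.
    by apply/eqP/val_inj.
  apply: le_trans zd; rewrite normrZ ger0_norm// ler_pM2l//.
  apply: normr_le => // j; rewrite wi; case: ifP => _; first by rewrite normr0.
  exact: coord_le_norm.
have zi : 2 * `|z ord0 i| <= 2 * `|z| by rewrite ler_pM2l// coord_le_norm.
have {}sl : (phi (x + (2 * z ord0 i) *: delta_mx ord0 i)%R <=
    (c + 2 * z ord0 i * y ord0 i + 2 * e * `|z ord0 i|)%:E)%E.
  have [z0'|z0'|z0'] := ltgtP (z ord0 i) 0.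
  - have := Ht' (- (2 * z ord0 i)); rewrite scalerN scaleNr opprK => H.
    rewrite ltr0_norm// in zi *.
    rewrite (le_trans (ltW (H _)))//; first by apply/andP; split; lra.
    by rewrite lee_fin; lra.
  - rewrite gtr0_norm// in zi *.
    rewrite (le_trans (ltW (Ht _ _)))//; first by apply/andP; split; lra.
    by rewrite lee_fin; lra.
  - by rewrite z0' !(mulr0,scale0r,mul0r,addr0) normr0 mulr0 addr0 xc.
have h01 : 0 <= (2^-1 : R) <= 1 by lra.
have := phi_cvx h01 IH sl.
have -> : 2^-1 *: (x + 2 *: w) +
    (1 - 2^-1) *: (x + (2 * z ord0 i) *: delta_mx ord0 i) = x + z.
  rewrite {2}zE (_ : 1 - 2^-1 = 2^-1 :> R); last by field.
  rewrite -scalerDr addrACA -scalerA -scalerDr [LHS]scalerDr scalerA mulVf//.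
  rewrite scale1r; congr (_ + _).
  by rewrite scalerDr -scalerDl (_ : 2^-1 + 2^-1 = 1 :> R) ?scale1r//; field.
move=> /le_trans; apply; rewrite lee_fin.
have -> : dot z y = dot w y + z ord0 i * y ord0 i.
  by rewrite {1}zE dotDl dotZl [dot (delta_mx _ _) y]dotC dot_delta.
have -> : norm1 z = norm1 w + `|z ord0 i|.
  rewrite /norm1 (bigD1 i)//= [in RHS](bigD1 i)//= wi eqxx normr0 add0r addrC.
  by congr (_ + _); apply: eq_bigr => j ji; rewrite wi (negbTE ji).
have -> : norm1 (2 *: w) = 2 * norm1 w.
  by rewrite /norm1 mulr_sumr; apply: eq_bigr => j _; rewrite mxE normrM ger0_norm.
rewrite dotZl.
set A := dot w y; set B := norm1 w; set C := `|_|.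
rewrite le_eqVlt; apply/orP; left; by apply/eqP; field.
Qed.

(** For a convex function, partial derivatives at an interior point give differentiability:
    [slope_upper] bounds [phi (x + z)] from above, and the same bound at [- z] together with
    midpoint convexity bounds it from below. *)
Lemma is_gradientP x y : is_gradient phi x y <-> U x /\
  (forall i e, 0 < e -> slope_lt (delta_mx ord0 i) (y ord0 i + e) x /\
     slope_lt (- delta_mx ord0 i) (- y ord0 i + e) x).
Proof.
split => [xy|[xU sl]].
  split.
    have [xU _ _] := xy; apply: filterS xU => z.
    by rewrite /dom_phi/= fin_numE lt_neqAle leey andbT => /andP[].
  move=> i e e0; split.
    by have := gradient_slope_lt (delta_mx ord0 i) xy e0; rewrite dotC dot_delta.
  have := gradient_slope_lt (- delta_mx ord0 i) xy e0.
  by rewrite dotNl dotC dot_delta.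
have xc := dom_phi_fin (nbhs_singleton xU).
set c := fine (phi x) in xc.
suff /gradient_littleoP[df dfE] : forall e, 0 < e -> \forall z \near (0 : 'rV[R]_n),
    `|(fine \o phi) (z + x) - ((fine \o phi) x + dot z y)| <= e * `|z|.
  by split => //; exact: interior_dom_fin.
(* [norm1 z] is at most [n |z|]; dividing by [n + 1] avoids a zero denominator. *)
move=> e e0; pose e' := e / n.+1%:R.
have e0' : 0 < e' by rewrite divr_gt0.
have [d d0 H] := slope_upper xc sl e0'.
have zd0 : \forall z \near (0 : 'rV[R]_n), `|z| <= d by exact: nbhs0_le.
near=> z.
have zd : `|z| <= d by near: z.
have Hz := H _ zd.
have HNz : (phi (x - z)%R <= (c + dot (- z) y + e' * norm1 (- z))%:E)%E.
  by apply: H; rewrite normrN.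
have fd : phi (x + z) = (fine (phi (x + z)))%:E.
  by apply: dom_phi_fin; rewrite /dom_phi/= (le_lt_trans Hz)// ltry.
have := convex_midpoint xc (_ : phi (x + z) <= (fine (phi (x + z)))%:E)%E HNz.
rewrite -fd lexx => /(_ isT); rewrite norm1N dotNl.
have n1 : norm1 z <= n%:R * `|z|.
  rewrite /norm1 (le_trans (ler_sum _ (fun i _ => coord_le_norm z i)))//.
  by rewrite sumr_const card_ord -[leLHS]mulr_natl.
have e'E : e' * norm1 z <= e * `|z|.
  rewrite /e' mulrAC ler_pdivrMr// -mulrA ler_pM2l// (le_trans n1)//.
  by rewrite mulrC ler_wpM2l// ler_nat.
move: Hz; rewrite fd lee_fin /= [z + x]addrC -/c.
clear -e'E; move: (fine _) (dot z y) e'E => a b H1 H2 H3.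
rewrite ler_norml; apply/andP; split; lra.
Unshelve. all: by end_near. Qed.

Lemma is_gradient_unique x y y' : is_gradient phi x y -> is_gradient phi x y' ->
  y = y'.
Proof.
move=> [_ _ yE] [_ _ yE']; apply/rowP => i.
rewrite -[LHS]dot_delta -[RHS]dot_delta ![dot _ (delta_mx _ _)]dotC.
by rewrite -yE -yE'.
Qed.

End convex_ereal.

(** * Almost everywhere existence and measurability of the gradient in the interior of the domain *)

Section gradient_ae.
Context {R : realType} {n : nat}.
Implicit Types (x y z u v : 'rV[R]_n) (b c d : R).
Variable phi : 'rV[R]_n -> \bar R.
Hypotheses (phi_cvx : convex_ereal phi) (phi_low : forall x, (-oo < phi x)%E).
Hypothesis mphi : measurable_fun setT phi.
Local Notation leb := (@lebesgue_rV R n).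
Local Notation dom := (dom_phi phi).
Local Notation U := (interior dom).

Lemma measurable_slope_lt v b : measurable (slope_lt phi v b).
Proof.
rewrite (_ : slope_lt phi v b = \bigcup_m [set x |
    (phi (1 *: x + m.+1%:R^-1 *: v)%R < phi x + (m.+1%:R^-1 * b)%:E)%E]).
  apply: bigcup_measurable => m _; rewrite -[X in measurable X]setTI.
  apply: measurable_lte => //.
  - exact: (measurableT_comp mphi (measurable_affine_rV 1 (m.+1%:R^-1 *: v))).
  - by apply: emeasurable_funD.
apply/seteqP; split => x.
  by move=> [m xm]; exists m => //=; rewrite scale1r.
by move=> [m _ /=]; rewrite scale1r => xm; exists m.
Qed.

Lemma slope_lt_le x v b b' : b <= b' -> slope_lt phi v b x -> slope_lt phi v b' x.
Proof.
move=> bb' [m xm]; exists m; rewrite (lt_le_trans xm)// leeD2l// lee_fin.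
by rewrite ler_pM2l// invr_gt0.
Qed.

Lemma slope_lt_ex x v : U x -> exists b, slope_lt phi v b x.
Proof.
move=> xU; have xc := dom_phi_fin phi_low (nbhs_singleton xU).
set c := fine (phi x) in xc.
have v0 : (fun m : nat => m.+1%:R^-1 *: v) @ \oo --> (0 : 'rV[R]_n).
  rewrite -(scale0r v); apply: cvgZr_tmp; exact: cvg_harmonic.
have xv : (fun m : nat => m.+1%:R^-1 *: v + x) @ \oo --> x.
  by rewrite -{2}(add0r x); apply: cvgD => //; exact: cvg_cst.
have [m _ mdom] : \forall m \near \oo, dom (m.+1%:R^-1 *: v + x).
  exact: (xv _ xU).
have {}mdom := mdom m (leqnn m).
exists (m.+1%:R * (fine (phi (m.+1%:R^-1 *: v + x)) - c + 1)); exists m.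
rewrite [(x + _)%R]addrC xc (dom_phi_fin phi_low mdom) -EFinD lte_fin.
rewrite /= mulKf ?pnatr_eq0//; move: (fine _) => d; clear; lra.
Qed.

(** The strict inequality at a sampled step leaves room between the quotient and [b]. This slack is
    what gives strict bounds on the gradient in [measurable_gradient_of]. *)
Lemma slope_lt_open x v b : U x -> slope_lt phi v b x ->
  exists2 b', b' < b & slope_lt phi v b' x.
Proof.
move=> xU; have xc := dom_phi_fin phi_low (nbhs_singleton xU).
set c := fine (phi x) in xc.
move=> [m]; rewrite xc; set k := _^-1; have k0 : 0 < k by rewrite invr_gt0.
move=> xm; have xmd : dom (x + k *: v) by rewrite /dom_phi/= (lt_trans xm)// -EFinD ltry.
move: xm; rewrite (dom_phi_fin phi_low xmd) -EFinD lte_fin.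
move: (fine _) (dom_phi_fin phi_low xmd) => d xmE xm.
have dk : (d - c) / k < b by rewrite ltr_pdivrMr//; clear -xm; lra.
exists (((d - c) / k + b) / 2); first by clear -dk; lra.
exists m; rewrite -/k xmE xc -EFinD lte_fin.
have : d - c < k * b by clear -xm; lra.
have -> : k * (((d - c) / k + b) / 2) = ((d - c) + k * b) / 2.
  by field; rewrite gt_eqF.
by clear; lra.
Qed.

Definition gradient_dom : set 'rV[R]_n := [set x | exists y, is_gradient phi x y].

(** Along each axis the left slope is at most the right slope, and they agree unless two rationals
    fit between them. Existence of a gradient thus becomes countably many conditions on measurable
    sets. *)
Lemma gradient_domE : gradient_dom = [set x | U x /\
  forall (i : 'I_n) (q q' : rat), q < q' ->
    slope_lt phi (delta_mx ord0 i) (ratr q') x \/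
    slope_lt phi (- delta_mx ord0 i) (- ratr q) x].
Proof.
apply/seteqP; split => x.
  move=> [y /(is_gradientP phi_cvx phi_low)[xU sl]]; split => // i q q' qq'.
  have [yq|yq] := ltP (y ord0 i) (ratr q').
    left; have e0 : 0 < ratr q' - y ord0 i by rewrite subr_gt0.
    by have [+ _] := sl i _ e0; rewrite addrC subrK.
  right; have e0 : 0 < y ord0 i - ratr q.
    by rewrite subr_gt0 (lt_le_trans _ yq)// ltr_rat.
  by have [_] := sl i _ e0; rewrite addKr.
move=> [xU sl]; have xc := dom_phi_fin phi_low (nbhs_singleton xU).
pose A i := [set b | slope_lt phi (delta_mx ord0 i) b x].
have Ainf i : has_inf (A i).
  split; first by have [b] := slope_lt_ex (delta_mx ord0 i) xU; exists b.
  have [b' xb'] := slope_lt_ex (- delta_mx ord0 i) xU.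
  exists (- b') => b xb; have := slope_opp phi_cvx phi_low xc xb xb'.
  by move=> ?; rewrite lerNl -subr_ge0 opprK addrC ltW.
(* The [i]-th coordinate of the candidate is the right derivative along the [i]-th axis, as the
   infimum of its strict upper bounds. *)
exists (\row_i inf (A i)); apply/(is_gradientP phi_cvx phi_low); split => // i e e0.
rewrite mxE; split.
  have [b Ab bA] := inf_adherent e0 (Ainf i).
  exact: slope_lt_le (ltW bA) Ab.
(* Rationals [q < q'] are taken between [inf (A i) - e] and [inf (A i)]. As [q'] is too small to
   bound the right slope, the hypothesis yields the left-slope alternative with
   [- q < - inf (A i) + e]. *)
have /rat_in_itvoo[q] : inf (A i) - e < inf (A i) by rewrite ltrBlDr ltrDl.
rewrite in_itv/= => /andP[q1 q2].
have /rat_in_itvoo[q'] := q2; rewrite in_itv/= => /andP[qq' q'2].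
rewrite ltr_rat in qq'.
have [xq'|] := sl i _ _ qq'.
  by have := ge_inf (Ainf i).2 xq'; rewrite leNgt q'2.
by apply: slope_lt_le; lra.
Qed.

Lemma measurable_dom : measurable dom.
Proof.
by rewrite -[X in measurable X]setTI; exact: emeasurable_fun_infty_o.
Qed.

Lemma measurable_interior_dom : measurable U.
Proof. by apply: open_rV_measurable; exact: open_interior. Qed.

(* Points of U where the one-sided slopes of phi along the i-th axis are
   separated by qq'.1 < qq'.2; a line in direction i meets such a set at most
   once. *)
Definition gradient_kink (i : 'I_n) (qq' : rat * rat) : set 'rV[R]_n :=
  U `\` (slope_lt phi (delta_mx ord0 i) (ratr qq'.2) `|`
         slope_lt phi (- delta_mx ord0 i) (- ratr qq'.1)).

Lemma measurable_gradient_kink i qq' : measurable (gradient_kink i qq').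
Proof.
apply: measurableD; first exact: measurable_interior_dom.
by apply: measurableU; exact: measurable_slope_lt.
Qed.

Lemma gradient_domD : U `\` gradient_dom =
  \bigcup_(iqq in [set iqq : 'I_n * (rat * rat) | iqq.2.1 < iqq.2.2])
    gradient_kink iqq.1 iqq.2.
Proof.
rewrite gradient_domE; apply/seteqP; split => x.
  move=> [xU] /not_andP[//|/existsNP[i /existsNP[q /existsNP[q']]]].
  move=> /not_implyP[qq' xq]; exists (i, (q, q')) => //; split => //.
move=> [[i [q q']] /= qq' [xU xq]]; split => // -[_ /(_ i _ _ qq')].
exact: xq.
Qed.

Lemma gradient_dom_sub : gradient_dom `<=` U.
Proof. by rewrite gradient_domE => x []. Qed.

Lemma measurable_gradient_dom : measurable gradient_dom.
Proof.
have -> : gradient_dom = U `\` (U `\` gradient_dom).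
  by rewrite setDD; apply/esym/setIidPr; exact: gradient_dom_sub.
apply: measurableD; first exact: measurable_interior_dom.
rewrite gradient_domD; apply: countable_bigcup_measurable => iqq.
exact: measurable_gradient_kink.
Qed.

Lemma gradient_kink0 i q q' : q < q' -> leb (gradient_kink i (q, q')) = 0%E.
Proof.
move=> qq'.
apply: (@lebesgue_rV_sections0 _ _ (delta_mx ord0 i)).
  exact: measurable_gradient_kink.
set e := delta_mx _ _.
(* The right slope at [t1] is at least [q'] and the left slope at [t2] is at most [q], so the
   increment of [phi] between them would be at least [q' (t2 - t1)] and at most [q (t2 - t1)]. *)
have H x (t1 t2 : R) : gradient_kink i (q, q') (x + t1 *: e) ->
    gradient_kink i (q, q') (x + t2 *: e) -> t1 < t2 -> False.
  move=> [xU1 /not_orP[/= sl1 _]] [xU2 /not_orP[/= _ sl2]] t12.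
  have x1c := dom_phi_fin phi_low (nbhs_singleton xU1).
  have x2c := dom_phi_fin phi_low (nbhs_singleton xU2).
  set c1 := fine _ in x1c; set c2 := fine _ in x2c.
  have s0 : 0 < t2 - t1 by rewrite subr_gt0.
  have H1 : c1 + (t2 - t1) * ratr q' <= c2.
    rewrite leNgt; apply/negP => c2lt; apply: sl1.
    apply/(slope_ltP phi_cvx phi_low _ _ x1c); exists (t2 - t1) => // s.
    apply: (slope_shrink phi_cvx phi_low x1c).
    by rewrite -addrA -scalerDl [t1 + _]addrC subrK x2c lte_fin.
  have H2 : c2 + (t2 - t1) * - ratr q <= c1.
    rewrite leNgt; apply/negP => c1lt; apply: sl2.
    apply/(slope_ltP phi_cvx phi_low _ _ x2c); exists (t2 - t1) => // s.
    apply: (slope_shrink phi_cvx phi_low x2c).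
    rewrite scalerN -scaleNr opprB -addrA -scalerDl [t2 + (t1 - _)]addrC subrK.
    by rewrite x1c lte_fin.
  have : (t2 - t1) * ratr q' <= (t2 - t1) * ratr q :> R by clear -H1 H2; lra.
  by rewrite ler_pM2l// ler_rat leNgt qq'.
move=> x t1 t2 x1 x2; case: (ltgtP t1 t2) => // t12.
  by have := H _ _ _ x1 x2 t12.
by have := H _ _ _ x2 x1 t12.
Qed.

Lemma gradient_dom_negl_interior : leb.-negligible (U `\` gradient_dom).
Proof.
rewrite gradient_domD.
have : leb.-negligible (\bigcup_k (if unpickle k is Some iqq then
    if (iqq : 'I_n * (rat * rat)).2.1 < iqq.2.2
    then gradient_kink iqq.1 iqq.2 else set0 else set0)).
  apply: negligible_bigcup => k.
  case: unpickle => [[i [q q']]|]; last exact: negligible_set0.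
  case: ifPn => [qq'|_]; last exact: negligible_set0.
  by apply/negligibleP; [exact: measurable_gradient_kink|exact: gradient_kink0].
apply: negligibleS => x [iqq qq' xk].
by exists (pickle iqq) => //; rewrite pickleK qq'.
Qed.

Definition gradient_of x : 'rV[R]_n := get [set y | is_gradient phi x y].

Lemma gradient_ofP x : gradient_dom x -> is_gradient phi x (gradient_of x).
Proof.
move=> [y xy]; rewrite /gradient_of.
exact: (@getI _ [set y | is_gradient phi x y] y).
Qed.

Lemma gradient_preimage (A : set 'rV[R]_n) :
  [set x | exists2 y, A y & is_gradient phi x y] =
  gradient_dom `&` gradient_of @^-1` A.
Proof.
apply/seteqP; split => x.
  move=> [y Ay xy]; have xD : gradient_dom x by exists y.
  split => //=; have := is_gradient_unique (gradient_ofP xD) xy.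
  by move=> ->.
move=> [xD xA]; exists (gradient_of x) => //; exact: gradient_ofP.
Qed.

(** On [gradient_dom], membership of the gradient in an open box amounts to strict bounds on the
    one-sided slopes along the axes, that is to finitely many sets [slope_lt]. *)
Lemma measurable_gradient_of : measurable_fun gradient_dom gradient_of.
Proof.
apply: measurable_fun_rVP => a b.
have -> : gradient_dom `&` gradient_of @^-1` open_box a b = gradient_dom `&`
    \bigcap_(i in setT) (slope_lt phi (delta_mx ord0 i) (b i) `&`
      slope_lt phi (- delta_mx ord0 i) (- a i)).
  apply/seteqP; split => x [xD xab]; split => //.
    have /(is_gradientP phi_cvx phi_low)[xU sl] := gradient_ofP xD.
    move=> i _; have /andP[xa xb] := xab i.
    rewrite -subr_gt0 in xa; rewrite -subr_gt0 in xb.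
    have [_ H1] := sl i _ xa; have [H2 _] := sl i _ xb.
    by move: H1 H2; rewrite addKr [_ + (b i - _)]addrC subrK.
  move=> i; have [xb xa] := xab i I.
  have /(is_gradientP phi_cvx phi_low)[xU sl] := gradient_ofP xD.
  have xc := dom_phi_fin phi_low (nbhs_singleton xU).
  have [b' b'b {}xb] := slope_lt_open xU xb.
  have [a' a'a {}xa] := slope_lt_open xU xa.
  apply/andP; split.
    rewrite ltNge; apply/negP => ax.
    have e0 : 0 < - a' - gradient_of x ord0 i by clear -a'a ax; lra.
    have [H _] := sl i _ e0; have := slope_opp phi_cvx phi_low xc H xa.
    by move=> H'; clear -H'; lra.
  rewrite ltNge; apply/negP => bx.
  have e0 : 0 < gradient_of x ord0 i - b' by clear -b'b bx; lra.
  have [_ H] := sl i _ e0; have := slope_opp phi_cvx phi_low xc xb H.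
  by move=> H'; clear -H'; lra.
apply: measurableI; first exact: measurable_gradient_dom.
apply: fin_bigcap_measurable => [|i _]; first exact: finite_finset.
by apply: measurableI; exact: measurable_slope_lt.
Qed.

End gradient_ae.

(** * Negligibility of the boundary of the domain *)

Section dom_boundary.
Context {R : realType} {n : nat}.
Implicit Types (x y z u v : 'rV[R]_n) (b c d : R).
Variable phi : 'rV[R]_n -> \bar R.
Hypotheses (phi_cvx : convex_ereal phi) (phi_low : forall x, (-oo < phi x)%E).
Hypothesis mphi : measurable_fun setT phi.
Variables (rho K : R).
Hypothesis rho0 : 0 < rho.
Hypothesis phi_ball : forall x, `|x| <= rho -> (phi x <= K%:E)%E.
Local Notation leb := (@lebesgue_rV R n).
Local Notation dom := (dom_phi phi).
Local Notation U := (interior dom).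

(** The ball of radius [(1 - s) rho] around [s x] consists of the points [s x + (1 - s) b] with
    [|b| < rho], where convexity bounds [phi]. *)
Lemma dom_shrink x s : dom x -> 0 <= s < 1 -> U (s *: x).
Proof.
move=> xd /andP[s0 s1]; have s1' : 0 < 1 - s by rewrite subr_gt0.
apply/nbhs_ballP; exists ((1 - s) * rho) => /=; first exact: mulr_gt0.
move=> z; rewrite -ball_normE/= => zs.
pose b := (1 - s)^-1 *: (z - s *: x).
have br : `|b| <= rho.
  rewrite /b normrZ ger0_norm; last by rewrite invr_ge0 ltW.
  by rewrite ler_pdivrMl// distrC ltW.
have s01 : 0 <= s <= 1 by rewrite s0 ltW.
have := phi_cvx s01 (_ : phi x <= (fine (phi x))%:E)%E (phi_ball br).
rewrite -(dom_phi_fin phi_low xd) lexx => /(_ isT).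
rewrite /b scalerA divff ?gt_eqF// scale1r addrC subrK => /le_lt_trans; apply.
exact: ltry.
Qed.

(* Shrinking dom towards 0 by any factor s < 1 puts it inside U. *)
Lemma dom_boundary_negl : leb.-negligible (dom `\` U).
Proof.
have mD := measurable_dom mphi.
have mU := @measurable_interior_dom _ _ phi.
(* Cutting by cubes makes the measures finite, so that they can be subtracted; shrinking towards 0
   preserves each cube. *)
have -> : dom `\` U = \bigcup_k ((dom `&` cube k%:R) `\` (U `&` cube k%:R)).
  rewrite -[LHS]setIT -bigcup_cube setI_bigcupr.
  apply: eq_bigcupr => k _; apply/seteqP; split => x.
    by move=> [[xd xU] xk]; split => // -[].
  by move=> [[xd xk] xUk]; split => //; split => // xU; apply: xUk.
apply: negligible_bigcup => k.
have mc := @measurable_cube R n k%:R.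
have mDk := measurableI _ _ mD mc; have mUk := measurableI _ _ mU mc.
apply/negligibleP; first exact: measurableD.
have cfin : (leb (cube k%:R) < +oo)%E by rewrite lebesgue_cube ?ltry.
have Dfin : (leb (dom `&` cube k%:R) < +oo)%E.
  by rewrite (le_lt_trans _ cfin)// le_measure ?inE.
have UD : (dom `&` cube k%:R) `&` (U `&` cube k%:R) = U `&` cube k%:R.
  apply/setIidPr; apply: setSI; exact: interior_subset.
have UDle : (leb (U `&` cube k%:R) <= leb (dom `&` cube k%:R))%E.
  by rewrite le_measure ?inE//; apply: setSI; exact: interior_subset.
rewrite measureD// UD.
suff DU : (leb (dom `&` cube k%:R) <= leb (U `&` cube k%:R))%E.
  have E : leb (dom `&` cube k%:R) = leb (U `&` cube k%:R).
    by apply/le_anti/andP.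
  transitivity (leb (U `&` cube k%:R) - leb (U `&` cube k%:R))%E.
    by congr (_ - _)%E.
  by rewrite subee// ge0_fin_numE// (le_lt_trans UDle).
(* Shrinking by [s = exp (- t)] costs the factor [s ^ - n = exp (t n)], which is removed below by
   making [t] small. *)
have scal t : 0 < t ->
    (leb (dom `&` cube k%:R) <= (expR (t * n%:R))%:E * leb (U `&` cube k%:R))%E.
  move=> t0; pose s := expR (- t).
  have s0 : 0 < s by exact: expR_gt0.
  have s1 : s < 1 by rewrite expR_lt1 oppr_lt0.
  have -> : expR (t * n%:R) = `|s| ^- n.
    by rewrite gtr0_norm// /s -expRM_natr mulNr expRN invrK.
  have sn0 : s != 0 by rewrite gt_eqF.
  rewrite -(lebesgue_rV_affine 0 sn0)//.
  apply: le_measure; rewrite ?inE//.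
    rewrite -[X in measurable X]setTI.
    exact: (measurable_affine_rV s 0).
  move=> x [xd xk] /=; rewrite addr0; split.
    by apply: dom_shrink => //; rewrite ltW.
  move: xk; rewrite !cubeE => /= xk i; rewrite mxE normrM gtr0_norm//.
  by rewrite (le_lt_trans _ (xk i))// ler_piMl// ltW.
have [a UE] : exists a, leb (U `&` cube k%:R) = a%:E.
  exists (fine (leb (U `&` cube k%:R))).
  by rewrite fineK// ge0_fin_numE// (le_lt_trans UDle).
have [b DE] : exists b, leb (dom `&` cube k%:R) = b%:E.
  by exists (fine (leb (dom `&` cube k%:R))); rewrite fineK// ge0_fin_numE.
have b0 : (0 <= b%:E)%E by rewrite -DE.
rewrite lee_fin in b0.
rewrite UE DE lee_fin; apply/ler_addgt0Pr => e e0.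
move: scal; rewrite UE DE => scal.
have bn0 : 0 <= b * n%:R by rewrite mulr_ge0.
have bn1 : 0 < b * n%:R + 1 by rewrite ltr_wpDl.
have := scal _ (divr_gt0 e0 bn1); set t := e / _; rewrite -EFinM lee_fin => H.
have {}H : b * expR (- (t * n%:R)) <= a by rewrite expRN ler_pdivrMr ?expR_gt0// mulrC.
have : b * (1 - t * n%:R) <= a.
  by rewrite (le_trans _ H)// ler_wpM2l// expR_ge1Dx.
have : b * n%:R * t <= e.
  by rewrite /t mulrCA ger_pMr// ler_pdivrMr// mul1r lerDl.
move=> H1 H2; rewrite (le_trans _ (lerD H2 H1))// [leRHS](_ : _ = b)//; ring.
Qed.

End dom_boundary.

Section gradient_dom_negl.
Context {R : realType} {n : nat}.
Variable phi : 'rV[R]_n -> \bar R.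

Lemma gradient_dom_negl (rho K : R) : convex_ereal phi ->
  (forall x, (-oo < phi x)%E) -> measurable_fun setT phi -> 0 < rho ->
  (forall x, `|x| <= rho -> (phi x <= K%:E)%E) ->
  (@lebesgue_rV R n).-negligible (dom_phi phi `\` gradient_dom phi).
Proof.
move=> cvx low mphi rho0 ball.
apply: negligibleS (negligibleU (dom_boundary_negl cvx low mphi rho0 ball)
  (gradient_dom_negl_interior cvx low mphi)) => x [xd xg].
by have [xU|xU] := pselect (interior (dom_phi phi) x); [right|left].
Qed.

End gradient_dom_negl.

(** * The gradient of an even convex function is odd *)

Section gradient_even.
Context {R : realType} {n : nat}.
Implicit Types (x y z v : 'rV[R]_n).
Variable phi : 'rV[R]_n -> \bar R.
Hypotheses (phi_cvx : convex_ereal phi) (phi_low : forall x, (-oo < phi x)%E).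
Hypothesis phi_even : forall x, phi (- x) = phi x.

Lemma slope_lt_opp v b x : slope_lt phi v b (- x) <-> slope_lt phi (- v) b x.
Proof.
suff H k : phi (- x + k *: v) = phi (x + k *: - v).
  by split => -[m xm]; exists m; move: xm; rewrite H phi_even.
by rewrite -phi_even opprD opprK scalerN.
Qed.

Lemma is_gradient_opp x y : is_gradient phi x y -> is_gradient phi (- x) (- y).
Proof.
move=> /(is_gradientP phi_cvx phi_low)[xU sl].
apply/(is_gradientP phi_cvx phi_low); split.
  have /nbhs_ballP[e /= e0 xe] := xU.
  apply/nbhs_ballP; exists e => // z; rewrite -ball_normE /= => xz.
  rewrite /dom_phi /= -phi_even; apply: xe; rewrite -ball_normE /=.
  by rewrite opprK -normrN opprD.
move=> i e e0; have [H1 H2] := sl i e e0.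
by split; apply/slope_lt_opp; rewrite !mxE ?opprK.
Qed.

Lemma gradient_dom_opp x : gradient_dom phi (- x) <-> gradient_dom phi x.
Proof.
by split => -[y /is_gradient_opp]; rewrite ?opprK => xy; exists (- y).
Qed.

Lemma gradient_of_opp x : gradient_dom phi x ->
  gradient_of phi (- x) = - gradient_of phi x.
Proof.
move=> xD; have xD' : gradient_dom phi (- x) by apply/gradient_dom_opp.
apply: (is_gradient_unique (gradient_ofP xD')).
exact: is_gradient_opp (gradient_ofP xD).
Qed.

End gradient_even.

(** * Existence of a maximizer *)

Section coercivity.
Context {R : realType} {n : nat}.
Implicit Types (x y z u v : 'rV[R]_n) (h : 'rV[R]_n -> \bar R).
Variable mu : {finite_measure set 'rV[R]_n -> \bar R}.
Hypotheses (mu_even : even_measure mu)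
  (mu_moment : (\int[mu]_x (enorm x)%:E < +oo)%E)
  (mu_hyperplane : forall H : set 'rV[R]_n, hyperplane H -> ~ supported_on mu H).

Lemma coord_le_enorm x i : `|x ord0 i| <= enorm x.
Proof.
rewrite -sqrtr_sqr /enorm ler_wsqrtr// /dot (bigD1 i)//= -expr2 lerDl.
by apply: sumr_ge0 => j _; rewrite -expr2 sqr_ge0.
Qed.

Lemma norm1_le_enorm x : norm1 x <= n%:R * enorm x.
Proof.
rewrite /norm1 (le_trans (ler_sum _ (fun i _ => coord_le_enorm x i)))//.
by rewrite sumr_const card_ord -[leLHS]mulr_natl.
Qed.

Lemma measurable_enorm : measurable_fun setT (@enorm R n).
Proof.
apply: measurableT_comp (continuous_measurable_fun (@sqrt_continuous R)) _.
apply: measurable_sum => i; apply: measurable_funM; exact: measurable_coord.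
Qed.

Lemma norm1_moment : (\int[mu]_x (norm1 x)%:E < +oo)%E.
Proof.
have me := measurable_enorm.
apply: (@le_lt_trans _ _ (\int[mu]_x (n%:R%:E * (enorm x)%:E))%E).
  apply: ge0_le_integral => //.
  - by move=> x _; rewrite lee_fin norm1_ge0.
  - by apply/measurable_EFinP; exact: measurable_norm1.
  - by apply/measurable_EFinP; exact: measurable_funM.
  - by move=> x _; rewrite -EFinM lee_fin norm1_le_enorm.
rewrite ge0_integralZl//; last 2 first.
- exact/measurable_EFinP.
- by move=> x _; rewrite lee_fin sqrtr_ge0.
by rewrite lte_mul_pinfty ?lee_fin.
Qed.

(** Truncation at 1 bounds the integral of [trunc_dot x] by [r] times the total mass plus the
    measure of the set where [|dot y x| >= r]. Without it a lower bound on the integral would say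
    nothing about that measure. *)
Let trunc_dot x y : R := Num.min 1 `|dot y x|.

Let trunc_dot_ge0 x y : 0 <= trunc_dot x y.
Proof. by rewrite /trunc_dot le_min ler01 normr_ge0. Qed.

Let measurable_trunc_dot x : measurable_fun setT (trunc_dot x).
Proof.
apply: measurable_minr => //; apply: measurableT_comp => //.
exact: measurable_dot.
Qed.

Let muT_fin : (mu setT < +oo)%E.
Proof. by rewrite -ge0_fin_numE// fin_num_measure. Qed.

Let trunc_dot_integrable x : (\int[mu]_y (trunc_dot x y)%:E < +oo)%E.
Proof.
apply: (@le_lt_trans _ _ (\int[mu]_y (cst 1 y))%E); last first.
  by rewrite integral_cst// mul1e.
apply: ge0_le_integral => //.
- by move=> y _; rewrite lee_fin.
- exact/measurable_EFinP.
- by move=> y _; rewrite lee_fin ge_min lexx.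
Qed.

Let Ldot x : R := fine (\int[mu]_y (trunc_dot x y)%:E).

Let LdotE x : (\int[mu]_y (trunc_dot x y)%:E = (Ldot x)%:E)%E.
Proof.
by rewrite fineK// ge0_fin_numE ?integral_ge0// => y _; rewrite lee_fin.
Qed.

Let I1 : R := fine (\int[mu]_y (norm1 y)%:E).

Let I1E : (\int[mu]_y (norm1 y)%:E = I1%:E)%E.
Proof.
rewrite fineK// ge0_fin_numE ?norm1_moment//.
by apply: integral_ge0 => y _; rewrite lee_fin norm1_ge0.
Qed.

Let I1_ge0 : 0 <= I1.
Proof. by rewrite -lee_fin -I1E integral_ge0// => y _; rewrite lee_fin norm1_ge0. Qed.

(** The first moment serves as Lipschitz constant, which makes [Ldot] continuous on the unit
    sphere. *)
Let Ldot_lip x x' : Ldot x <= Ldot x' + `|x - x'| * I1.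
Proof.
rewrite -lee_fin EFinD EFinM -!LdotE -I1E.
have mn : measurable_fun setT (fun y : 'rV[R]_n => (norm1 y)%:E).
  by apply/measurable_EFinP; exact: measurable_norm1.
rewrite -ge0_integralZl//; last by move=> y _; rewrite lee_fin norm1_ge0.
rewrite -ge0_integralD//; last 4 first.
- by move=> y _; rewrite lee_fin.
- exact/measurable_EFinP.
- by move=> y _; rewrite -EFinM lee_fin mulr_ge0// norm1_ge0.
- exact: measurable_funeM.
apply: ge0_le_integral => //.
- by move=> y _; rewrite lee_fin.
- exact/measurable_EFinP.
- apply: emeasurable_funD; first exact/measurable_EFinP.
  exact: measurable_funeM.
move=> y _; rewrite -EFinM -EFinD lee_fin.
have : `|dot y x| <= `|dot y x'| + `|x - x'| * norm1 y.
  have -> : dot y x = dot y x' + dot (x - x') y.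
    by rewrite [dot (x - x') y]dotC -dotDr addrC subrK.
  by rewrite (le_trans (ler_normD _ _))// lerD2l dot_le_norm1.
have : 0 <= `|x - x'| * norm1 y by rewrite mulr_ge0// norm1_ge0.
rewrite /trunc_dot /Num.min; case: ifPn; case: ifPn => //; rewrite -?leNgt; lra.
Qed.

Let Ldot_gt0 x : x != 0 -> 0 < Ldot x.
Proof.
move=> x0; rewrite lt_neqAle -lee_fin -LdotE integral_ge0; last first.
  by move=> y _; rewrite lee_fin.
rewrite andbT; apply/eqP => /esym L0.
have H : hyperplane [set y | dot y x = 0] by exists x, 0.
apply: (mu_hyperplane H); rewrite /supported_on.
have mtd : measurable_fun setT (EFin \o trunc_dot x) by exact/measurable_EFinP.
have : (\int[mu]_y `|(EFin \o trunc_dot x) y| = 0)%E.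
  rewrite -[RHS]/(0%:E) -L0 -LdotE; apply: eq_integral => y _.
  by rewrite /= ger0_norm.
move=> /(ae_eq_integral_abs _ measurableT mtd)[N [mN N0 HN]].
apply/eqP; rewrite -measure_le0 -N0 le_measure ?inE//.
  apply: measurableC; rewrite -[X in measurable X]setTI.
  exact: (@measurable_dot R n x measurableT [set 0%R] (measurable_set1 0%R)).
move=> y /= yx; apply: HN => /= /(_ I) [] /eqP; apply/negP.
by rewrite /trunc_dot gt_eqF// lt_min ltr01 normr_gt0; apply/eqP.
Qed.

Lemma measurable_half_space (a : R) x :
  measurable [set y : 'rV[R]_n | a <= dot x y].
Proof.
rewrite -[X in measurable X]setTI; apply: measurable_fun_ler => //.
rewrite (_ : dot x = (fun y => dot y x)); first exact: measurable_dot.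
by apply/funext => y; exact: dotC.
Qed.

(** [Ldot] is continuous and positive on the compact unit sphere, hence bounded below there. The
    truncation turns this into mass where [|dot y x|] is large, and evenness gives each of the two
    opposite half-spaces at least half of it. *)
Lemma half_space_mass (n_gt0 : (0 < n)%N) : exists r d : R, [/\ 0 < r, 0 < d &
  forall x, (d%:E <= mu [set y | (r * `|x| <= dot x y)%R])%E].
Proof.
pose S : set 'rV[R]_n := [set x | `|x| = 1].
have S0 : S !=set0 by exists (delta_mx ord0 (Ordinal n_gt0)); exact: norm_delta.
have cS : compact S.
  apply: bounded_closed_compact.
    by exists 1; split => // t t1 x /= ->; exact: ltW.
  rewrite (_ : S = (fun x : 'rV[R]_n => `|x|) @^-1` [set 1])//.
  by apply: closed_comp; [move=> x _; exact: norm_rV_continuous|exact: closed_eq].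
have cL : continuous Ldot.
  move=> x; apply/(@cvgrPdist_le R R^o _ _ (nbhs_filter x)) => e e0.
  have I11 : 0 < I1 + 1 by rewrite ltr_wpDl.
  have xe : \forall z \near x, `|x - z| <= e / (I1 + 1).
    apply/nbhs_ballP; exists (e / (I1 + 1)); first exact: divr_gt0.
    by move=> z; rewrite -ball_normE /= => /ltW.
  near=> z.
  have xz : `|x - z| <= e / (I1 + 1) by near: z.
  have xz' : `|x - z| * I1 <= e.
    rewrite (le_trans (ler_wpM2r _ xz))// mulrAC ler_pdivrMr// ler_pM2l//.
    by rewrite lerDl.
  have := Ldot_lip x z; have := Ldot_lip z x; rewrite [`|z - x|]distrC => H1 H2.
  by rewrite ler_norml; apply/andP; split; lra.
have [x0 Sx0 x0min] : exists2 x0, x0 \in S & forall x, x \in S -> Ldot x0 <= Ldot x.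
  apply: compact_EVT_min => //; exact: continuous_subspaceT.
have L0 : 0 < Ldot x0.
  by apply: Ldot_gt0; rewrite -normr_eq0 (set_mem Sx0) oner_eq0.
pose m := fine (mu setT).
have mE : mu setT = m%:E by rewrite fineK// ge0_fin_numE.
have m0 : 0 <= m by rewrite fine_ge0.
have m1 : 0 < m + 1 by rewrite ltr_wpDl.
(* The region [|dot y x| < r] contributes at most [r m <= Ldot x0 / 2] to [Ldot x]. The remaining
   half is shared by two half-spaces of equal measure, whence [d = Ldot x0 / 4]. *)
pose r := Ldot x0 / 2 / (m + 1).
have r0 : 0 < r by rewrite !divr_gt0.
have mHS := measurable_half_space.
have HS x : `|x| = 1 -> ((Ldot x0 / 4)%:E <= mu [set y | (r <= dot x y)%R])%E.
  move=> x1.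
  have HSN : mu [set y | r <= dot x (- y)] = mu [set y | r <= dot x y].
    rewrite -[RHS]mu_even//; congr (mu _); apply/seteqP; split => y /=.
      by move=> ry; exists (- y); rewrite ?opprK.
    by move=> [z rz <-]; rewrite opprK.
  have mHSN : measurable [set y : 'rV[R]_n | r <= dot x (- y)].
    by under eq_set do rewrite dotNr -dotNl; exact: mHS.
  have : (mu [set y | (r <= `|dot y x|)%R] <=
      mu [set y | (r <= dot x y)%R] + mu [set y | (r <= dot x y)%R])%E.
    rewrite -{1}HSN.
    have -> : [set y | (r <= `|dot y x|)%R] =
        [set y | (r <= dot x (- y))%R] `|` [set y | (r <= dot x y)%R].
      apply/seteqP; split => y; rewrite /setU /= [dot y x]dotC ler_normr dotNr.
        by move=> /orP[]; [right|left].
      by move=> []->; rewrite ?orbT.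
    exact: measureU2.
  have : ((Ldot x0 / 2)%:E <= mu [set y | (r <= `|dot y x|)%R])%E.
    have mA : measurable [set y : 'rV[R]_n | (r <= `|dot y x|)%R].
      rewrite -[X in measurable X]setTI; apply: measurable_fun_ler => //.
      by apply: measurableT_comp => //; exact: measurable_dot.
    have : ((Ldot x)%:E <= (r * m)%:E + mu [set y | (r <= `|dot y x|)%R])%E.
      rewrite -LdotE EFinM -mE -integral_cst//.
      have <- : (\int[mu]_y (\1_[set y | (r <= `|dot y x|)%R] y : R)%:E =
          mu [set y | (r <= `|dot y x|)%R])%E.
        by rewrite integral_indic// setIT.
      rewrite -ge0_integralD//;
        [|by move=> y _ /=; rewrite lee_fin ltW|exact/measurable_EFinP].
      apply: ge0_le_integral => //.
      - by move=> y _; rewrite lee_fin.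
      - exact/measurable_EFinP.
      - by apply: emeasurable_funD => //; exact/measurable_EFinP.
      move=> y _; rewrite -EFinD lee_fin indicE.
      case: (leP r `|dot y x|) => ry.
        by rewrite mem_set//= ge_min lerDr ltW.
      rewrite memNset/=; last by rewrite leNgt ry.
      by rewrite addr0 ge_min (ltW ry) orbT.
    have rm : r * m <= Ldot x0 / 2.
      rewrite /r mulrAC ler_pdivrMr// ler_pM2l ?divr_gt0//.
      by rewrite lerDl.
    have := x0min x (mem_set x1).
    set A := mu _; have [s ->] : exists s, A = s%:E.
      by exists (fine A); rewrite fineK// fin_num_measure.
    rewrite -EFinD !lee_fin; lra.
  set A := mu [set y | (r <= dot x y)%R]; have [t ->] : exists t, A = t%:E.
    by exists (fine A); rewrite fineK// fin_num_measure.
  move=> H1 H2; have := le_trans H1 H2; rewrite -EFinD !lee_fin; lra.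
exists r, (Ldot x0 / 4); split => //; first by rewrite divr_gt0.
move=> x; have [->|x0'] := eqVneq x 0.
  have e1 : `|delta_mx ord0 (Ordinal n_gt0) : 'rV[R]_n| = 1 by exact: norm_delta.
  rewrite (le_trans (HS _ e1))// le_measure ?inE//.
  by move=> y _ /=; rewrite normr0 mulr0 dot0l.
have nx : 0 < `|x| by rewrite normr_gt0.
have x1 : `| `|x|^-1 *: x | = 1.
  by rewrite normrZ ger0_norm ?invr_ge0// mulVf// gt_eqF.
rewrite (le_trans (HS _ x1))// le_measure ?inE//.
by move=> y /=; rewrite dotZl ler_pdivlMl// mulrC.
Unshelve. all: by end_near. Qed.

(** By Markov's inequality [h >= M] holds on a set of measure less than [d], so the half-space
    attached to [x] contains some [y] with [h y <= M]; the Fenchel-Young inequality at this [y] is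
    the claim. *)
Lemma legendre_coercive (n_gt0 : (0 < n)%N) : exists r d : R, [/\ 0 < r, 0 < d &
  forall (p C M : R) h, 0 < p -> 0 < M -> measurable_fun setT h ->
    (forall x, (0 <= h x)%E) -> (\int[mu]_x (h x `^ p) <= C%:E)%E ->
    C < d * M `^ p -> forall x, ((r * `|x| - M)%:E <= legendre h x)%E].
Proof.
have [r [d [r0 d0 H]]] := half_space_mass n_gt0.
exists r, d; split => // p C M h p0 M0 mh h0 hC CM x.
have [y [ry hy]] : exists y, r * `|x| <= dot x y /\ (h y <= M%:E)%E.
  apply: contrapT => /forallNP hM.
  have mA : measurable [set y | (M%:E <= h y)%E].
    by rewrite -[X in measurable X]setTI; exact: emeasurable_fun_c_infty.
  have dA : (d%:E <= mu [set y | (M%:E <= h y)%E])%E.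
    rewrite (le_trans (H x))// le_measure ?inE//.
      exact: measurable_half_space.
    move=> y /= ry; have /not_andP[//|/negP] := hM y.
    by rewrite -ltNge => /ltW.
  have : ((M `^ p)%:E * mu [set y | (M%:E <= h y)%E] <= C%:E)%E.
    apply: le_trans hC.
    have := @le_integral_comp_abse _ _ R mu setT measurableT h M
      (fun t => t `^ p)%E (measurable_poweR p) (fun t _ => poweR_ge0 t p) _ mh M0.
    rewrite setTI poweR_EFin.
    have habs y : (`|h y| = h y)%E by rewrite gee0_abs.
    rewrite (_ : [set y | (M%:E <= `|h y|)%E] = [set y | (M%:E <= h y)%E]); last first.
      by apply/seteqP; split => y /=; rewrite habs.
    rewrite (eq_integral (fun y => (h y `^ p)%E)); last by move=> y _; rewrite habs.
    apply; move=> a b; rewrite !inE/= !in_itv/= !andbT => a0 b0 ab.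
    by apply: (gt0_ler_poweR (ltW p0)) => //; rewrite in_itv/= leey andbT.
  apply/negP; rewrite -ltNge.
  apply: (@lt_le_trans _ _ ((M `^ p)%:E * d%:E)%E).
    by rewrite -EFinM lte_fin mulrC.
  by rewrite lee_pmul2l// lte_fin powR_gt0.
rewrite (le_trans _ (fenchel_young x hy))// lee_fin dotC.
by rewrite lerB.
Qed.

End coercivity.

(** * Lower and upper limits, and extraction of subsequences *)

Section limits.
Context {R : realType}.

Lemma le_of_expR_le (a b A : R) : 0 <= a -> 0 <= A ->
  (forall t, 0 < t -> a <= expR (t * A) * b) -> a <= b.
Proof.
move=> a0 A0 H; apply/ler_addgt0Pr => e e0.
have aA0 : 0 <= a * A by rewrite mulr_ge0.
have aA1 : 0 < a * A + 1 by rewrite ltr_wpDl.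
have := H _ (divr_gt0 e0 aA1); set t := e / _ => {}H.
have {}H : a * expR (- (t * A)) <= b by rewrite expRN ler_pdivrMr ?expR_gt0// mulrC.
have H1 : a * (1 - t * A) <= b.
  by rewrite (le_trans _ H)// ler_wpM2l// expR_ge1Dx.
have H2 : a * A * t <= e.
  by rewrite /t mulrCA ger_pMr// ler_pdivrMr// mul1r lerDl.
by rewrite (le_trans _ (lerD H1 H2))// [leRHS](_ : _ = a)//; ring.
Qed.

Lemma limn_einfE (u : (\bar R)^nat) : limn_einf u = ereal_sup (range (einfs u)).
Proof. by rewrite limn_einf_lim; apply/cvg_lim => //; exact: cvg_einfs_sup. Qed.

Lemma limn_esupE (u : (\bar R)^nat) : limn_esup u = ereal_inf (range (esups u)).
Proof. by rewrite limn_esup_lim; apply/cvg_lim => //; exact: cvg_esups_inf. Qed.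

Lemma limn_einf_lt (u : (\bar R)^nat) t : (limn_einf u < t)%E ->
  forall N, exists2 j, (N <= j)%N & (u j < t)%E.
Proof.
rewrite limn_einfE => ut N.
have : (einfs u N < t)%E by rewrite (le_lt_trans _ ut)//; apply: ereal_sup_ubound; exists N.
by move=> /ereal_inf_lt[_ [j /= Nj <-]] ujt; exists j.
Qed.

Lemma limn_einf_le (u : (\bar R)^nat) t :
  (forall N, exists2 j, (N <= j)%N & (u j <= t)%E) -> (limn_einf u <= t)%E.
Proof.
move=> H; rewrite limn_einfE; apply: ge_ereal_sup => _ [N _ <-].
have [j Nj uj] := H N; rewrite (le_trans _ uj)//.
by apply: ereal_inf_lbound; exists j.
Qed.

Lemma limn_einf_ge0 (u : (\bar R)^nat) :
  (forall k, (0 <= u k)%E) -> (0 <= limn_einf u)%E.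
Proof.
move=> u0; rewrite limn_einfE; apply: (@le_trans _ _ (einfs u 0)).
  by apply: le_ereal_inf_tmp => _ [k _ <-].
by apply: ereal_sup_ubound; exists 0%N.
Qed.

Lemma le_limn_einf (u v : (\bar R)^nat) : (forall k, (u k <= v k)%E) ->
  (limn_einf u <= limn_einf v)%E.
Proof.
move=> uv; rewrite !limn_einfE; apply: ge_ereal_sup => _ [N _ <-].
apply: (@le_trans _ _ (einfs v N)); last by apply: ereal_sup_ubound; exists N.
apply: le_ereal_inf_tmp => _ [k /= Nk <-]; rewrite (le_trans _ (uv k))//.
by apply: ereal_inf_lbound; exists k.
Qed.

Lemma le_limn_esup (u v : (\bar R)^nat) : (forall k, (u k <= v k)%E) ->
  (limn_esup u <= limn_esup v)%E.
Proof.
move=> uv; rewrite !limn_esupE; apply: le_ereal_inf_tmp => _ [N _ <-].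
apply: (@le_trans _ _ (esups u N)); first by apply: ereal_inf_lbound; exists N.
apply: ge_ereal_sup => _ [k /= Nk <-]; rewrite (le_trans (uv k))//.
by apply: ereal_sup_ubound; exists k.
Qed.

(* Helly-type selection: a diagonal subsequence, read off a cluster point of
   the sequence (k |-> F k) in the compact product space [0, B]^nat. *)
Lemma diagonal_subsequence (F : nat -> nat -> R) (B : R) :
  (forall k i, 0 <= F k i <= B) -> exists (s : nat -> nat) (L : nat -> R),
    (forall j, (j <= s j)%N) /\
    (forall i, (fun j => F (s j) i) @ \oo --> L i).
Proof.
move=> FB.
have cK : compact [set f : prod_topology (fun _ : nat => R : topologicalType) |
    forall i, `[0%R, B]%classic (f i)].
  exact: (@tychonoff nat (fun=> R : topologicalType) (fun=> `[0%R, B]%classic)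
    (fun=> @segment_compact R 0 B)).
have FK : ((fun k => F k : prod_topology (fun _ : nat => R : topologicalType)) @ \oo)
    [set f | forall i, `[0%R, B]%classic (f i)].
  by exists 0%N => // k _ i /=; rewrite in_itv/=.
have [L [_ clL]] := cK _ _ FK.
(* A basic neighbourhood in the product topology constrains finitely many coordinates, so stage [j]
   asks for closeness on the coordinates [0] to [j] only; coordinate [i] is covered from stage [i]
   on. *)
have H j : exists k, (j <= k)%N /\ forall i : 'I_j.+1, `|L i - F k i| < j.+1%:R^-1.
  have nL : nbhs L [set f : prod_topology (fun _ : nat => R : topologicalType) |
      forall i : 'I_j.+1, `|L i - f i| < j.+1%:R^-1].
    apply: (@filter_forall _ _ (fun (i : 'I_j.+1)
      (f : prod_topology (fun _ : nat => R : topologicalType)) =>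
      `|L i - f i| < j.+1%:R^-1) _ (nbhs_filter L)) => i.
    have := @proj_continuous nat (fun=> R : topologicalType) i L.
    move=> /(@cvgrPdist_lt R R^o _ _ (nbhs_filter L)); apply.
    by rewrite invr_gt0.
  have tail : ((fun k => F k : prod_topology (fun _ : nat => R : topologicalType)) @ \oo)
      [set F k | k in [set k | (j <= k)%N]].
    by exists j => // k /= jk; exists k.
  have [_ [[k /= jk <-] Lk]] := clL _ _ tail nL.
  by exists k.
have [s sP] := choice H.
exists s, L; split => [j|i]; first by have [] := sP j.
apply/(@cvgrPdist_lt R R^o) => e e0.
near=> j.
have ij : (i < j.+1)%N by rewrite ltnS; near: j; exact: nbhs_infty_ge.
have [_ /(_ (Ordinal ij)) /= Lj] := sP j.
apply: (lt_trans Lj).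
near: j.
have := @cvg_harmonic R => /(@cvgrPdist_lt R R^o)/(_ e e0).
by apply: filterS => j; rewrite sub0r normrN gtr0_norm ?harmonic_gt0.
Unshelve. all: by end_near. Qed.

End limits.

(** * The mass functional and its bounds under coercivity *)

Section exp_legendre.
Context {R : realType} {n : nat}.
Implicit Types (x y z : 'rV[R]_n) (h phi : 'rV[R]_n -> \bar R).
Local Notation leb := (@lebesgue_rV R n).

Lemma measurable_expeR : measurable_fun [set: \bar R] (@expeR R).
Proof.
rewrite (_ : @expeR R = fun t => if t \is a fin_num then (expR (fine t))%:E
    else if t == +oo%E then +oo%E else 0%E); last by apply/funext => -[].
apply: measurable_fun_ifT => //=.
- by apply: (measurable_fun_bool true); exact/emeasurable_fin_num.
- by apply/measurable_EFinP; exact: measurableT_comp.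
- by apply: measurable_fun_ifT => //=; exact: measurable_fun_eqe.
Qed.

Definition exp_legendre h x : \bar R := expeR (- legendre h x)%E.

Lemma measurable_exp_legendre h : measurable_fun setT (exp_legendre h).
Proof.
apply: (measurableT_comp measurable_expeR).
by apply: measurableT_comp => //; exact: measurable_legendre.
Qed.

Lemma exp_legendre_ge0 h x : (0 <= exp_legendre h x)%E.
Proof. exact: expeR_ge0. Qed.

Lemma exp_legendre_le h x c : (c%:E <= legendre h x)%E ->
  (exp_legendre h x <= (expR (- c))%:E)%E.
Proof. by move=> cx; rewrite -[leRHS]/(expeR (- c)%:E) lee_expeR EFinN leeN2. Qed.

Lemma exp_legendre_ge h x c : (legendre h x <= c%:E)%E ->
  ((expR (- c))%:E <= exp_legendre h x)%E.
Proof. by move=> cx; rewrite -[leLHS]/(expeR (- c)%:E) lee_expeR EFinN leeN2. Qed.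

Lemma norm1_le_norm x : norm1 x <= n%:R * `|x|.
Proof.
rewrite /norm1 (le_trans (ler_sum _ (fun i _ => coord_le_norm x i)))//.
by rewrite sumr_const card_ord -[leLHS]mulr_natl.
Qed.

Definition mass h : \bar R := (\int[leb]_x exp_legendre h x)%E.

Lemma mass_ge0 h : (0 <= mass h)%E.
Proof. by apply: integral_ge0 => x _; exact: exp_legendre_ge0. Qed.

Section coercive_mass.
Variables (r M : R).
Hypothesis r0 : 0 < r.

Definition coercive h := forall x, ((r * `|x| - M)%:E <= legendre h x)%E.

Lemma exp_coercive_le h x : coercive h ->
  (exp_legendre h x <= (expR M)%:E * (expR (- (r * `|x|)))%:E)%E.
Proof.
move=> hr; rewrite (le_trans (exp_legendre_le (hr x)))//.
by rewrite -EFinM lee_fin -expRD ler_expR; lra.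
Qed.

Lemma measurable_exp_norm (c : R) : measurable_fun setT
  (fun x => (expR (- (c * `|x|)))%:E).
Proof.
apply/measurable_EFinP; apply: measurableT_comp => //.
apply: measurable_funN; apply: measurable_funM => //.
exact: measurable_normr.
Qed.

Lemma mass_coercive_le h : coercive h ->
  (mass h <= (expR M)%:E * \int[leb]_x (expR (- (r * `|x|)))%:E)%E.
Proof.
move=> hr; rewrite -ge0_integralZl//; last exact: measurable_exp_norm.
apply: ge0_le_integral => //.
- by move=> x _; exact: exp_legendre_ge0.
- exact: measurable_exp_legendre.
- by apply: emeasurable_funM => //; exact: measurable_exp_norm.
- by move=> x _; exact: exp_coercive_le.
Qed.

Lemma mass_coercive_fin h : coercive h -> (mass h < +oo)%E.
Proof.
move=> hr; rewrite (le_lt_trans (mass_coercive_le hr))//.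
rewrite lte_mul_pinfty ?lee_fin ?expR_ge0//.
exact: expR_norm_integrable.
Qed.

(* The mass of exp(- phi) outside {phi <= K} is small, so {phi <= K} has volume
   bounded below and does not fit into a thin slab; hence h grows linearly. *)
Lemma legendre_ball (Z0 : R) : 0 < Z0 -> exists rho K : R, [/\ 0 < rho, 0 <= K &
  forall h, coercive h -> (forall x, 0 <= h x)%E -> (forall x, h (- x) = h x) ->
    h = legendre (legendre h) -> (Z0%:E <= mass h)%E ->
    forall x, `|x| <= rho -> (legendre h x <= K%:E)%E].
Proof.
move=> Z00.
pose J := fine (\int[leb]_x (expR (- (r / 2 * `|x|)))%:E).
have JE : (\int[leb]_x (expR (- (r / 2 * `|x|)))%:E = J%:E)%E.
  rewrite fineK// ge0_fin_numE; first by apply: expR_norm_integrable; rewrite divr_gt0.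
  by apply: integral_ge0 => x _; rewrite lee_fin expR_ge0.
have J0 : 0 <= J.
  by rewrite -lee_fin -JE integral_ge0// => x _; rewrite lee_fin expR_ge0.
pose J' := expR (M / 2) * J.
have J'0 : 0 <= J' by rewrite mulr_ge0// expR_ge0.
(* With [K / 2 = J' / (Z0 / 2)] the claim follows from [exp u >= 1 + u]. *)
have [K K0 KJ] : exists2 K, 0 <= K & expR (- (K / 2)) * J' <= Z0 / 2.
  have z2 : 0 < Z0 / 2 by rewrite divr_gt0.
  exists (2 * (J' / (Z0 / 2))); first by rewrite mulr_ge0// divr_ge0// ltW.
  rewrite [2 * _]mulrC mulfK// expRN mulrC ler_pdivrMr ?expR_gt0//.
  rewrite -ler_pdivrMl// (le_trans _ (expR_ge1Dx _))//.
  by rewrite mulrC lerDr.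
pose T := (Num.max 0 (K + M)) / r + 1.
have T1 : 0 < T.
  by rewrite /T ltr_wpDl// divr_ge0 ?(ltW r0)// le_max lexx.
pose B := 2 * (2 * (T + 1)) ^+ n.
have B0 : 0 < B.
  by rewrite /B mulr_gt0// exprn_gt0// mulr_gt0// addr_gt0.
(* Outside the sublevel set [{phi <= K}] the mass is at most [exp (- K / 2) J' <= Z0 / 2], and
   inside it the density is at most [exp M]; the other [Z0 / 2] therefore needs volume at least
   [w]. *)
pose w := Z0 / 2 * expR (- M).
have w0 : 0 < w by rewrite mulr_gt0 ?expR_gt0// divr_gt0.
pose rho := w / (2 * B).
have rho0 : 0 < rho by rewrite divr_gt0// mulr_gt0.
(* [h] will be shown to grow like [rho |y|] in the sup norm. Its conjugate is then controlled where
   [norm1 x <= rho], and [norm1 x <= n |x|]. *)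
exists (rho / n.+1%:R), K; split => //; first by rewrite divr_gt0.
move=> h hr h0 heven hE hZ.
set phi := legendre h in hE *.
pose A := [set x | (phi x <= K%:E)%E].
have mA : measurable A.
  rewrite -[X in measurable X]setTI; apply: emeasurable_fun_infty_c => //.
  exact: measurable_legendre.
have Acube : A `<=` cube T.
  move=> x /= xA; apply/cube_norm => //.
  have := le_trans (hr x) xA; rewrite lee_fin lerBlDr => xK.
  have : `|x| <= Num.max 0 (K + M) / r.
    by rewrite ler_pdivlMr// mulrC (le_trans xK)// le_max lexx orbT.
  by move=> /le_lt_trans; apply; rewrite /T ltrDl.
have Afin : (leb A < +oo)%E.
  apply: (@le_lt_trans _ _ (leb (cube T))); last first.
    by rewrite lebesgue_cube ?ltry// ltW.
  by rewrite le_measure ?inE//; exact: measurable_cube.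
have volA : (w%:E <= leb A)%E.
  have pw x : (exp_legendre h x <= (expR M)%:E * (\1_A x)%:E +
      (expR (- (K / 2)) * expR (M / 2))%:E * (expR (- (r / 2 * `|x|)))%:E)%E.
    rewrite -!EFinM -EFinD indicE; have [xA|xA] := boolP (x \in A).
      rewrite (le_trans (exp_legendre_le (_ : ((- M)%:E <= _)%E)))//.
        by rewrite (le_trans _ (hr x))// lee_fin lerBrDr addNr mulr_ge0// ltW.
      by rewrite opprK mulr1 lee_fin lerDl !mulr_ge0// expR_ge0.
    rewrite mulr0 add0r -!expRD.
    have : (K%:E < phi x)%E.
      by rewrite ltNge; apply: contraNN xA => xK; rewrite inE.
    have := hr x; rewrite -/phi => H1 H2.
    (* Off [A] both lower bounds hold, hence so does their average: one half makes the mass small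
       through [K], the other keeps it integrable through [r |x| / 2]. *)
    have H3 : (((K + (r * `|x| - M)) / 2)%:E <= phi x)%E.
      case: (phi x) H1 H2 => [v| |] //; last by move=> *; rewrite leey.
      by rewrite lee_fin lte_fin lee_fin => H1 H2; lra.
    by rewrite (le_trans (exp_legendre_le H3))// lee_fin ler_expR; lra.
  have : (Z0%:E <= (expR M)%:E * leb A + (expR (- (K / 2)) * J')%:E)%E.
    apply: (le_trans hZ); rewrite /J' mulrA EFinM -JE.
    have <- : (\int[leb]_x (\1_A x)%:E = leb A)%E by rewrite integral_indic// setIT.
    have m1 : measurable_fun setT (fun x => (\1_A x : R)%:E).
      by apply/measurable_EFinP; exact: measurable_indic.
    have m2 := measurable_exp_norm (r / 2).
    rewrite -ge0_integralZl//.
    rewrite -[X in (_ <= _ + X)%E]ge0_integralZl//; do ?[by rewrite lee_fin mulr_ge0 ?expR_ge0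
      | by move=> x _; rewrite lee_fin expR_ge0].
    rewrite -ge0_integralD//; do ?[by apply: emeasurable_funM
      | by move=> x _; rewrite mule_ge0// lee_fin ?mulr_ge0 ?expR_ge0].
    apply: ge0_le_integral => //.
    - by move=> x _; exact: exp_legendre_ge0.
    - exact: measurable_exp_legendre.
    - by apply: emeasurable_funD; apply: emeasurable_funM.
  have [a aE] : exists a, leb A = a%:E.
    by exists (fine (leb A)); rewrite fineK// ge0_fin_numE.
  rewrite aE -EFinM -EFinD !lee_fin => H.
  by rewrite /w expRN ler_pdivrMr ?expR_gt0// mulrC; lra.
have hlow y : ((rho * `|y| - K)%:E <= h y)%E.
  have [->|y0] := eqVneq y 0.
    by rewrite normr0 mulr0 sub0r (le_trans _ (h0 0))// lee_fin oppr_le0.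
  have ny : 0 < `|y| by rewrite normr_gt0.
  case hy : (h y) => [v| |]; [|exact: leey|by have := h0 y; rewrite hy].
  have phiA x : A x -> `|dot x y| <= v + K.
    move=> xA; rewrite ler_norml; apply/andP; split.
      have xA' : A (- x) by rewrite /A/= /phi legendre_even.
      have := fenchel_young y xA'; rewrite -hE hy lee_fin dotNl; lra.
    by have := fenchel_young y xA; rewrite -hE hy lee_fin; lra.
  (* [A] lies in the slab [|dot x y| <= v + K]; the extra [rho] makes the inequality strict as
     [lebesgue_slab] requires. Comparing volumes gives [s >= w / B = 2 rho], so
     [(v + K) / |y| >= rho]. *)
  pose s := (v + K) / `|y| + rho.
  have v0 : 0 <= v by have := h0 y; rewrite hy lee_fin.
  have s0 : 0 <= s by apply: addr_ge0; [apply: divr_ge0 => //; exact: addr_ge0|exact: ltW].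
  have wB : w <= s * B.
    rewrite -lee_fin (le_trans volA)//.
    apply: (@le_trans _ _ (leb (cube T `&` [set x | (`|dot x y| < s * `|y|)%R]))).
      rewrite le_measure ?inE//.
        apply: measurableI; first exact: measurable_cube.
        rewrite -[X in measurable X]setTI; apply: measurable_fun_ltr => //.
        apply: measurableT_comp => //; exact: measurable_dot.
      move=> x xA; split; first exact: Acube.
      rewrite /= (le_lt_trans (phiA _ xA))// /s mulrDl divfK ?gt_eqF//.
      by rewrite ltrDl mulr_gt0.
    rewrite (le_trans (lebesgue_slab y0 s0 (ltW T1)))// lee_fin.
    by rewrite /B mulrA [s * 2]mulrC.
  have : w / B <= s by rewrite ler_pdivrMr.
  have -> : w / B = 2 * rho by rewrite /rho; field; rewrite gt_eqF.
  rewrite /s => H; rewrite lee_fin lerBlDr -ler_pdivlMr//; lra.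
move=> x xrho; apply/legendre_leP => y; apply: le_trans (hlow y).
rewrite lee_fin lerD2r (le_trans (ler_norm _))// (le_trans (dot_le_norm1 _ _))//.
rewrite mulrC ler_wpM2r// (le_trans (norm1_le_norm x))//.
rewrite (le_trans (ler_wpM2l _ xrho))// mulrCA ger_pMr// ler_pdivrMr// mul1r.
by rewrite ler_nat.
Qed.

End coercive_mass.

End exp_legendre.

Lemma measurable_fun_limn_einf d (T : measurableType d) (R : realType)
    (D : set T) (f : (T -> \bar R)^nat) : (forall k, measurable_fun D (f k)) ->
  measurable_fun D (fun x => limn_einf (f ^~ x)).
Proof.
move=> mf; rewrite /limn_einf.
apply: measurableT_comp => //.
apply: (@measurable_fun_limn_esup _ _ _ D (fun k x => - f k x)%E) => k.
by apply: measurableT_comp => //.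
Qed.

(** * Compactness of maximizing sequences *)

Section selection.
Context {R : realType} {n : nat}.
Implicit Types (x y z : 'rV[R]_n).
Local Notation leb := (@lebesgue_rV R n).
Variable mu : {measure set 'rV[R]_n -> \bar R}.
Variables (p C : R) (p0 : 0 < p).

Definition admissible (h : 'rV[R]_n -> \bar R) : Prop :=
  [/\ measurable_fun setT h, forall x, (0 <= h x)%E, forall x, h (- x) = h x
    & (\int[mu]_x (h x `^ p) <= C%:E)%E].

Lemma rational_dense : exists d : nat -> 'rV[R]_n,
  forall x e, 0 < e -> exists i, `|d i - x| <= e.
Proof.
exists (fun i => if unpickle i is Some q then
  \row_j ratr ((q : {ffun 'I_n -> rat}) j) else 0) => x e e0.
have H (j : 'I_n) : exists q : rat, `|ratr q - x ord0 j| <= e.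
  have /rat_in_itvoo[q] : x ord0 j - e < x ord0 j + e.
    by rewrite ltrBlDr -addrA ltrDl addr_gt0.
  rewrite in_itv/= => /andP[q1 q2]; exists q.
  by rewrite ler_distlC; apply/andP; split; lra.
have [q qP] := choice H.
exists (pickle [ffun j => q j]); rewrite pickleK.
apply: normr_le => [|j]; first exact: ltW.
by rewrite !mxE ffunE.
Qed.

Variables (r M rho K S : R) (h : nat -> 'rV[R]_n -> \bar R).
Hypotheses (r0 : 0 < r) (rho0 : 0 < rho) (S0 : 0 <= S).
Hypothesis hadm : forall k, admissible (h k).
Hypothesis hcoer : forall k, coercive r M (h k).
Hypothesis hball : forall k x, `|x| <= rho -> (legendre (h k) x <= K%:E)%E.
Hypothesis hmass : forall k, ((S - k.+1%:R^-1)%:E <= mass (h k))%E.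

Let F k := exp_legendre (h k).

Let KM0 : 0 <= K + M.
Proof.
have h0 : (legendre (h 0) 0 <= K%:E)%E by apply: hball; rewrite normr0 ltW.
have := le_trans (hcoer 0 0) h0.
by rewrite normr0 mulr0 sub0r lee_fin lerNl -subr_ge0 opprK addrC.
Qed.

(** Convexity gives [s v + (1 - s) K] as a bound for the conjugate at the new point, where
    [v >= - M] is its value at [x]; the excess over [v] is at most [(1 - s) (K + M)]. The factor
    depends on neither [k] nor [x]. *)
Let F_shrink k x s b : 0 <= s <= 1 -> `|b| <= rho ->
  ((expR (- ((1 - s) * (K + M))))%:E * F k x <=
    F k (s *: x + (1 - s) *: b)%R)%E.
Proof.
move=> s01 brho; have /andP[s0 s1] := s01; rewrite /F {1}/exp_legendre.
case phix : (legendre (h k) x) => [v| |].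
- have := legendre_convex s01 (_ : legendre (h k) x <= v%:E)%E (hball k brho).
  rewrite phix lexx => /(_ isT)/exp_legendre_ge; apply: le_trans.
  rewrite /= -EFinM lee_fin -expRD ler_expR.
  have Mv : - M <= v.
    have := hcoer k x; rewrite phix lee_fin; apply: le_trans.
    by rewrite lerBrDr addNr mulr_ge0// ltW.
  have : 0 <= (1 - s) * (M + v).
    by rewrite mulr_ge0// ?subr_ge0// -lerBlDl sub0r.
  by move=> H; rewrite -subr_ge0 [leRHS](_ : _ = (1 - s) * (M + v))//; ring.
- by rewrite /= mule0 exp_legendre_ge0.
- by have := hcoer k x; rewrite phix.
Qed.

(** Along a subsequence converging at all points of a dense sequence, the upper limit of the
    densities at [x] is compared with their lower limit at a shrunk point. Reverse Fatou bounds [S]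
    by the integral of the upper limit, rescaling leads to the integral of the lower limit, and the
    latter is at most the mass of [g]. Fatou for [mu] keeps [g] admissible. *)
Lemma selection : exists2 g, admissible g & (S%:E <= mass g)%E.
Proof.
have [d ddense] := rational_dense.
have Ffin k x : F k x = (fine (F k x))%:E.
  rewrite fineK// ge0_fin_numE ?exp_legendre_ge0//.
  rewrite (le_lt_trans (exp_coercive_le _ (hcoer k)))//.
  by rewrite -EFinM ltry.
have Fbound k x : 0 <= fine (F k x) <= expR M.
  rewrite -!lee_fin -Ffin exp_legendre_ge0/=.
  rewrite (le_trans (exp_coercive_le _ (hcoer k)))// -EFinM lee_fin.
  by rewrite ger_pMr ?expR_gt0// expR_le1 oppr_le0 mulr_ge0// ltW.
have [s [L [sj FL]]] := diagonal_subsequence (fun k i => Fbound k (d i)).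
pose liminfF x := limn_einf (fun j => F (s j) x).
pose limsupF x := limn_esup (fun j => F (s j) x).
have mF k : measurable_fun setT (F k) by exact: measurable_exp_legendre.
have mliminf : measurable_fun setT liminfF.
  exact: (measurable_fun_limn_einf (fun j => mF (s j))).
have mlimsup : measurable_fun setT limsupF.
  exact: (measurable_fun_limn_esup (fun j => mF (s j))).
(* A dense point [d i] near [exp (- t) x] is the intermediary: one shrinking leads from [x] to
   [d i], a second from [d i] to [exp (- 2 t) x], and at [d i] the densities converge. *)
have compare x t : 0 < t -> (limsupF x <= (expR (t * (2 * (K + M))))%:E *
    liminfF (expR (- (2 * t)) *: x)%R)%E.
  move=> t0; pose sg := expR (- t).
  have sg0 : 0 < sg by exact: expR_gt0.
  have sg1 : sg < 1 by rewrite expR_lt1 oppr_lt0.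
  have sg01 : 0 <= sg <= 1 by rewrite !ltW.
  have sg1' : 0 < 1 - sg by rewrite subr_gt0.
  have [i di] := ddense (sg *: x) _ (mulr_gt0 sg1' rho0).
  pose b := (1 - sg)^-1 *: (d i - sg *: x).
  have bE : (1 - sg) *: b = d i - sg *: x.
    by rewrite /b scalerA divff ?gt_eqF// scale1r.
  have brho : `|b| <= rho.
    rewrite /b normrZ ger0_norm; last by rewrite invr_ge0 ltW.
    by rewrite ler_pdivrMl.
  pose c := expR (- ((1 - sg) * (K + M))).
  have c0 : 0 < c by exact: expR_gt0.
  have FL' : (fun j => F (s j) (d i)) @ \oo --> (L i)%:E.
    under eq_fun do rewrite Ffin.
    by apply: cvg_EFin; [exact: nearW|exact: FL].
  have up : (limsupF x <= c^-1%:E * (L i)%:E)%E.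
    have cv : (fun j => c^-1%:E * F (s j) (d i))%E @ \oo --> (c^-1%:E * (L i)%:E)%E.
      by apply: cvgeZl.
    rewrite -(cvg_limn_einf_sup cv).2; apply: le_limn_esup => j.
    have := F_shrink (s j) x sg01 brho; rewrite bE [sg *: x + _]addrC subrK -/c.
    rewrite (Ffin _ x) (Ffin _ (d i)) -!EFinM !lee_fin => H.
    by rewrite ler_pdivlMl.
  have lo : (c%:E * (L i)%:E <= liminfF (expR (- (2 * t)) *: x))%E.
    have cv : (fun j => c%:E * F (s j) (d i))%E @ \oo --> (c%:E * (L i)%:E)%E.
      by apply: cvgeZl.
    rewrite -(cvg_limn_einf_sup cv).1; apply: le_limn_einf => j.
    (* The offset [- sg b] cancels the deviation of [d i] from [sg x]: the second shrinking lands
       exactly on [sg ^ 2 x]. *)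
    have brho' : `|- sg *: b| <= rho.
      rewrite normrZ normrN gtr0_norm// (le_trans _ brho)//.
      by rewrite ler_piMl// ltW.
    have := F_shrink (s j) (d i) sg01 brho'.
    have -> : sg *: d i + (1 - sg) *: (- sg *: b) = expR (- (2 * t)) *: x.
      rewrite [(1 - sg) *: _]scalerA mulrC -scalerA bE scaleNr -scalerBr opprB.
      rewrite [d i + _]addrC subrK scalerA -expRD; congr (expR _ *: _).
      by ring.
    by [].
  have cL : ((L i)%:E <= c^-1%:E * liminfF (expR (- (2 * t)) *: x)%R)%E.
    by rewrite lee_pdivlMl.
  rewrite (le_trans up)//.
  apply: (@le_trans _ _ (c^-1%:E * (c^-1%:E * liminfF (expR (- (2 * t)) *: x)%R))%E).
    by rewrite lee_pmul2l// lte_fin invr_gt0.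
  rewrite muleA lee_wpmul2r//.
    by apply: limn_einf_ge0 => j; exact: exp_legendre_ge0.
  rewrite -EFinM lee_fin /c expRN invrK -expRD ler_expR.
  have sgt : 1 - sg <= t by have := expR_ge1Dx (- t); rewrite -/sg; lra.
  have KMt := ler_wpM2r KM0 sgt.
  by rewrite [leRHS](_ : _ = t * (K + M) + t * (K + M)) ?lerD//; ring.
pose G x : \bar R := ((expR M)%:E * (expR (- (r * `|x|)))%:E)%E.
have iG : leb.-integrable setT G.
  apply/integrableP; split.
    by apply: emeasurable_funM => //; exact: measurable_exp_norm.
  under eq_integral do rewrite gee0_abs ?mule_ge0 ?lee_fin ?expR_ge0//.
  rewrite ge0_integralZl//; do ?[exact: measurable_exp_norm
    | by move=> x _; rewrite lee_fin expR_ge0 | by rewrite lee_fin expR_ge0].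
  rewrite lte_mul_pinfty ?lee_fin ?expR_ge0//.
  exact: expR_norm_integrable.
have Slim : (S%:E <= \int[leb]_x limsupF x)%E.
  (* Reverse Fatou: the tail suprema decrease to the upper limit and are dominated by the integrable
     [G]. *)
  pose E j x := esups (fun k => F (s k) x) j.
  have mE j : measurable_fun setT (E j).
    exact: (measurable_fun_esups (fun j => mF (s j)) j).
  have FE j x : (F (s j) x <= E j x)%E by apply: ereal_sup_ubound; exists j => /=.
  have E0 j x : (0 <= E j x)%E.
    by rewrite (le_trans _ (FE j x))// exp_legendre_ge0.
  have aecv : {ae leb, forall x, setT x -> E ^~ x @ \oo --> limsupF x}.
    by apply: aeW => x _; rewrite /limsupF limn_esupE; exact: cvg_esups_inf.
  have aele : {ae leb, forall x j, setT x -> (`|E j x| <= G x)%E}.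
    apply: aeW => x j _; rewrite gee0_abs//.
    by apply: ge_ereal_sup => _ [k _ <-]; exact: exp_coercive_le.
  have [_ _ cvE] := dominated_convergence measurableT mE mlimsup aecv iG aele.
  have Sh : (fun j : nat => (S - j.+1%:R^-1)%:E) @ \oo --> S%:E.
    apply: cvg_EFin; first exact: nearW.
    rewrite -[X in _ --> X]subr0; apply: (@cvgB R R^o); first exact: cvg_cst.
    exact: cvg_harmonic.
  apply: (lee_cvg_to Sh cvE); apply: nearW => j.
  apply: (@le_trans _ _ (mass (h (s j)))).
    rewrite (le_trans _ (hmass (s j)))// lee_fin lerB// lef_pV2 ?posrE//.
    by rewrite ler_nat ltnS.
  apply: ge0_le_integral => //; last by move=> x _; exact: FE.
    by move=> x _; exact: exp_legendre_ge0.
  exact: measurable_exp_legendre.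
(* The lower limit is taken of the powers [h ^ p] and the root afterwards, so that the integral of
   [g ^ p] is directly the one in Fatou's lemma. *)
pose w y := limn_einf (fun j => h (s j) y `^ p)%E.
have w0 y : (0 <= w y)%E by apply: limn_einf_ge0 => j; exact: poweR_ge0.
pose g y := (w y `^ p^-1)%E.
have gp y : (g y `^ p)%E = w y.
  by rewrite /g -poweRrM mulVf ?gt_eqF// poweRe1.
have mw : measurable_fun setT w.
  apply: measurable_fun_limn_einf => j.
  by apply: (measurableT_comp (measurable_poweR p)); case: (hadm (s j)).
have gadm : admissible g.
  split.
  - exact: (measurableT_comp (measurable_poweR p^-1) mw).
  - by move=> y; exact: poweR_ge0.
  - move=> y; rewrite /g /w; congr (limn_einf _ `^ _)%E.
    by apply/funext => j; case: (hadm (s j)) => _ _ -> _.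
  under eq_integral do rewrite gp.
  apply: (le_trans (fatou mu measurableT _ _)).
  - move=> j; apply: (measurableT_comp (measurable_poweR p)).
    by case: (hadm (s j)).
  - by move=> j y _; exact: poweR_ge0.
  apply: limn_einf_le => N; exists N => //.
  by case: (hadm (s N)).
exists g => //.
(* If a real [t] lay strictly between the two sides, some [y] would give [g y < dot y x + ln t]. The
   same inequality then holds for [h (s j) y] at infinitely many [j], where it forces
   [F (s j) x <= t]. *)
have Fg x : (liminfF x <= exp_legendre g x)%E.
  rewrite leNgt; apply/negP => gF.
  have [t gt tF] : exists2 t, (exp_legendre g x < t%:E)%E & (t%:E < liminfF x)%E.
    move: gF; have := exp_legendre_ge0 g x.
    case: (exp_legendre g x) => [a| |]// _; last by rewrite ltNge leey.
    case: (liminfF x) => [b| |]// ab; last by exists (a + 1); rewrite ?ltry// lte_fin ltrDl.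
    by rewrite lte_fin in ab; exists ((a + b) / 2); rewrite lte_fin; lra.
  have t0 : 0 < t by rewrite -lte_fin (le_lt_trans _ gt)// exp_legendre_ge0.
  have tE : t = expR (- - ln t) by rewrite opprK lnK.
  have : ((- ln t)%:E < legendre g x)%E.
    rewrite ltNge; apply/negP => /exp_legendre_ge; rewrite -tE.
    by rewrite leNgt gt.
  move=> /legendre_gtP[y gy]; set tau := _ - _ in gy.
  have tau0 : 0 < tau by rewrite -lte_fin (le_lt_trans _ gy)// poweR_ge0.
  have pow_le (a b : \bar R) q : 0 < q -> (0 <= a)%E -> (0 <= b)%E ->
      (a <= b)%E -> (a `^ q <= b `^ q)%E.
    move=> q0 a0 b0; apply: (gt0_ler_poweR (ltW q0));
      by rewrite in_itv/= leey andbT.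
  have wy : (w y < tau%:E `^ p)%E.
    rewrite ltNge; apply/negP => /(pow_le _ _ p^-1).
    rewrite invr_gt0 p0 poweR_ge0 w0 -poweRrM mulfV ?gt_eqF// poweRe1; last exact: ltW.
    by move=> /(_ isT isT isT); rewrite leNgt gy.
  have : (liminfF x <= t%:E)%E.
    apply: limn_einf_le => N; have [j Nj hj] := limn_einf_lt wy N.
    exists j => //; rewrite [X in X%:E]tE; apply: exp_legendre_le; apply: ltW.
    apply/legendre_gtP; exists y; rewrite -/tau ltNge; apply/negP => tauh.
    have H : (tau%:E `^ p <= h (s j) y `^ p)%E.
      by apply: pow_le => //; [rewrite lee_fin ltW|case: (hadm (s j))].
    by move: hj; rewrite ltNge H.
  by rewrite leNgt tF.
have [massfin|] := ltP (mass g) +oo%E; last by rewrite leye_eq => /eqP ->; rewrite leey.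
have [m mE] : exists m, mass g = m%:E.
  by exists (fine (mass g)); rewrite fineK// ge0_fin_numE ?mass_ge0.
have A0 : 0 <= 2 * (K + M) + 2 * n%:R.
  by rewrite addr_ge0// mulr_ge0.
(* The exponent collects [2 (K + M)] from the two shrinkings and [2 n] from the Jacobian of
   [x |-> exp (- 2 t) x]. *)
rewrite mE lee_fin; apply: (le_of_expR_le S0 A0) => t t0.
rewrite -lee_fin (le_trans Slim)//.
apply: (@le_trans _ _ (\int[leb]_x ((expR (t * (2 * (K + M))))%:E *
    liminfF (expR (- (2 * t)) *: x + 0)%R))%E).
  apply: ge0_le_integral => //.
  - move=> x _; rewrite /limsupF (le_trans _ (limn_einf_sup _))//.
    by apply: limn_einf_ge0 => j; exact: exp_legendre_ge0.
  - apply: emeasurable_funM => //.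
    exact: (measurableT_comp mliminf (measurable_affine_rV _ 0)).
  - by move=> x _; rewrite addr0; exact: compare.
have lF0 x : (0 <= liminfF x)%E.
  by apply: limn_einf_ge0 => j; exact: exp_legendre_ge0.
have mlF : measurable_fun setT
    (fun x => liminfF (expR (- (2 * t)) *: x + 0)).
  exact: (measurableT_comp mliminf (measurable_affine_rV _ 0)).
rewrite ge0_integralZl//.
rewrite (ge0_integral_affine_rV _ _ mliminf lF0); last by rewrite gt_eqF// expR_gt0.
rewrite gtr0_norm ?expR_gt0// -expRM_natr mulNr expRN invrK muleA -EFinM -expRD.
have -> : t * (2 * (K + M)) + 2 * t * n%:R = t * (2 * (K + M) + 2 * n%:R) by ring.
rewrite EFinM -mE lee_pmul2l ?lte_fin ?expR_gt0//.
apply: ge0_le_integral => //.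
exact: measurable_exp_legendre.
Qed.

End selection.

(** * The choice of the constraint level, and the maximizer *)

Section maximizer.
Context {R : realType} {n : nat}.
Implicit Types (x y z : 'rV[R]_n) (h g : 'rV[R]_n -> \bar R).
Local Notation leb := (@lebesgue_rV R n).
Variable mu : {finite_measure set 'rV[R]_n -> \bar R}.
Hypotheses (mu_even : even_measure mu)
  (mu_moment : (\int[mu]_x (enorm x)%:E < +oo)%E)
  (mu_hyperplane : forall H : set 'rV[R]_n, hyperplane H -> ~ supported_on mu H).
Hypothesis n_gt0 : (0 < n)%N.
Variable p : R.
Hypothesis p01 : 0 < p < 1.

Let p0 : 0 < p. Proof. by case/andP: p01. Qed.

Lemma legendre_ge0 g y : (g 0%R <= 0)%E -> (0 <= legendre g y)%E.
Proof. by move=> /(fenchel_young y); rewrite dot0l subr0. Qed.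

Lemma legendre0_le0 h : (forall x, 0 <= h x)%E -> (legendre h 0%R <= 0)%E.
Proof. by move=> h0; apply/legendre_leP => y; rewrite dot0r subr0. Qed.

(** Biconjugation only lowers a function, so the constraint survives, and by [triconj] the mass does
    not change: maximizing sequences may be taken closed and convex. *)
Lemma admissible_biconj C h : admissible mu p C h ->
  admissible mu p C (legendre (legendre h)).
Proof.
move=> [mh h0 he hC]; split.
- exact: measurable_legendre.
- by move=> y; apply: legendre_ge0; exact: legendre0_le0.
- by apply: legendre_even; exact: legendre_even.
apply: le_trans hC; apply: ge0_le_integral => //.
- by move=> y _; exact: poweR_ge0.
- by apply: (measurableT_comp (measurable_poweR p)); exact: measurable_legendre.
- exact: (measurableT_comp (measurable_poweR p) mh).
move=> y _; apply: (gt0_ler_poweR (ltW p0)).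
- by rewrite in_itv/= leey andbT; apply: legendre_ge0; exact: legendre0_le0.
- by rewrite in_itv/= leey andbT.
- exact: biconj_le.
Qed.

Lemma mass_biconj h : mass (legendre (legendre h)) = mass h.
Proof. by rewrite /mass /exp_legendre triconj. Qed.

(** A competitor whose conjugate is at most [- a] on the unit cube, so that its mass grows at least
    like [exp a]. *)
Let h1 (a : R) y : \bar R := (a + norm1 y)%:E.

Lemma mass_cone a : ((expR a)%:E <= mass (h1 a))%E.
Proof.
apply: (@le_trans _ _ ((expR a)%:E * leb (cube 1))%E).
  rewrite lebesgue_cube// -EFinM lee_fin ler_peMr ?expR_ge0//.
  by rewrite exprn_ege1// mulr1 ler1n.
rewrite -integral_cst//; last exact: measurable_cube.
rewrite integral_mkcond; apply: ge0_le_integral => //.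
- by move=> x _; rewrite patchE; case: ifP => //; rewrite lee_fin expR_ge0.
- by apply/(measurable_restrictT _ (@measurable_cube _ _ _)).
- exact: measurable_exp_legendre.
move=> x _; rewrite patchE; case: ifPn => [|_]; last exact: exp_legendre_ge0.
rewrite inE => /cube_norm x1; rewrite -[a in expR a]opprK; apply: exp_legendre_ge.
apply/legendre_leP => y; rewrite /h1 lee_fin opprK addrC lerD2l.
rewrite (le_trans (ler_norm _))// dotC (le_trans (dot_le_norm1 _ _))//.
by rewrite ler_piMl ?norm1_ge0// ltW// x1.
Qed.

Let I : R := fine (\int[mu]_y (1 + norm1 y)%:E).

Let IE : (\int[mu]_y (1 + norm1 y)%:E = I%:E)%E.
Proof.
rewrite fineK// ge0_fin_numE; last first.
  by apply: integral_ge0 => y _; rewrite lee_fin addr_ge0// norm1_ge0.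
under eq_integral do rewrite EFinD.
rewrite ge0_integralD//; last 2 first.
- by move=> y _; rewrite lee_fin norm1_ge0.
- by apply/measurable_EFinP; exact: measurable_norm1.
rewrite lte_add_pinfty//; last exact: norm1_moment.
by rewrite integral_cst// mul1e -ge0_fin_numE// fin_num_measure.
Qed.

(** [(a + s) ^ p = a ^ p (1 + s / a) ^ p <= a ^ p (1 + s)] for [a >= 1]: the cost of this competitor
    grows only like [a ^ p]. *)
Lemma admissible_cone a : 1 <= a -> admissible mu p (a `^ p * I) (h1 a).
Proof.
move=> a1; have a0 := lt_le_trans ltr01 a1; split.
- apply/measurable_EFinP; apply: measurable_funD => //; exact: measurable_norm1.
- by move=> y; rewrite lee_fin addr_ge0 ?norm1_ge0// ltW.
- by move=> y; rewrite /h1 norm1N.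
rewrite EFinM -IE.
have m1 : measurable_fun setT (fun y : 'rV[R]_n => (1 + norm1 y)%:E).
  by apply/measurable_EFinP; apply: measurable_funD => //; exact: measurable_norm1.
rewrite -ge0_integralZl//; do ?[by move=> y _; rewrite lee_fin addr_ge0// norm1_ge0
  | by rewrite lee_fin powR_ge0].
have mh : measurable_fun setT (h1 a).
  by apply/measurable_EFinP; apply: measurable_funD => //; exact: measurable_norm1.
apply: ge0_le_integral => //.
- by move=> y _; exact: poweR_ge0.
- exact: (measurableT_comp (measurable_poweR p) mh).
- by apply: emeasurable_funM.
move=> y _; rewrite /h1 poweR_EFin -EFinM lee_fin.
have s0 := norm1_ge0 y; set s := norm1 y in s0 *.
have -> : a + s = a * (1 + s / a) by field; rewrite gt_eqF.
rewrite powRM ?(ltW a0)//; last by rewrite addr_ge0// divr_ge0// ltW.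
rewrite ler_wpM2l ?powR_ge0//.
have sa : 1 <= 1 + s / a by rewrite lerDl divr_ge0// ltW.
have /andP[_ p1] := p01.
rewrite (le_trans (ler1_powR sa (ltW p1)))// lerD2l.
by rewrite ler_pdivrMr// ler_peMr.
Qed.

Lemma maximizer_exists : exists (C r M rho K : R) h,
  [/\ admissible mu p C h, h = legendre (legendre h),
      0 < r, 0 < rho & coercive r M h] /\
  [/\ forall x, `|x| <= rho -> (legendre h x <= K%:E)%E,
      (0 < mass h)%E, (0 < h 0%R)%E &
      forall g, admissible mu p C g -> (mass g <= mass h)%E].
Proof.
have [r [d [r0 d0 coer]]] := legendre_coercive mu_even mu_moment mu_hyperplane n_gt0.
have I0 : 0 <= I.
  by rewrite -lee_fin -IE integral_ge0// => y _; rewrite lee_fin addr_ge0// norm1_ge0.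
(* With [C = a ^ p I] and [M = K1 a], the coercivity condition [C < d M ^ p] becomes a condition on
   [K1] alone, which leaves [a] free. *)
have [K1 K11 K1I] : exists2 K1, 1 <= K1 & I < d * K1 `^ p.
  have Id : 0 <= I / d by rewrite divr_ge0// ltW.
  exists ((1 + I / d) `^ p^-1).
    have : 1 `^ p^-1 <= (1 + I / d) `^ p^-1.
      rewrite ge0_ler_powR ?nnegrE ?invr_ge0 ?(ltW p0) ?addr_ge0//.
      by rewrite lerDl.
    by rewrite powR1.
  rewrite -powRrM mulVf ?gt_eqF// powRr1 ?addr_ge0//.
  rewrite mulrDr mulr1 mulrCA mulfV ?gt_eqF// mulr1.
  by rewrite ltrDr.
have K10 : 0 < K1 by exact: lt_le_trans K11.
(* Chosen so that [e M = a / 2]; [e <= 1] lets a nonnegative conjugate above [r |x| - M] also stay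
   above [e] times that bound. *)
pose e := (2 * K1)^-1.
have e0 : 0 < e by rewrite invr_gt0 mulr_gt0.
have e1 : e <= 1 by rewrite invf_le1 ?mulr_gt0//; lra.
pose J := fine (\int[leb]_x (expR (- (e * r * `|x|)))%:E).
have JE : (\int[leb]_x (expR (- (e * r * `|x|)))%:E = J%:E)%E.
  rewrite fineK// ge0_fin_numE.
    by apply: expR_norm_integrable; rewrite mulr_gt0.
  by apply: integral_ge0 => x _; rewrite lee_fin expR_ge0.
have J0 : 0 <= J.
  by rewrite -lee_fin -JE integral_ge0// => x _; rewrite lee_fin expR_ge0.
(* This makes [J < 1 + a / 2 <= exp (a / 2)], the inequality that excludes [h 0 = 0] at the end. *)
pose a := 2 * J + 1.
have a1 : 1 <= a by rewrite /a; lra.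
have a0 : 0 < a by lra.
pose C := a `^ p * I; pose M := K1 * a.
have M0 : 0 < M by rewrite mulr_gt0.
have CM : C < d * M `^ p.
  by rewrite /C /M powRM ?(ltW a0) ?(ltW K10)// mulrA mulrC ltr_pM2r// powR_gt0.
have adm_coer h : admissible mu p C h -> coercive r M h.
  by move=> [mh h0 _ hC] x; apply: coer CM x.
pose Sset := [set mass h | h in admissible mu p C].
have S_ub h : admissible mu p C h -> (mass h <= ereal_sup Sset)%E.
  by move=> hC; apply: ereal_sup_ubound; exists h.
have S_lb : ((expR a)%:E <= ereal_sup Sset)%E.
  by rewrite (le_trans (mass_cone a))// S_ub//; exact: admissible_cone.
have [S SE] : exists S, ereal_sup Sset = S%:E.
  exists (fine (ereal_sup Sset)); rewrite fineK// ge0_fin_numE; last first.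
    by rewrite (le_trans _ S_lb)// lee_fin expR_ge0.
  apply: (@le_lt_trans _ _ ((expR M)%:E * \int[leb]_x (expR (- (r * `|x|)))%:E)%E).
    by apply: ge_ereal_sup => _ [h /adm_coer hr <-]; exact: mass_coercive_le.
  by rewrite lte_mul_pinfty ?lee_fin ?expR_ge0//; exact: expR_norm_integrable.
rewrite SE in S_ub S_lb.
have S0 : 0 < S by rewrite (lt_le_trans (expR_gt0 a)).
have S2 : 0 < S / 2 by rewrite divr_gt0.
have [rho [K [rho0 K0 ball]]] := @legendre_ball R n r M r0 _ S2.
have ball' h : admissible mu p C h -> h = legendre (legendre h) ->
    ((S / 2)%:E <= mass h)%E ->
    forall x, `|x| <= rho -> (legendre h x <= K%:E)%E.
  move=> hC hE hm; have [_ h0 he _] := hC.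
  by apply: ball => //; exact: adm_coer.
(* The floor [S / 2] is what lets [legendre_ball] supply one [rho] and one [K] for the entire
   sequence. *)
have hk k : exists h, [/\ admissible mu p C h, h = legendre (legendre h) &
    ((Num.max (S - k.+1%:R^-1) (S / 2))%:E <= mass h)%E].
  have : ((Num.max (S - k.+1%:R^-1) (S / 2))%:E < ereal_sup Sset)%E.
    rewrite SE lte_fin gt_max ltrBlDr ltrDl invr_gt0 ltr0n/=; lra.
  move=> /ereal_sup_gt[_ [h hC <-] /ltW hm].
  exists (legendre (legendre h)); split.
  - exact: admissible_biconj.
  - by rewrite triconj.
  - by rewrite mass_biconj.
have {hk}[h hP] := choice hk.
have hadm k : admissible mu p C (h k) by case: (hP k).
have hball k x : `|x| <= rho -> (legendre (h k) x <= K%:E)%E.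
  have [hC hE hm] := hP k; apply: ball' => //.
  by rewrite (le_trans _ hm)// lee_fin le_max lexx orbT.
have hmass k : ((S - k.+1%:R^-1)%:E <= mass (h k))%E.
  by have [_ _ hm] := hP k; rewrite (le_trans _ hm)// lee_fin le_max lexx.
have [g gC gS] := selection p0 r0 rho0 (ltW S0) hadm
  (fun k => adm_coer _ (hadm k)) hball hmass.
have g'C := admissible_biconj gC.
rewrite -mass_biconj in gS.
set g' := legendre (legendre g) in g'C gS.
have g'E : g' = legendre (legendre g') by rewrite /g' triconj.
exists C, r, M, rho, K, g'; split; split => //.
- exact: adm_coer.
- apply: ball' => //; rewrite (le_trans _ gS)// lee_fin; lra.
- by rewrite (lt_le_trans _ gS)// lte_fin.
(* If [g' 0] were 0, its conjugate would be nonnegative, hence at least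
   [e (r |x| - M) = e r |x| - a / 2]. The mass would then be at most [exp (a / 2) J < exp a], less
   than what the cone achieves. *)
- have [_ g'0 _ _] := g'C; rewrite lt_neqAle g'0 andbT; apply/eqP => g00.
  have phi0 x : (0 <= legendre g' x)%E.
    by rewrite legendre_ge0// -g00.
  have : (mass g' <= (expR (a / 2))%:E * J%:E)%E.
    rewrite -JE -ge0_integralZl//; last exact: measurable_exp_norm.
    apply: ge0_le_integral => //.
    + by move=> x _; exact: exp_legendre_ge0.
    + exact: measurable_exp_legendre.
    + by apply: emeasurable_funM => //; exact: measurable_exp_norm.
    move=> x _; rewrite -EFinM -expRD.
    have : ((e * (r * `|x| - M))%:E <= legendre g' x)%E.
      have := adm_coer _ g'C x; have := phi0 x.
      case: (legendre g' x) => [v| |]//; last by move=> *; exact: leey.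
      rewrite !lee_fin => v0 vr; have [rM|rM] := leP 0 (r * `|x| - M).
        by rewrite (le_trans _ vr)// ler_piMl.
      by rewrite (le_trans _ v0)// pmulr_rle0// ltW.
    move=> /exp_legendre_le/le_trans; apply; rewrite lee_fin ler_expR.
    have -> : a / 2 = e * M by rewrite /e /M; field; rewrite gt_eqF.
    lra.
  rewrite leNgt; apply/negP/negPn; rewrite -EFinM (lt_le_trans _ gS)//.
  rewrite (lt_le_trans _ S_lb)// lte_fin.
  have -> : expR a = expR (a / 2) * expR (a / 2).
    by rewrite -expRD; congr expR; field.
  rewrite ltr_pM2l ?expR_gt0// (lt_le_trans _ (expR_ge1Dx _))//.
  rewrite /a; lra.
- by move=> h' /S_ub h'S; rewrite (le_trans h'S).
Qed.

End maximizer.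

(** * The Euler-Lagrange equation *)

(** The tangent bound of the concave power. After dividing by [v], it is Young's inequality for
    [(1 + s / v) ^ p] and 1 with exponents [1 / p] and [1 / (1 - p)]. *)
Lemma powR_bernoulli {R : realType} (p v s : R) : 0 < p < 1 -> 0 < v ->
  0 <= v + s -> (v + s) `^ p <= v `^ p + p * s * v `^ (p - 1).
Proof.
move=> /andP[p0 p1] v0 vs0.
have vn0 : v != 0 by rewrite gt_eqF.
have vsE : v + s = v * (1 + s / v) by field.
have u0 : 0 <= 1 + s / v by rewrite -(pmulr_rge0 _ v0) -vsE.
have -> : v `^ p + p * s * v `^ (p - 1) = v `^ p * (1 + p * (s / v)).
  rewrite -(mulr_powRB1 (ltW v0) p0); field; exact: vn0.
rewrite vsE powRM ?(ltW v0)// ler_wpM2l ?powR_ge0//.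
have q0 : 0 < 1 - p by rewrite subr_gt0.
have := @conjugate_powR R ((1 + s / v) `^ p) 1 p^-1 (1 - p)^-1.
rewrite powR_ge0 ler01 !invr_gt0 p0 q0 !invrK.
have -> : p + (1 - p) = 1 by ring.
move=> /(_ isT isT isT isT erefl).
rewrite mulr1 -powRrM mulfV ?gt_eqF// powRr1// powR1 mul1r => /le_trans; apply.
by rewrite le_eqVlt; apply/orP; left; apply/eqP; ring.
Qed.

Lemma exp_legendre_shift {R : realType} n (g h : 'rV[R]_n -> \bar R) x (s : R) :
  (legendre g x <= legendre h x + s%:E)%E ->
  ((expR (- s))%:E * exp_legendre h x <= exp_legendre g x)%E.
Proof.
move=> H; rewrite -[(expR (- s))%:E]/(expeR (- s)%:E) -expeRD lee_expeR.
by rewrite EFinN addeC -oppeD ?fin_num_adde_defl// leeN2.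
Qed.

(** * First variation of the mass under an indicator perturbation *)

Section first_variation.
Context {R : realType} {n : nat}.
Implicit Types (x y z : 'rV[R]_n) (A : set 'rV[R]_n).
Local Notation leb := (@lebesgue_rV R n).
Variable h : 'rV[R]_n -> \bar R.
Hypothesis hE : h = legendre (legendre h).
Local Notation phi := (legendre h).
Variables (r M rho K : R).
Hypotheses (r0 : 0 < r) (rho0 : 0 < rho) (hcoer : coercive r M h).
Hypothesis hball : forall x, `|x| <= rho -> (phi x <= K%:E)%E.

Lemma coercive_low x : (-oo < phi x)%E.
Proof. by rewrite (lt_le_trans _ (hcoer x))// ltNyr. Qed.

Let cvx : convex_ereal phi := @legendre_convex R n h.
Let mphi : measurable_fun setT phi := @measurable_legendre R n h.
Local Notation D := (gradient_dom phi).
Local Notation grad := (gradient_of phi).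

Lemma exp_legendre_dom_negl :
  leb.-negligible ([set x | (0 < exp_legendre h x)%E] `\` D).
Proof.
apply: negligibleS (gradient_dom_negl cvx coercive_low mphi rho0 hball).
move=> x [/= x0 xD]; split => //; rewrite /dom_phi /= ltNge leye_eq.
by apply/eqP => xy; rewrite /exp_legendre xy /= ltxx in x0.
Qed.

(** Points of positive density without a gradient form a null set, so the pushforward under the
    gradient keeps the total mass. *)
Lemma integral_gradient_dom : (\int[leb]_(x in D) exp_legendre h x = mass h)%E.
Proof.
have mD := measurable_gradient_dom cvx coercive_low mphi.
have mF := @measurable_exp_legendre R n h.
rewrite /mass -(setUv D) ge0_integral_setU//; last 4 first.
- exact: measurableC.
- by rewrite setUv.
- by move=> x _; exact: exp_legendre_ge0.
- by rewrite disj_set2E setICr.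
rewrite [X in (_ + X)%E](_ : _ = 0%E) ?adde0//.
have [N [mN N0 HN]] := exp_legendre_dom_negl.
apply/eqP; rewrite eq_le integral_ge0; last by move=> x _; exact: exp_legendre_ge0.
rewrite andbT (ge0_negligible_integral mN)//; last 3 first.
- exact: measurableC.
- exact: measurable_funTS.
- by move=> x _; exact: exp_legendre_ge0.
rewrite (eq_integral (cst 0%E)) ?integral0// => x.
rewrite inE => -[xD xN].
apply/eqP; rewrite eq_le exp_legendre_ge0 andbT leNgt; apply/negP => x0.
by apply: xN; apply: HN.
Qed.

Variables (A : set 'rV[R]_n) (kappa : R).
Hypotheses (oA : open A) (kappa0 : 0 <= kappa).

Definition perturb (t : R) y : \bar R := (h y + (t * (\1_A y - kappa))%:E)%E.

Lemma legendre_perturb_le t x : 0 <= t ->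
  (legendre (perturb t) x <= phi x + (t * kappa)%:E)%E.
Proof.
move=> t0; case phix : (phi x) => [c| |]; last 2 first.
- by rewrite addye// leey.
- by have := coercive_low x; rewrite phix.
rewrite -EFinD; apply/legendre_leP => y.
have /legendre_leP/(_ y) : (phi x <= c%:E)%E by rewrite phix.
rewrite /perturb => H; rewrite -leeBlDr// -EFinB (le_trans _ H)// lee_fin.
have : 0 <= t * \1_A y by rewrite mulr_ge0.
by lra.
Qed.

(** On [A] the perturbation raises [h] by [t - t kappa]. Off [A], slopes are at distance at least
    [d] from the gradient, and there the Fenchel-Young inequality has a gap of at least [e d / 2],
    which pays for the missing [t]. *)
Lemma legendre_perturb_grad x : D x -> A (grad x) -> exists2 e, 0 < e &
  forall t, 0 <= t <= e ->
    (legendre (perturb t) x <= phi x + (t * kappa - t)%:E)%E.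
Proof.
move=> xD xA; have xg := gradient_ofP xD.
have /(is_gradientP cvx coercive_low)[xU sl] := xg.
have phix := dom_phi_fin coercive_low (nbhs_singleton xU).
set c := fine (phi x) in phix; set y := grad x in xA xg sl.
have /nbhs_ballP[d /= d0 yd] : nbhs y A by exact: open_nbhs_nbhs.
have d2 : 0 < d / 2 by rewrite divr_gt0.
have [e e0 He] := slope_upper cvx coercive_low phix sl d2.
exists (e * (d / 2)); first exact: mulr_gt0.
move=> t /andP[t0 te]; rewrite phix -EFinD; apply/legendre_leP => y'.
rewrite /perturb -leeBlDr// -EFinB; have [yA|yA] := boolP (y' \in A).
  have /legendre_leP/(_ y') : (phi x <= c%:E)%E by rewrite phix.
  move=> H; rewrite (le_trans _ H)// lee_fin indicE yA /=; lra.
have yd' : d <= `|y' - y|.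
  rewrite leNgt; apply: contra yA => yy; rewrite inE; apply: yd.
  by rewrite -ball_normE /= distrC.
have yn0 : y' - y != 0 by rewrite -normr_gt0 (lt_le_trans d0).
have [i yi] := normr_coord yn0.
have [sg [sg1 sgE]] : exists sg, `|sg| = 1 /\ sg * (y' - y) ord0 i = `|y' - y|.
  exists (Num.sg ((y' - y) ord0 i)); split; last by rewrite yi normrEsg.
  by rewrite normr_sg -normr_gt0 -yi normr_gt0 yn0.
(* A step of length [e] along the coordinate where [y' - y] attains its sup norm gains
   [e |y' - y| >= e d], against an error of [e d / 2] from [slope_upper]. *)
pose z : 'rV[R]_n := (e * sg) *: delta_mx ord0 i.
have zn : `|z| <= e.
  by rewrite normrZ norm_delta mulr1 normrM sg1 mulr1 gtr0_norm.
have zE : dot z y' - dot z y = e * `|y' - y|.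
  rewrite -[- dot z y]dotNr -dotDr /z dotZl dotC dot_delta -sgE.
  by rewrite mulrA.
have n1z : norm1 z = e.
  rewrite /norm1 (bigD1 i)//= big1 ?addr0 => [|j ji]; last first.
    by rewrite !mxE (negbTE ji) andbF mulr0 normr0.
  by rewrite !mxE !eqxx mulr1 normrM sg1 mulr1 gtr0_norm.
have := fenchel_young y' (He z zn); rewrite -hE n1z => H.
rewrite (le_trans _ H)// lee_fin indicE (negbTE yA) dotDl [dot y' x]dotC /=.
have : e * d <= e * `|y' - y| by rewrite ler_pM2l.
by lra.
Qed.

(** The threshold in [legendre_perturb_grad] depends on the point; these are the points for which
    the given [t] already achieves the gain. *)
Definition gradient_perturb_set t : set 'rV[R]_n := (D `&` grad @^-1` A) `&`
  [set x | (legendre (perturb t) x <= phi x + (t * kappa - t)%:E)%E].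

Lemma measurable_gradient_preimage : measurable (D `&` grad @^-1` A).
Proof.
have mD := measurable_gradient_dom cvx coercive_low mphi.
apply: (measurable_gradient_of cvx coercive_low mphi mD).
exact: open_rV_measurable.
Qed.

Lemma measurable_gradient_perturb_set t : measurable (gradient_perturb_set t).
Proof.
apply: measurableI; first exact: measurable_gradient_preimage.
rewrite -[X in measurable X]setTI; apply: measurable_lee => //.
  exact: measurable_legendre.
exact: emeasurable_funD.
Qed.

(** The perturbed density is at least [exp (- t kappa)] times the old one, with a further factor
    [exp t] on the set of gain. Integrating, then using [exp t - 1 >= t] and [exp (t kappa) - 1 <= t
    kappa exp (t kappa)], lets [t] be divided out. *)
Lemma perturb_mass_bound t : 0 < t -> (mass (perturb t) <= mass h)%E ->
  (mass h < +oo)%E ->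
  (\int[leb]_(x in gradient_perturb_set t) exp_legendre h x <=
    (kappa * expR (t * kappa))%:E * mass h)%E.
Proof.
move=> t0 tm hfin.
have mE := measurable_gradient_perturb_set t.
set E := gradient_perturb_set t in mE *.
have mF := @measurable_exp_legendre R n h.
have F0 x : (0 <= exp_legendre h x)%E by exact: exp_legendre_ge0.
have t1 : 0 < expR t - 1 by rewrite subr_gt0 expR_gt1.
have Ffin x : exists2 f, exp_legendre h x = f%:E & 0 <= f.
  exists (fine (exp_legendre h x)); last exact: fine_ge0.
  rewrite fineK// ge0_fin_numE// (le_lt_trans (exp_legendre_le (hcoer x)))//.
  exact: ltry.
have pw x : ((expR (- (t * kappa)))%:E * (exp_legendre h x + (expR t - 1)%:E *
    (exp_legendre h \_ E) x) <= exp_legendre (perturb t) x)%E.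
  rewrite patchE; case: ifPn => [|_].
    rewrite inE => -[_ /= /exp_legendre_shift]; apply: le_trans.
    have [f -> f0] := Ffin x; rewrite -!EFinM lee_fin.
    have -> : expR (- (t * kappa - t)) = expR (- (t * kappa)) * expR t.
      by rewrite -expRD; congr expR; ring.
    by rewrite -mulrA ler_pM2l ?expR_gt0//; lra.
  rewrite [point](_ : _ = 0%E)// mule0 adde0; apply: exp_legendre_shift.
  by apply: legendre_perturb_le; exact: ltW.
have mFE : measurable_fun setT (exp_legendre h \_ E).
  exact/(measurable_restrictT _ mE)/measurable_funTS.
have FE0 x : (0 <= (exp_legendre h \_ E) x)%E by rewrite patchE; case: ifP.
have : ((expR (- (t * kappa)))%:E * (mass h + (expR t - 1)%:E *
    \int[leb]_(x in E) exp_legendre h x) <= mass h)%E.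
  apply: le_trans tm; rewrite [X in (_ * (_ + _ * X))%E]integral_mkcond.
  rewrite -ge0_integralZl//; last by rewrite lee_fin ltW.
  rewrite -ge0_integralD//; last 2 first.
  - by move=> x _; rewrite mule_ge0// lee_fin ltW.
  - exact: emeasurable_funM.
  rewrite -ge0_integralZl//; last 2 first.
  - by apply: emeasurable_funD => //; exact: emeasurable_funM.
  - by move=> x _; rewrite adde_ge0// mule_ge0// lee_fin ltW.
  apply: ge0_le_integral => //.
  - by move=> x _; rewrite mule_ge0 ?lee_fin ?expR_ge0// adde_ge0// mule_ge0// lee_fin ltW.
  - apply: emeasurable_funM => //; apply: emeasurable_funD => //.
    exact: emeasurable_funM.
  - exact: measurable_exp_legendre.
have Efin : (\int[leb]_(x in E) exp_legendre h x < +oo)%E.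
  apply: le_lt_trans hfin; apply: ge0_subset_integral => //.
have E0 : (0 <= \int[leb]_(x in E) exp_legendre h x)%E by exact: integral_ge0.
have [m mE'] : exists m, mass h = m%:E.
  by exists (fine (mass h)); rewrite fineK// ge0_fin_numE// mass_ge0.
have m0 : 0 <= m by rewrite -lee_fin -mE' mass_ge0.
have [a aE] : exists a, (\int[leb]_(x in E) exp_legendre h x = a%:E)%E.
  by exists (fine (\int[leb]_(x in E) exp_legendre h x)%E); rewrite fineK// ge0_fin_numE.
rewrite aE in E0 *; rewrite mE' -!EFinM !lee_fin expRN in E0 *.
rewrite ler_pdivrMl ?expR_gt0// => H.
have et : t <= expR t - 1 by have := expR_ge1Dx t; lra.
have H1 : expR (t * kappa) - 1 <= t * kappa * expR (t * kappa).
  have := expR_ge1Dx (- (t * kappa)); rewrite expRN => H2.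
  have := ler_wpM2r (expR_ge0 (t * kappa)) H2.
  by rewrite mulVf ?gt_eqF ?expR_gt0//; lra.
have H3 : t * a <= t * (kappa * expR (t * kappa) * m).
  rewrite (le_trans (ler_wpM2r E0 et))//.
  have := ler_wpM2r m0 H1; lra.
by rewrite ler_pM2l// in H3.
Qed.

(* Fatou along t = t0 / (j + 1): the sets gradient_perturb_set t exhaust
   D `&` grad @^-1` A as t decreases to 0. *)
Lemma gradient_preimage_bound (t0 : R) : 0 < t0 ->
  (forall t, 0 < t <= t0 -> (mass (perturb t) <= mass h)%E) ->
  (mass h < +oo)%E ->
  (\int[leb]_(x in D `&` grad @^-1` A) exp_legendre h x <=
    kappa%:E * mass h)%E.
Proof.
move=> t00 ht hfin; pose t (j : nat) := t0 / j.+1%:R.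
have tj0 j : 0 < t j by rewrite divr_gt0.
have tjt0 j : t j <= t0 by rewrite ler_pdivrMr// ler_peMr// ?ler1n// ltW.
have cvt : t @ \oo --> (0 : R).
  rewrite -(mulr0 t0); apply: (@cvgM R); first exact: cvg_cst.
  exact: cvg_harmonic.
have mF := @measurable_exp_legendre R n h.
have F0 x : (0 <= exp_legendre h x)%E by exact: exp_legendre_ge0.
pose E j := gradient_perturb_set (t j).
have mE j : measurable (E j) by exact: measurable_gradient_perturb_set.
have mFE j : measurable_fun setT (exp_legendre h \_ (E j)).
  exact/(measurable_restrictT _ (mE j))/measurable_funTS.
have FE0 j x : (0 <= (exp_legendre h \_ (E j)) x)%E by rewrite patchE; case: ifP.
apply: (@le_trans _ _ (\int[leb]_x limn_einf (fun j => (exp_legendre h \_ (E j)) x))%E).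
  rewrite integral_mkcond; apply: ge0_le_integral => //.
  - by move=> x _; rewrite patchE; case: ifP.
  - apply/(measurable_restrictT _ measurable_gradient_preimage).
    exact: measurable_funTS.
  - exact: measurable_fun_limn_einf.
  move=> x _; rewrite patchE; case: ifPn => [|_]; last first.
    by apply: limn_einf_ge0 => j; exact: FE0.
  rewrite inE => -[xD xA]; have [e e0 He] := legendre_perturb_grad xD xA.
  have [N _ HN] : \forall j \near \oo, t j <= e.
    by exact: (@cvgr_le R nat \oo _ t 0 cvt e e0).
  rewrite limn_einfE.
  apply: (@le_trans _ _ (einfs (fun j => (exp_legendre h \_ (E j)) x) N)); last first.
    by apply: ereal_sup_ubound; exists N.
  apply: le_ereal_inf_tmp => _ [k /= Nk <-]; rewrite patchE mem_set//; split => //=.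
  by apply: He; rewrite HN// ltW.
apply: (le_trans (fatou leb measurableT mFE (fun j x _ => FE0 j x))).
have [m mE'] : exists m, mass h = m%:E.
  by exists (fine (mass h)); rewrite fineK// ge0_fin_numE// mass_ge0.
have cv : (fun j => (kappa * expR (t j * kappa))%:E * mass h)%E @ \oo -->
    (kappa%:E * mass h)%E.
  rewrite mE' -EFinM; under eq_fun do rewrite -EFinM.
  apply: cvg_EFin; first exact: nearW.
  apply: (@cvgM R); last exact: cvg_cst.
  rewrite -[X in _ --> X]mulr1; apply: (@cvgM R); first exact: cvg_cst.
  rewrite -(expR0 R) -(mul0r kappa).
  apply: (@continuous_cvg _ _ _ _ _ _ expR); first exact: continuous_expR.
  by apply: (@cvgM R) => //; exact: cvg_cst.
rewrite -(cvg_limn_einf_sup cv).1; apply: le_limn_einf => j.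
rewrite -integral_mkcond; apply: perturb_mass_bound => //.
by apply: ht; rewrite tj0 tjt0.
Qed.

End first_variation.

(** * Integration against a measure given by a density *)

Section density.
Local Open Scope ereal_scope.
Context d (T : measurableType d) (R : realType).
Variables (m : {measure set T -> \bar R}) (F : T -> \bar R).
Hypotheses (mF : measurable_fun setT F) (F0 : forall x, 0 <= F x).

Lemma integral_semi_sigma_additive :
  semi_sigma_additive (fun A => \int[m]_(x in A) F x).
Proof.
move=> A mA tA mUA.
rewrite ge0_integral_bigcup//; last exact: measurable_funTS.
by apply: is_cvg_nneseries => k _ _; exact: integral_ge0.
Qed.

Import HBNNSimple.

Lemma integral_density_nnsfun (nu : {measure set T -> \bar R})
    (s : {nnsfun T >-> R}) :
  (forall A, measurable A -> nu A = \int[m]_(x in A) F x) ->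
  \int[nu]_x (s x)%:E = \int[m]_x ((s x)%:E * F x).
Proof.
move=> nuE.
have mind (r : R) : measurable_fun setT (fun x => (\1_(s @^-1` [set r]) x : R)%:E).
  exact/measurable_EFinP/measurable_indic.
rewrite integralT_nnsfun sintegralE.
under [RHS]eq_integral.
  move=> x _; rewrite fimfunE -fsumEFin// ge0_mule_fsuml; last first.
    by move=> r; rewrite EFinM nnfun_muleindic_ge0.
  over.
rewrite [RHS]ge0_integral_fsum//; last 2 first.
- move=> r; apply: emeasurable_funM => //.
  by under eq_fun do rewrite EFinM; exact: measurable_funeM.
- by move=> r x _; rewrite mule_ge0// EFinM nnfun_muleindic_ge0.
apply: eq_fsbigr => r _.
under [RHS]eq_integral do rewrite EFinM -muleA.
have [r0|r0] := leP 0%R r; last first.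
  rewrite (_ : s @^-1` [set r] = set0); last first.
    rewrite -subset0 => x /= sx; have : (0 <= s x)%R by [].
    by rewrite sx leNgt r0.
  rewrite measure0 mule0; apply/esym/integral0_eq => x _.
  by rewrite indic0 mul0e mule0.
rewrite ge0_integralZl//; last 2 first.
- exact: emeasurable_funM.
- by move=> x _; rewrite mule_ge0// lee_fin.
rewrite nuE//; congr (_ * _).
rewrite integral_mkcond; apply: eq_integral => x _.
by rewrite patchE indicE; case: ifP => _; rewrite ?mul1e ?mul0e.
Qed.

(** Simple functions increase to [k], and monotone convergence applies on both sides; finiteness of
    [F] lets the products converge pointwise. *)
Lemma ge0_integral_density (nu : {measure set T -> \bar R}) (k : T -> \bar R) :
  (forall x, F x \is a fin_num) ->
  (forall A, measurable A -> nu A = \int[m]_(x in A) F x) ->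
  measurable_fun setT k -> (forall x, 0 <= k x) ->
  forall A, measurable A -> \int[nu]_(x in A) k x = \int[m]_(x in A) (k x * F x).
Proof.
move=> Ffin nuE mk k0 A mA.
suff H : forall k' : T -> \bar R, measurable_fun setT k' -> (forall x, 0 <= k' x) ->
    \int[nu]_x k' x = \int[m]_x (k' x * F x).
  rewrite integral_mkcond H//; last 2 first.
  - exact/(measurable_restrictT _ mA)/measurable_funTS.
  - by move=> x; rewrite patchE; case: ifP.
  rewrite [RHS]integral_mkcond; apply: eq_integral => x _.
  by rewrite !patchE; case: ifP => _ //; rewrite mul0e.
move=> {}k {}mk {}k0.
pose s := nnsfun_approx measurableT mk.
have cvs x : (EFin \o s^~ x) @ \oo --> k x.
  exact: (cvg_nnsfun_approx measurableT mk (fun x _ => k0 x)).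
have nds x : {homo (fun j => (s j x)%:E) : i j / (i <= j)%N >-> i <= j}.
  by move=> i j ij; rewrite lee_fin; exact/lefP/nd_nnsfun_approx.
have ms j : measurable_fun setT (fun x => (s j x)%:E) by exact/measurable_EFinP.
have E1 : \int[nu]_x k x = limn (fun j => \int[nu]_x (s j x)%:E).
  rewrite -monotone_convergence//; last by move=> j x _; rewrite lee_fin.
  by apply: eq_integral => x _; apply/esym/cvg_lim => //; exact: cvs.
have E2 : \int[m]_x (k x * F x) = limn (fun j => \int[m]_x ((s j x)%:E * F x)).
  rewrite -monotone_convergence//; last 3 first.
  - by move=> j; exact: emeasurable_funM.
  - by move=> j x _; rewrite mule_ge0// lee_fin.
  - by move=> x _ i j ij; rewrite lee_wpmul2r//; exact: nds.
  apply: eq_integral => x _; apply/esym/cvg_lim => //.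
  by apply: cvgeZr => //; exact: cvs.
rewrite E1 E2; congr (limn _); apply/funext => j.
exact: integral_density_nnsfun.
Qed.

End density.

(** * Identification of the surface area measure of the maximizer *)

Section euler_lagrange.
Context {R : realType} {n : nat}.
Implicit Types (x y z : 'rV[R]_n) (A B : set 'rV[R]_n).
Local Notation leb := (@lebesgue_rV R n).
Variable mu : {finite_measure set 'rV[R]_n -> \bar R}.
Hypotheses (mu_even : even_measure mu) (muT_gt0 : (0 < mu setT)%E).
Variables (p C : R) (h : 'rV[R]_n -> \bar R).
Hypotheses (p01 : 0 < p < 1) (hadm : admissible mu p C h).
Hypothesis hE : h = legendre (legendre h).
Local Notation phi := (legendre h).
Variables (r M rho K : R).
Hypotheses (r0 : 0 < r) (rho0 : 0 < rho) (hcoer : coercive r M h).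
Hypothesis hball : forall x, `|x| <= rho -> (phi x <= K%:E)%E.
Hypotheses (mass_gt0 : (0 < mass h)%E) (h0_gt0 : (0 < h 0%R)%E).
Hypothesis hmax : forall g, admissible mu p C g -> (mass g <= mass h)%E.

Let p0 : 0 < p. Proof. by case/andP: p01. Qed.
Let p1 : p < 1. Proof. by case/andP: p01. Qed.
Let mh : measurable_fun setT h. Proof. by case: hadm. Qed.
Let h_ge0 x : (0 <= h x)%E. Proof. by case: hadm. Qed.
Let h_even x : h (- x) = h x. Proof. by case: hadm. Qed.
Let hC : (\int[mu]_x (h x `^ p) <= C%:E)%E. Proof. by case: hadm. Qed.
Let mhp : measurable_fun setT (fun x => h x `^ p)%E.
Proof. exact: (measurableT_comp (measurable_poweR p) mh). Qed.

Let h_fin_ae : mu [set x | h x = +oo%E] = 0%E.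
Proof.
have ih : mu.-integrable setT (fun x => h x `^ p)%E.
  apply/integrableP; split => //.
  under eq_integral do rewrite gee0_abs ?poweR_ge0//.
  by rewrite (le_lt_trans hC)// ltry.
have [N [mN N0 HN]] := integrable_ae measurableT ih.
apply/eqP; rewrite -measure_le0 -N0 le_measure ?inE//.
  by rewrite -[X in measurable X]setTI; apply: measurable_eqe.
by move=> x /= hx; apply: HN => /= /(_ I); rewrite hx poweRyr// gt_eqF.
Qed.

Let h_min x : (h 0%R <= h x)%E.
Proof. by rewrite hE; apply: legendre0_le; exact: legendre_even. Qed.

Let h0_fin : exists2 a : R, h 0%R = a%:E & 0 < a.
Proof.
have [x hx] : exists x, h x != +oo%E.
  apply: contrapT => /forallNP hoo; move: muT_gt0.
  rewrite (_ : setT = [set x | h x = +oo%E]) ?h_fin_ae ?ltxx//.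
  by apply/esym; rewrite -subTset => x _ /=; apply/eqP/negPn/negP/hoo.
move: h0_gt0 (h_min x); case: (h 0%R) => [a| |]//; first by exists a.
by rewrite leye_eq (negbTE hx).
Qed.

(** Represents [h ^ (p - 1)]. Where [h] is [+oo], [fine] returns 0 and 0 to the nonzero power
    [p - 1] is 0, which is the right limiting value. *)
Let w y : R := fine (h y) `^ (p - 1).

Let mw : measurable_fun setT w.
Proof.
apply: (measurableT_comp (measurable_powR (p - 1))).
exact: (measurableT_comp (fine_measurable measurableT) mh).
Qed.

Let w_ge0 y : 0 <= w y. Proof. exact: powR_ge0. Qed.

Let mEw : measurable_fun setT (fun y => (w y)%:E).
Proof. exact/measurable_EFinP. Qed.

Let w_even y : w (- y) = w y. Proof. by rewrite /w h_even. Qed.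

(** The exponent is negative and [h] is smallest at 0, so positivity of [h 0] bounds the weight and
    makes [W] finite. *)
Let w_le a y : h 0%R = a%:E -> 0 < a -> w y <= a `^ (p - 1).
Proof.
move=> ha a0; have p1' : p - 1 != 0 by rewrite lt_eqF// subr_lt0.
have := h_min y; rewrite ha /w; case: (h y) => [v| |]//=.
- rewrite lee_fin => av; rewrite -opprB !powRN lef_pV2 ?posrE ?powR_gt0//.
    apply: ge0_ler_powR; rewrite ?nnegrE ?subr_ge0 ?(ltW p1) ?(ltW a0)//.
    by rewrite (le_trans (ltW a0)).
  exact: lt_le_trans av.
- by move=> _; rewrite powR0// powR_ge0.
Qed.

Let w_fin A : measurable A -> (\int[mu]_(y in A) (w y)%:E < +oo)%E.
Proof.
move=> mA; have [a ha a0] := h0_fin.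
apply: (@le_lt_trans _ _ (\int[mu]_(y in A) (a `^ (p - 1))%:E)%E).
  apply: ge0_le_integral => //.
  - by move=> y _; rewrite lee_fin.
  - exact: measurable_funTS.
  - by move=> y _; rewrite lee_fin w_le.
rewrite integral_cst// lte_mul_pinfty ?lee_fin ?powR_ge0//.
by rewrite -ge0_fin_numE// fin_num_measure.
Qed.

Let W A : R := fine (\int[mu]_(y in A) (w y)%:E).

Let WE A : measurable A -> (\int[mu]_(y in A) (w y)%:E = (W A)%:E)%E.
Proof.
move=> mA; rewrite fineK// ge0_fin_numE ?w_fin// integral_ge0// => y _.
by rewrite lee_fin.
Qed.

Let W_ge0 A : 0 <= W A.
Proof. by rewrite fine_ge0// integral_ge0// => y _; rewrite lee_fin. Qed.

Let WT_gt0 : 0 < W setT.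
Proof.
rewrite lt_neqAle W_ge0 andbT; apply/eqP => /esym W0.
have iw : (\int[mu]_y `|(w y)%:E| = 0)%E.
  rewrite -[RHS]/(0%:E) -W0 -WE//; apply: eq_integral => y _.
  by rewrite gee0_abs ?lee_fin.
have /(ae_eq_integral_abs _ measurableT mEw)[N [mN N0 HN]] := iw.
move: muT_gt0; rewrite lt_neqAle => /andP[/eqP muT _]; apply: muT.
apply/esym/eqP; rewrite -measure_le0.
rewrite (@le_trans _ _ (mu (N `|` [set x | h x = +oo%E])))//.
  rewrite le_measure ?inE//.
    apply: measurableU => //.
    by rewrite -[X in measurable X]setTI; apply: measurable_eqe.
  move=> y _; have [hy|hy] := pselect (h y = +oo%E); [by right|left].
  apply: HN => /= /(_ I) [] /eqP; rewrite powR_eq0 => /andP[/eqP hy0 _].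
  have [a ha a0] := h0_fin.
  have := h_min y; rewrite ha; case: (h y) hy hy0 => [v| |]//= _ ->.
  by rewrite lee_fin leNgt a0.
have mN' : measurable [set x | h x = +oo%E].
  by rewrite -[X in measurable X]setTI; apply: measurable_eqe.
rewrite (le_trans (measureU2 _ mN mN'))//.
rewrite -[leRHS]adde0; apply: leeD; rewrite le_eqVlt; apply/orP; left; apply/eqP.
  exact: N0.
exact: h_fin_ae.
Qed.

Let W_le A : measurable A -> W A <= W setT.
Proof.
move=> mA; rewrite -lee_fin -!WE//; apply: ge0_subset_integral => //.
by move=> y _; rewrite lee_fin.
Qed.

(** The ratio [W A / W setT] gives [\1_A] minus it zero integral against the weight [w]; by
    [powR_bernoulli] the constraint integral then does not increase. The bound [t <= h 0] keeps the
    competitor nonnegative. *)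
Let perturb_admissible A t a : open A -> (forall y, A (- y) <-> A y) ->
  h 0%R = a%:E -> 0 < t <= a ->
  admissible mu p C (perturb h A (W A / W setT) t).
Proof.
move=> oA symA ha /andP[t0 ta]; set k := _ / _.
have mA := open_rV_measurable oA.
have k0 : 0 <= k by rewrite divr_ge0.
have k1 : k <= 1 by rewrite ler_pdivrMr// mul1r W_le.
have a0 : 0 < a by exact: lt_le_trans ta.
have tk : t * k <= a by rewrite (le_trans _ ta)// ler_piMr// ltW.
have mpert : measurable_fun setT (perturb h A k t).
  have mI : measurable_fun setT (\1_A : 'rV[R]_n -> R) by exact: measurable_indic.
  apply: emeasurable_funD => //; apply/measurable_EFinP.
  by apply: measurable_funM => //; exact: measurable_funB.
have s_ge y : - a <= t * (\1_A y - k).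
  have : 0 <= t * \1_A y by rewrite mulr_ge0// ltW.
  by lra.
have pert0 y : (0 <= perturb h A k t y)%E.
  have := h_min y; rewrite ha /perturb.
  case: (h y) => [v| |]//; last by move=> _; rewrite addye.
  by rewrite -EFinD !lee_fin => av; have := s_ge y; lra.
split => //.
  move=> y; rewrite /perturb h_even !indicE.
  suff -> : (- y \in A) = (y \in A) by [].
  by apply/idP/idP; rewrite !inE => /symA.
(* The negative part of the tangent term stands on the left, so that only nonnegative functions are
   integrated; where [h] is [+oo] the right side is [+oo]. *)
have key y : (perturb h A k t y `^ p + (p * t * k)%:E * (w y)%:E <=
    h y `^ p + (p * t)%:E * ((\1_A y)%:E * (w y)%:E))%E.
  have := pert0 y; have := h_min y; rewrite ha /w /perturb.
  case: (h y) => [v| |]; last by [].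
  2: by move=> _ _; rewrite addye// poweRyr ?gt_eqF// [leRHS]addye// leey.
  rewrite -EFinD !lee_fin => av vs; rewrite [fine _]/=.
  have v0 : 0 < v by exact: lt_le_trans av.
  have := powR_bernoulli p01 v0 vs.
  set V := v `^ (p - 1); set X := (v + _) `^ p; set Y := v `^ p.
  by lra.
have mind : measurable_fun setT (fun y => (\1_A y : R)%:E).
  exact/measurable_EFinP/measurable_indic.
have m1 : measurable_fun setT (fun y => perturb h A k t y `^ p)%E.
  exact: (measurableT_comp (measurable_poweR p) mpert).
have pt0 : 0 <= p * t by rewrite mulr_ge0 ?ltW.
have ptk0 : 0 <= p * t * k by rewrite mulr_ge0.
have i1 : (\int[mu]_y (perturb h A k t y `^ p + (p * t * k)%:E * (w y)%:E) =
    \int[mu]_y (perturb h A k t y `^ p) + (p * t * W A)%:E)%E.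
  rewrite ge0_integralD//; do ?[exact: measurable_funeM
    | by move=> y _; exact: poweR_ge0 | by move=> y _; rewrite -EFinM lee_fin mulr_ge0].
  rewrite ge0_integralZl//; do ?[by move=> y _; rewrite lee_fin].
  rewrite WE// -EFinM; congr (_ + _%:E)%E.
  by rewrite /k -!mulrA mulVf ?mulr1// gt_eqF.
have i2 : (\int[mu]_y (h y `^ p + (p * t)%:E * ((\1_A y)%:E * (w y)%:E)) =
    \int[mu]_y (h y `^ p) + (p * t * W A)%:E)%E.
  have m2 : measurable_fun setT (fun y => (\1_A y : R)%:E * (w y)%:E)%E.
    exact: emeasurable_funM.
  rewrite ge0_integralD//; do ?[exact: measurable_funeM
    | by move=> y _; exact: poweR_ge0
    | by move=> y _; rewrite mule_ge0// mule_ge0// lee_fin].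
  rewrite ge0_integralZl//; do ?[by move=> y _; rewrite -EFinM lee_fin mulr_ge0].
  rewrite [in RHS]EFinM -WE//; congr (_ + _ * _)%E.
  rewrite [RHS]integral_mkcond; apply: eq_integral => y _; rewrite patchE indicE.
  by case: ifP => _; rewrite ?mul1e ?mul0e.
have : (\int[mu]_y (perturb h A k t y `^ p) + (p * t * W A)%:E <=
    \int[mu]_y (h y `^ p) + (p * t * W A)%:E)%E.
  rewrite -i1 -i2; apply: ge0_le_integral => //.
  - by move=> y _; rewrite adde_ge0 ?poweR_ge0// -EFinM lee_fin mulr_ge0.
  - by apply: emeasurable_funD => //; exact: measurable_funeM.
  - apply: emeasurable_funD => //; apply: measurable_funeM.
    exact: emeasurable_funM.
by rewrite leeD2rE// => /le_trans; apply.
Qed.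

(** The surface area measure of the density, with the gradient as a function on its domain;
    [surface_exp_legendre] matches it with the official definition. *)
Definition surface A := (\int[leb]_(x in gradient_dom phi `&`
  gradient_of phi @^-1` A) exp_legendre h x)%E.

Let surface_le A : open A -> (forall y, A (- y) <-> A y) ->
  (surface A <= (W A / W setT)%:E * mass h)%E.
Proof.
move=> oA symA; have [a ha a0] := h0_fin.
rewrite /surface; apply: (gradient_preimage_bound hE hcoer oA a0).
- by move=> t ta; apply: hmax; exact: perturb_admissible ta.
- exact: mass_coercive_fin hcoer.
Qed.

Let cvx : convex_ereal phi := @legendre_convex R n h.
Let low x : (-oo < phi x)%E := coercive_low hcoer x.
Let mphi : measurable_fun setT phi := @measurable_legendre R n h.
Let mD := measurable_gradient_dom cvx low mphi.
Let mF := @measurable_exp_legendre R n h.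
Let F0 x : (0 <= exp_legendre h x)%E := exp_legendre_ge0 h x.

Let mpre A : measurable A ->
  measurable (gradient_dom phi `&` gradient_of phi @^-1` A).
Proof. by move=> mA; exact: (measurable_gradient_of cvx low mphi mD). Qed.

Let surface_set0 : surface set0 = 0%E.
Proof. by rewrite /surface preimage_set0 setI0 integral_set0. Qed.

Let surface_ge0 A : (0 <= surface A)%E.
Proof. by apply: integral_ge0 => x _; exact: F0. Qed.

Let surface_sigma : semi_sigma_additive surface.
Proof.
move=> B mB tB mUB.
rewrite /surface preimage_bigcup setI_bigcupr.
apply: (@integral_semi_sigma_additive _ _ R leb _ mF F0
  (fun k => gradient_dom phi `&` gradient_of phi @^-1` B k)).
- by move=> k; exact: mpre.
- apply/trivIsetP => i j _ _ ij; move/trivIsetP : tB => /(_ i j I I ij) tB.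
  rewrite -subset0 => x [[_ xi] [_ xj]].
  by have : (B i `&` B j) (gradient_of phi x) by []; rewrite tB.
- by apply: bigcup_measurable => k _; exact: mpre.
Qed.

Lemma surface_measure_subproof : isMeasure _ 'rV[R]_n R surface.
Proof.
exact: (isMeasure.Build _ 'rV[R]_n R surface surface_set0 surface_ge0 surface_sigma).
Qed.

Let S : {measure set 'rV[R]_n -> \bar R} := HB.pack surface surface_measure_subproof.

Let mass_fin : (mass h < +oo)%E := mass_coercive_fin r0 hcoer.

Let surfaceT : surface setT = mass h.
Proof.
by rewrite /surface preimage_setT setIT (integral_gradient_dom rho0 hcoer hball).
Qed.

Let m : R := fine (mass h).
Let mE : mass h = m%:E.
Proof. by rewrite fineK// ge0_fin_numE// mass_ge0. Qed.
Let m_gt0 : 0 < m. Proof. by rewrite -lte_fin -mE. Qed.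

(** The constant of the theorem; this normalization gives the weighted measure the same total mass
    as [surface]. *)
Let lam : R := m / W setT.
Let lam_gt0 : 0 < lam. Proof. exact: divr_gt0. Qed.

Let dens y : \bar R := (lam * w y)%:E.
Let dens_ge0 y : (0 <= dens y)%E.
Proof. by rewrite lee_fin mulr_ge0// ltW. Qed.
Let mdens : measurable_fun setT dens.
Proof. by apply/measurable_EFinP; apply: measurable_funM. Qed.

Let target A := (\int[mu]_(y in A) dens y)%E.

Let targetE A : measurable A -> target A = (lam * W A)%:E.
Proof.
move=> mA; rewrite EFinM -WE// -ge0_integralZl//; do ?[exact: measurable_funTS
  | by rewrite lee_fin ltW | by move=> y _; rewrite lee_fin].
Qed.

Lemma target_measure_subproof : isMeasure _ 'rV[R]_n R target.
Proof.
apply: (isMeasure.Build _ 'rV[R]_n R target).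
- exact: integral_set0.
- by move=> A; exact: integral_ge0.
- exact: integral_semi_sigma_additive.
Qed.

Let nu : {measure set 'rV[R]_n -> \bar R} := HB.pack target target_measure_subproof.

Let nuS_T : nu setT = S setT.
Proof.
rewrite [RHS]surfaceT [LHS]targetE// mE /lam; congr EFin.
by rewrite mulfVK// gt_eqF.
Qed.

Let S_fin A : measurable A -> (S A < +oo)%E.
Proof.
move=> mA; apply: le_lt_trans mass_fin; rewrite -surfaceT.
by apply: (@le_measure _ _ _ S); rewrite ?inE.
Qed.

Let nu_fin A : measurable A -> (nu A < +oo)%E.
Proof. by move=> mA; rewrite [X in (X < _)%E]targetE// ltry. Qed.

Let sym A := forall y, A (- y) <-> A y.

Let S_le_nu A : open A -> sym A -> (S A <= nu A)%E.
Proof.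
move=> oA sA; apply: (le_trans (surface_le oA sA)).
rewrite [leRHS]targetE; last exact: open_rV_measurable.
rewrite mE -EFinM lee_fin /lam.
by rewrite le_eqVlt; apply/orP; left; apply/eqP; field; rewrite gt_eqF.
Qed.

(** Both measures have the same finite total mass, so the inequality on the open symmetric
    complement reverses on [B]. *)
Let nu_le_S_closed B : measurable B -> open (~` B) -> sym B -> (nu B <= S B)%E.
Proof.
move=> mB oB sB.
have sCB : sym (~` B) by move=> y; split => H /sB.
have := S_le_nu oB sCB.
have SC : (S (~` B) = S setT - S B)%E.
  by rewrite -setTD measureD// ?setTI// S_fin.
have nC : (nu (~` B) = nu setT - nu B)%E.
  by rewrite -setTD measureD// ?setTI// nu_fin.
rewrite SC nC nuS_T.
have [s ->] : exists s, S setT = s%:E.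
  by exists (fine (S setT)); rewrite fineK// ge0_fin_numE// S_fin.
have [a ->] : exists s, S B = s%:E.
  by exists (fine (S B)); rewrite fineK// ge0_fin_numE// S_fin.
have [b ->] : exists s, nu B = s%:E.
  by exists (fine (nu B)); rewrite fineK// ge0_fin_numE// nu_fin.
by rewrite -!EFinB !lee_fin lerD2l lerN2.
Qed.

(** [A] is exhausted by the closed symmetric sets of points at distance at least [1 / (k + 1)] from
    its complement; the inequality passes through continuity from below. *)
Let nu_le_S_open A : open A -> sym A -> (nu A <= S A)%E.
Proof.
move=> oA sA; have mA := open_rV_measurable oA.
pose B (k : nat) := [set y : 'rV[R]_n | forall z, ~ A z -> k.+1%:R^-1 <= `|y - z|].
have oB k : open (~` B k).
  rewrite openE => y /existsNP[z /not_implyP[Az /negP]]; rewrite -ltNge => yz.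
  apply/nbhs_ballP; exists (k.+1%:R^-1 - `|y - z|); first by rewrite /= subr_gt0.
  move=> u; rewrite -ball_normE /= => yu /(_ z Az); apply/negP; rewrite -ltNge.
  rewrite (le_lt_trans (ler_distD y u z))// -ltrBrDr distrC.
  exact: yu.
have mB k : measurable (B k).
  by rewrite -[B k]setCK; apply: measurableC; exact: open_rV_measurable.
have sB k : sym (B k).
  suff H y : B k y -> B k (- y) by move=> y; split => [/H|/H//]; rewrite opprK.
  move=> By z Az; have := By (- z) _; rewrite -opprD normrN opprK; apply.
  by move/sA.
have ndB : nondecreasing_seq B.
  move=> i j ij; apply/subsetPset => y By z Az; rewrite (le_trans _ (By z Az))//.
  by rewrite lef_pV2 ?posrE// ler_nat ltnS.
have AE : A = \bigcup_k B k.
  apply/seteqP; split => y.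
    move=> Ay; have /nbhs_ballP[e /= e0 ye] : nbhs y A by exact: open_nbhs_nbhs.
    exists (Num.truncn e^-1) => // z Az; rewrite leNgt; apply/negP => yz; apply: Az.
    apply: ye; rewrite -ball_normE /= (lt_le_trans yz)//.
    by rewrite invf_ple ?posrE// ltW// truncnS_gt.
  move=> [k _ By]; apply: contrapT => Ay; have := By y Ay.
  by rewrite subrr normr0 leNgt invr_gt0 ltr0n.
have mUB : measurable (\bigcup_k B k) by rewrite -AE.
have cvB : (nu \o B) @ \oo --> nu A.
  by rewrite [X in nu X]AE; exact: nondecreasing_cvg_mu.
apply: (cvge_to_le cvB); apply: nearW => k /=.
rewrite (le_trans (nu_le_S_closed (mB k) (oB k) (sB k)))//.
by apply: le_measure; rewrite ?inE// AE; apply: bigcup_sup.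
Qed.

Let nuS_sym A : open A -> sym A -> nu A = S A.
Proof. by move=> oA sA; apply/le_anti; rewrite nu_le_S_open// S_le_nu. Qed.

(** The reflection, written as an affine map so that [ge0_integral_affine_rV] applies to it. *)
Let T x : 'rV[R]_n := -1 *: x + 0.
Let TE x : T x = - x. Proof. by rewrite /T addr0 scaleN1r. Qed.
Let mT : measurable_fun setT T. Proof. exact: measurable_affine_rV. Qed.

Let phi_even x : phi (- x) = phi x. Proof. exact: legendre_even. Qed.

Let S_even A : measurable A -> S (T @^-1` A) = S A.
Proof.
move=> mA; rewrite /S /= /surface [LHS]integral_mkcond [RHS]integral_mkcond.
set Q := gradient_dom phi `&` gradient_of phi @^-1` A.
have mQ : measurable Q by exact: mpre.
transitivity (\int[leb]_x (exp_legendre h \_ Q) (-1 *: x + 0)%R)%E.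
  apply: eq_integral => x _; rewrite !patchE addr0 scaleN1r.
  rewrite (_ : (x \in _) = (- x \in Q)); last first.
    apply/idP/idP; rewrite !inE => -[xD].
      rewrite /= TE => xA; split; first exact/(gradient_dom_opp cvx low phi_even).
      by rewrite /= (gradient_of_opp cvx low phi_even).
    move/(gradient_dom_opp cvx low phi_even) : xD => xD.
    by rewrite /= (gradient_of_opp cvx low phi_even)//= -TE.
  by case: ifP => // _; rewrite /exp_legendre phi_even.
have mQF : measurable_fun setT (exp_legendre h \_ Q).
  by apply/(measurable_restrictT _ mQ); exact: measurable_funTS.
have n10 : -1 != 0 :> R by rewrite oppr_eq0 oner_eq0.
rewrite (ge0_integral_affine_rV 0 n10 mQF); last by move=> x; rewrite patchE; case: ifP.
by rewrite normrN1 expr1n invr1 mul1e.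
Qed.

Let nu_even A : measurable A -> nu (T @^-1` A) = nu A.
Proof.
move=> mA.
transitivity (\int[pushforward mu T]_(y in A) dens y)%E.
  rewrite ge0_integral_pushforward//; last exact: measurable_funTS.
  by apply: eq_integral => y _; rewrite /= /dens TE w_even.
apply: eq_measure_integral => B mB _.
rewrite /= /pushforward -(mu_even mB); congr (mu _).
apply/seteqP; split => y /=; first by rewrite TE => By; exists (- y); rewrite ?opprK.
by move=> [z Bz <-]; rewrite TE opprK.
Qed.

(** The union and the intersection of [A] with its reflection are symmetric. Additivity on them and
    evenness of both measures give [2 nu A = 2 S A], which removes the symmetry assumption. *)
Let nuS_open A : open A -> nu A = S A.
Proof.
move=> oA.
have oTA : open (T @^-1` A).
  rewrite (_ : T = -%R); last by apply/funext => x; rewrite TE.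
  apply: open_comp => // x _; exact: oppr_continuous.
have mA := open_rV_measurable oA; have mTA := open_rV_measurable oTA.
have sU : sym (A `|` T @^-1` A).
  by move=> y; rewrite /setU /= !TE opprK; split => -[]; [right|left|right|left].
have sI : sym (A `&` T @^-1` A).
  by move=> y; rewrite /setI /= !TE opprK; split => -[].
have := nuS_sym (openU oA oTA) sU.
have uN := measureUfinl mA mTA (nu_fin mA).
have uS := measureUfinl mA mTA (S_fin mA).
rewrite uN uS (nuS_sym (openI oA oTA) sI) nu_even// S_even//.
have [s ->] : exists s, S (A `&` T @^-1` A) = s%:E.
  by eexists; rewrite -[LHS]fineK// ge0_fin_numE// S_fin//; exact: measurableI.
have [a ->] : exists s, S A = s%:E.
  by eexists; rewrite -[LHS]fineK// ge0_fin_numE// S_fin.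
have [b ->] : exists s, nu A = s%:E.
  by eexists; rewrite -[LHS]fineK// ge0_fin_numE// nu_fin.
rewrite -!EFinD => -[ab]; congr EFin.
lra.
Qed.

Let nuS A : measurable A -> nu A = S A.
Proof.
move=> mA.
apply: (@measure_unique _ _ _ (@open 'rV[R]_n) (fun=> setT)) => //.
- by move=> X Y; exact: openI.
- by move=> k; exact: openT.
- by rewrite bigcup_const//; exists 0%N.
- by move=> k; apply: nu_fin; exact: measurableT.
Qed.

Lemma euler_lagrange : exists2 c : R, 0 < c & forall A, measurable A ->
  (\int[surface]_(y in A) (h y `^ (1 - p)) = c%:E * mu A)%E.
Proof.
exists lam => // A mA.
have mh1 : measurable_fun setT (fun y => h y `^ (1 - p))%E.
  exact: (measurableT_comp (measurable_poweR (1 - p)) mh).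
have h10 y : (0 <= h y `^ (1 - p))%E by exact: poweR_ge0.
transitivity (\int[nu]_(y in A) (h y `^ (1 - p)))%E.
  by apply: (@eq_measure_integral _ _ _ A nu S) => B mB _; apply/esym; exact: nuS.
rewrite (@ge0_integral_density _ _ _ mu dens mdens dens_ge0 nu)//.
rewrite -integral_cst//; apply: ge0_ae_eq_integral => //.
- by apply: emeasurable_funM => //; exact: measurable_funTS.
- by move=> y _; rewrite mule_ge0.
- by move=> y _; rewrite lee_fin ltW.
(* Outside this null set [h] is a positive real and the powers [1 - p] and [p - 1] cancel; on it the
   weight is 0 and cancellation fails. *)
exists [set y | h y = +oo%E]; split => //.
  by rewrite -[X in measurable X]setTI; apply: measurable_eqe.
move=> y /=; apply: contra_notP => hy _.
have [a ha a0] := h0_fin.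
have := h_min y; rewrite ha /dens /w.
case: (h y) hy => [v| |]//= _; rewrite lee_fin => av.
have v0 : 0 < v by exact: lt_le_trans av.
rewrite -EFinM; congr EFin.
rewrite mulrCA -powRD; last by rewrite (gt_eqF v0) implybT.
rewrite (_ : 1 - p + (p - 1) = 0) ?powRr0 ?mulr1//.
lra.
Qed.

End euler_lagrange.

(** * The density as a member of the class of log-concave functions *)

Section exp_legendre_LC.
Context {R : realType} {n : nat}.
Implicit Types (x y z : 'rV[R]_n).
Variable h : 'rV[R]_n -> \bar R.
Local Notation phi := (legendre h).
Hypothesis low : forall x, (-oo < phi x)%E.
Let f x : R := fine (exp_legendre h x).

Lemma fine_exp_legendre x : (fine (exp_legendre h x))%:E = exp_legendre h x.
Proof. by rewrite /exp_legendre; move: (low x); case: (phi x). Qed.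

Lemma potential_exp_legendre : potential f = phi.
Proof.
by apply/funext => x; rewrite /potential fine_exp_legendre /exp_legendre expeRK oppeK.
Qed.

Let f_ge0 x : 0 <= f x.
Proof. by rewrite fine_ge0// exp_legendre_ge0. Qed.

Lemma upper_semicontinuous_exp_legendre : upper_semicontinuous f.
Proof.
(* For [a >= 0] the superlevel set of [- f] is empty; for [a < 0] taking logarithms turns it into an
   open superlevel set of the conjugate. *)
apply/lower_semicontinuousP => a; have [a0|a0] := leP 0 a.
  rewrite (_ : [set _ | _] = set0); first exact: open0.
  rewrite -subset0 => x /=; rewrite lte_fin => ax.
  by have := f_ge0 x; rewrite -oppr_le0 leNgt (le_lt_trans a0 ax).
rewrite (_ : [set _ | _] = [set x | (- ln (- a))%:E < phi x]%E).
  exact: legendre_open.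
have na0 : 0 < - a by rewrite oppr_gt0.
have H x : (a%:E < (- f x)%:E)%E = ((- ln (- a))%:E < phi x)%E.
  rewrite EFinN lteNr -EFinN fine_exp_legendre -[in LHS](lnK na0).
  by rewrite -[(expR _)%:E]/(expeR (ln (- a))%:E) lte_expeR lteNl.
by apply/funext => x /=; rewrite H.
Qed.

Lemma log_concave_exp_legendre : log_concave f.
Proof.
move=> x y t /andP[t0 t1].
have t1' : 1 - t != 0 by rewrite subr_eq0 gt_eqF.
have := @legendre_convex R n h x y; rewrite /f /exp_legendre.
(* Where the conjugate is [+oo] the density is 0, and so is its power because the exponents [1 - t]
   and [t] are nonzero. *)
case: (phi x) (low x) => [c| |]// _; last by rewrite powR0// mul0r => _; exact: f_ge0.
case: (phi y) (low y) => [d| |]// _.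
  2: by rewrite (powR0 (lt0r_neq0 t0)) mulr0 => _; exact: f_ge0.
move=> /(_ c d (1 - t)); rewrite subKr => cvx.
have tt : 0 <= 1 - t <= 1 by lra.
have {cvx tt} := cvx tt (lexx _) (lexx _).
rewrite /= -!expRM -expRD.
case: (phi _) (low ((1 - t) *: x + t *: y)) => [e| |]//= _.
rewrite lee_fin ler_expR; lra.
Qed.

Lemma LC_exp_legendre : LC f.
Proof.
split; [exact: f_ge0|exact: upper_semicontinuous_exp_legendre|].
exact: log_concave_exp_legendre.
Qed.

Lemma surface_exp_legendre : surface_area_measure f = surface h.
Proof.
apply/funext => A; rewrite /surface_area_measure potential_exp_legendre.
rewrite gradient_preimage; apply: eq_integral => x _.
exact: fine_exp_legendre.
Qed.

End exp_legendre_LC.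

(** The zero measure is supported on every hyperplane, and hyperplanes exist since [n > 0]. *)
Lemma measure_setT_gt0 (R : realType) (n : nat)
  (mu : {measure set 'rV[R]_n -> \bar R}) : (0 < n)%N ->
  (forall H : set 'rV[R]_n, hyperplane H -> ~ supported_on mu H) ->
  (0 < mu setT)%E.
Proof.
move=> n_gt0 mu_hyperplane; rewrite lt_neqAle measure_ge0 andbT; apply/eqP => mu0.
pose e : 'rV[R]_n := delta_mx ord0 (Ordinal n_gt0).
have e0 : e != 0.
  by apply/eqP => /rowP/(_ (Ordinal n_gt0))/eqP; rewrite !mxE !eqxx oner_eq0.
apply: (mu_hyperplane [set x | dot x e = 0]); first by exists e, 0.
apply/eqP; rewrite -measure_le0 [leRHS]mu0 le_measure ?inE//.
apply: measurableC; rewrite -[X in measurable X]setTI.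
exact: (measurable_dot e measurableT (measurable_set1 0)).
Qed.

Unset Implicit Arguments.

Local Open Scope ereal_scope.

Theorem theorem4p8 (R : realType) (n : nat) (n_gt0 : (0 < n)%N)
  (p : R) (p01 : (0 < p < 1)%R)
  (mu : {finite_measure set 'rV[R]_n -> \bar R})
  (mu_even : even_measure mu)
  (mu_moment : \int[mu]_x (enorm x)%:E < +oo)
  (mu_hyperplane : forall H : set 'rV[R]_n, hyperplane H -> ~ supported_on mu H) :
  exists (c : R) (f : 'rV[R]_n -> R),
    [/\ (0 < c)%R, LC f /\ even_fun f,
        0 < \int[@lebesgue_rV R n]_x (f x)%:E < +oo,
        forall y, 0 <= support_fun f y
      & forall A : set 'rV[R]_n, measurable A ->
          Lp_surface_area_measure p f A = c%:E * mu A].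
Proof.
have muT := measure_setT_gt0 n_gt0 mu_hyperplane.
have [C [r [M [rho [K [h [[hadm hE r0 rho0 hcoer] [hball m0 h0 hmax]]]]]]]] :=
  maximizer_exists mu_even mu_moment mu_hyperplane n_gt0 p01.
have low := coercive_low hcoer.
have [c c0 hc] := euler_lagrange mu_even muT p01 hadm hE r0 rho0 hcoer hball m0 h0 hmax.
have [_ h_ge0 h_even _] := hadm.
pose f x : R := fine (exp_legendre h x).
have supp : support_fun f = h.
  rewrite [RHS]hE; apply/funext => y.
  by rewrite /support_fun (potential_exp_legendre low).
exists c, f; split => //.
- split; first exact: LC_exp_legendre.
  by move=> x; rewrite /f /exp_legendre legendre_even.
- under eq_integral do rewrite (fine_exp_legendre low).
  by rewrite m0 (mass_coercive_fin r0 hcoer).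
- by rewrite supp.
- move=> A mA; rewrite -hc// /Lp_surface_area_measure supp.
  by rewrite (surface_exp_legendre low).
Qed.
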